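(* Let $n\ge 3$ be odd, let $0\le k\le n-1$ be an integer, and let $X$ be the set of non-crossing partitions of $[n]=\{1,\dots,n\}$ with exactly $n-k$ blocks, with the action of the dihedral group $I_2(n)$ induced by its natural action on $[n]$. Then the triple $$\left(X,\ \frac{1}{\{n\}_{s,t}}\genfrac{\{}{\}}{0pt}{}{n}{k}_{s,t}\genfrac{\{}{\}}{0pt}{}{n}{k+1}_{s,t},\ I_2(n)\right)$$ exhibits dihedral sieving.
   Context: A set partition of $[n]$ is non-crossing if its blocks do not cross when drawn on a disk whose boundary is labelled clockwise with $1,2,\dots,n$ (i.e. there are no $a<b<c<d$ with $a,c$ in one block and $b,d$ in a different block). $I_2(n)=\langle r,s \mid r^n=s^2=e,\ rs=sr^{-1}\rangle$ is the dihedral group of order $2n$. Its natural action on $[n]$ is the one on the vertices of a regular $n$-gon labelled cyclically by $1,\dots,n$ ($r$ acts as $i\mapsto i+1$ and $s$ as $i\mapsto -i$ modulo $n$). $\operatorname{Rep}(I_2(n))$ is the representation ring: the ring generated by isomorphism classes $[U]$ of finite-dimensional complex representations, with $[U\oplus V]=[U]+[V]$ and $[U\otimes V]=[U][V]$. For $n$ odd it is generated as a ring by $z_1$ and $\det$ (hence by $z_1$ and $-\det$). Here $z_1$ is the 2-dimensional representation sending $r$ to the rotation by $2\pi/n$ and $s$ to a reflection matrix, and $\det$ is the 1-dimensional representation with $\det(r)=1$, $\det(s)=-1$. Dihedral sieving: for $n$ odd, a finite $I_2(n)$-set $X$ and a polynomial $P(s,t)\in\mathbb{Z}[s,t]$,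 the triple $(X,P(s,t),I_2(n))$ exhibits dihedral sieving if $\mathbb{C}[X]=P(z_1,-\det)$ in $\operatorname{Rep}(I_2(n))$, where $\mathbb{C}[X]$ is the permutation representation. (The polynomial variable $s$ is unrelated to the group element $s$.) Generalized Fibonacci polynomials: $\{0\}_{s,t}=0$, $\{1\}_{s,t}=1$, $\{m+2\}_{s,t}=s\{m+1\}_{s,t}+t\{m\}_{s,t}$. Put $\{m\}!_{s,t}=\{m\}_{s,t}\{m-1\}_{s,t}\cdots\{1\}_{s,t}$ (with $\{0\}!_{s,t}=1$). The Fibonomial coefficient is $\genfrac{\{}{\}}{0pt}{}{m}{k}_{s,t}=\dfrac{\{m\}!_{s,t}}{\{k\}!_{s,t}\{m-k\}!_{s,t}}$, which is known to be a polynomial in $s,t$ with nonnegative integer coefficients. The expression $\frac{1}{\{n\}_{s,t}}\genfrac{\{}{\}}{0pt}{}{n}{k}_{s,t}\genfrac{\{}{\}}{0pt}{}{n}{k+1}_{s,t}$ is likewise a polynomial in $s,t$ with integer coefficients. *)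

(* Defs.v *)
From HB Require Import structures.
From mathcomp Require Import all_boot all_order all_algebra all_fingroup.
From mathcomp Require Import all_solvable.
From mathcomp Require Import generic_quotient fraction polyXY.
From mathcomp Require Import mxrepresentation character.
From mathcomp Require Import boolp reals trigo.
From mathcomp Require Import complex mxtens.
From mathcomp Require Import ring zify.
Set Implicit Arguments.
Unset Strict Implicit.
Unset Printing Implicit Defensive.
Import Order.TTheory GRing.Theory Num.Theory.
Local Open Scope ring_scope.

(* The ring of formal differences of elements of a commutative semiring S. *)
Section GrothendieckRing.
Variable S : comPzSemiRingType.
Local Open Scope quotient_scope.
Implicit Types x y z : S * S.

Definition groth_eq x y := `[< exists e : S, x.1 + y.2 + e = y.1 + x.2 + e >].

Lemma groth_eqP x y :
  reflect (exists e, x.1 + y.2 + e = y.1 + x.2 + e) (groth_eq x y).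
Proof. exact: asboolP. Qed.

Lemma groth_eq_refl : reflexive groth_eq.
Proof. by move=> x; apply/groth_eqP; exists 0. Qed.

Lemma groth_eq_sym : symmetric groth_eq.
Proof. by move=> x y; apply/groth_eqP/groth_eqP => -[e he]; exists e. Qed.

Lemma groth_eq_trans : transitive groth_eq.
Proof.
move=> y x z /groth_eqP[e he] /groth_eqP[f hf]; apply/groth_eqP.
exists (y.1 + y.2 + e + f).
transitivity ((x.1 + y.2 + e) + (y.1 + z.2 + f)); first by ring.
by rewrite he hf; ring.
Qed.

Canonical groth_equiv :=
  EquivRel groth_eq groth_eq_refl groth_eq_sym groth_eq_trans.

Definition groth := {eq_quot groth_equiv}.
HB.instance Definition _ := Choice.on groth.
HB.instance Definition _ := EqQuotient.on groth.

Definition groth_class x : groth := \pi_groth x.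

Lemma groth_classP x y : groth_eq x y <-> groth_class x = groth_class y.
Proof.
split=> [xy | xy]; first by apply/eqquotP.
exact/(@eqquotP _ groth_equiv groth)/xy.
Qed.

Lemma groth_ind (P : groth -> Prop) :
  (forall x, P (groth_class x)) -> forall u, P u.
Proof. by move=> h u; rewrite -(reprK u); apply: h. Qed.

Lemma groth_reprP x : groth_eq (repr (groth_class x)) x.
Proof. by apply/eqquotP; apply: reprK. Qed.

Definition groth_add (u v : groth) := groth_class
  ((repr u).1 + (repr v).1, (repr u).2 + (repr v).2).
Definition groth_opp (u : groth) := groth_class ((repr u).2, (repr u).1).
Definition groth_mul (u v : groth) := groth_class
  ((repr u).1 * (repr v).1 + (repr u).2 * (repr v).2,
   (repr u).1 * (repr v).2 + (repr u).2 * (repr v).1).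

Lemma groth_addE x y : groth_add (groth_class x) (groth_class y) =
  groth_class (x.1 + y.1, x.2 + y.2).
Proof.
apply/groth_classP/groth_eqP => /=.
have /groth_eqP[e he] := groth_reprP x; have /groth_eqP[f hf] := groth_reprP y.
exists (e + f); set a := repr _ in he *; set b := repr _ in hf *.
transitivity ((a.1 + x.2 + e) + (b.1 + y.2 + f)); first by ring.
by rewrite he hf; ring.
Qed.

Lemma groth_oppE x : groth_opp (groth_class x) = groth_class (x.2, x.1).
Proof.
apply/groth_classP/groth_eqP => /=.
have /groth_eqP[e he] := groth_reprP x.
exists e; set a := repr _ in he *.
transitivity (x.1 + a.2 + e); first by ring.
by rewrite -he; ring.
Qed.

Lemma groth_mulE x y : groth_mul (groth_class x) (groth_class y) =
  groth_class (x.1 * y.1 + x.2 * y.2, x.1 * y.2 + x.2 * y.1).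
Proof.
apply/groth_classP/groth_eqP => /=.
have /groth_eqP[e he] := groth_reprP x; have /groth_eqP[f hf] := groth_reprP y.
set a := repr _ in he *; set b := repr _ in hf *.
exists (e * (b.1 + b.2) + f * (x.1 + x.2) + (x.1 + x.2) * (b.1 + b.2)).
transitivity ((a.1 + x.2 + e) * b.1 + (x.1 + a.2 + e) * b.2
   + x.1 * (b.1 + y.2 + f) + x.2 * (y.1 + b.2 + f)); first by ring.
by rewrite he -[in X in _ + X * b.2]he hf -[in X in _ + x.2 * X]hf; ring.
Qed.

Fact groth_addA : associative groth_add.
Proof.
elim/groth_ind => x; elim/groth_ind => y; elim/groth_ind => z.
by rewrite !groth_addE /= !addrA.
Qed.

Fact groth_addC : commutative groth_add.
Proof.
elim/groth_ind => x; elim/groth_ind => y.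
by rewrite !groth_addE /= [x.1 + _]addrC [x.2 + _]addrC.
Qed.

Fact groth_add0 : left_id (groth_class (0, 0)) groth_add.
Proof. by elim/groth_ind => -[x1 x2]; rewrite groth_addE /= !add0r. Qed.

Fact groth_addN : left_inverse (groth_class (0, 0)) groth_opp groth_add.
Proof.
elim/groth_ind => x; rewrite groth_oppE groth_addE; apply/groth_classP/groth_eqP.
by exists 0 => /=; ring.
Qed.

Fact groth_mulA : associative groth_mul.
Proof.
elim/groth_ind => x; elim/groth_ind => y; elim/groth_ind => z.
by rewrite !groth_mulE /=; congr groth_class; congr pair; ring.
Qed.

Fact groth_mulC : commutative groth_mul.
Proof.
elim/groth_ind => x; elim/groth_ind => y.
by rewrite !groth_mulE /=; congr groth_class; congr pair; ring.
Qed.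

Fact groth_mul1 : left_id (groth_class (1, 0)) groth_mul.
Proof.
elim/groth_ind => -[x1 x2].
by rewrite groth_mulE /=; congr groth_class; congr pair; ring.
Qed.

Fact groth_mulD : left_distributive groth_mul groth_add.
Proof.
elim/groth_ind => x; elim/groth_ind => y; elim/groth_ind => z.
rewrite groth_addE !groth_mulE groth_addE /=.
by congr groth_class; congr pair; ring.
Qed.

End GrothendieckRing.

(* Rep is the Grothendieck ring of the semiring of isomorphism classes (for
   mx_rsim) of finite-dimensional representations of G over F, with direct sum
   and tensor product. *)
Section RepresentationRing.
Variables (F : fieldType) (gT : finGroupType) (G : {group gT}).
Local Notation representation := (representation F G).
Implicit Types U V W : representation.
Local Open Scope quotient_scope.

HB.instance Definition _ := gen_eqMixin representation.
HB.instance Definition _ := gen_choiceMixin representation.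

Definition rep_iso U V := `[< mx_rsim U V >].

Lemma rep_isoP U V : reflect (mx_rsim U V) (rep_iso U V).
Proof. exact: asboolP. Qed.

Lemma rep_iso_refl : reflexive rep_iso.
Proof. by move=> U; apply/rep_isoP/mx_rsim_refl. Qed.

Lemma rep_iso_sym : symmetric rep_iso.
Proof. by move=> U V; apply/rep_isoP/rep_isoP; apply: mx_rsim_sym. Qed.

Lemma rep_iso_trans : transitive rep_iso.
Proof.
by move=> V U W /rep_isoP UV /rep_isoP VW; apply/rep_isoP/(mx_rsim_trans UV).
Qed.

Canonical rep_iso_equiv :=
  EquivRel rep_iso rep_iso_refl rep_iso_sym rep_iso_trans.

Definition iso_class := {eq_quot rep_iso_equiv}.
HB.instance Definition _ := Choice.on iso_class.
HB.instance Definition _ := EqQuotient.on iso_class.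

Definition iso_class_of U : iso_class := \pi_iso_class U.

Lemma iso_classP U V : mx_rsim U V <-> iso_class_of U = iso_class_of V.
Proof.
split=> [/rep_isoP UV | UV]; first by apply/eqquotP.
have : rep_iso U V by apply/(@eqquotP _ rep_iso_equiv iso_class)/UV.
by move/rep_isoP.
Qed.

Lemma iso_class_ind (P : iso_class -> Prop) :
  (forall U, P (iso_class_of U)) -> forall u, P u.
Proof. by move=> h u; rewrite -(reprK u); apply: h. Qed.

Lemma iso_class_reprP U : mx_rsim (repr (iso_class_of U)) U.
Proof. by apply/iso_classP; apply: reprK. Qed.

Lemma rsim_index n1 n2 (rG1 : mx_representation F G n1)
    (rG2 : mx_representation F G n2) (f : 'I_n1 -> 'I_n2) :
    bijective f ->
    {in G, forall g i j, rG2 g (f i) (f j) = rG1 g i j} ->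
  mx_rsim rG1 rG2.
Proof.
move=> bij_f rf; have /esym en : n1 = n2.
  by have /bij_eq_card := bij_f; rewrite !card_ord.
subst n2; case: bij_f => h fK hK.
exists (\matrix_(i, j) (f i == j)%:R) => //.
  apply/row_freeP; exists (\matrix_(i, j) (h i == j)%:R).
  apply/matrixP => i j; rewrite !mxE (bigD1 (f i)) //= big1 => [|k ki].
    by rewrite !mxE eqxx fK mul1r addr0.
  by rewrite !mxE eq_sym (negPf ki) mul0r.
move=> g Gg; apply/matrixP => i j; rewrite !mxE.
rewrite (bigD1 (h j)) //= big1 => [|k kj]; last first.
  by rewrite !mxE -(inj_eq (can_inj hK)) fK (negPf kj) mulr0.
rewrite [RHS](bigD1 (f i)) //= big1 => [|k ki]; last first.
  by rewrite !mxE eq_sym (negPf ki) mul0r.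
by rewrite !mxE hK !eqxx mul1r mulr1 !addr0 -(rf g Gg) hK.
Qed.

Lemma trowE n1 m2 n2 (A : 'rV[F]_n1) (B : 'M[F]_(m2, n2)) i K :
  trow A B i K = A 0 (mxtens_unindex K).1 * B i (mxtens_unindex K).2.
Proof.
elim: n1 A K => [A [] //|n1 IH A K] /=.
have n2_gt0 : (0 < n2)%N by case: (n2) K => // -[m]; rewrite muln0.
rewrite mxE; case: splitP => k def_k; rewrite ?IH !mxE; congr (A _ _ * B _ _);
  apply: val_inj; rewrite /= def_k.
- by rewrite divn_small.
- by rewrite modn_small.
- by rewrite divnDl ?dvdnn // divnn n2_gt0.
- by rewrite modnDl.
Qed.

Lemma tprod_tens m1 n1 m2 n2 (A : 'M[F]_(m1, n1)) (B : 'M[F]_(m2, n2)) :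
  tprod A B = tensmx A B.
Proof.
elim: m1 A => [A | m1 IH A] /=; first by apply/matrixP => -[].
apply/matrixP => K L; rewrite [RHS]mxE.
have m2_gt0 : (0 < m2)%N by case: (m2) K => // -[m]; rewrite muln0.
rewrite mxE; case: splitP => k def_k; rewrite ?IH ?trowE !mxE;
  congr (A _ _ * B _ _); apply: val_inj; rewrite /= ?def_k.
- by rewrite divn_small.
- by rewrite modn_small.
- by rewrite divnDl ?dvdnn // divnn m2_gt0.
- by rewrite modnDl.
Qed.

Lemma rsim_dadd U U' V V' : mx_rsim U U' -> mx_rsim V V' ->
  mx_rsim (dadd_grepr U V) (dadd_grepr U' V').
Proof.
case=> [B eB fB hB] [C eC fC hC].
exists (block_mx B 0 0 C); first by rewrite /= eB eC.
  case/row_freeP: fB => B' BB'; case/row_freeP: fC => C' CC'.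
  apply/row_freeP; exists (block_mx B' 0 0 C').
  by rewrite mulmx_block !(mulmx0, mul0mx, addr0, add0r) BB' CC' -scalar_mx_block.
move=> g Gg /=.
by rewrite !mulmx_block !(mulmx0, mul0mx, addr0, add0r) hB // hC.
Qed.

Definition tensor_rep U V : representation := Representation (prod_repr U V).

Lemma rsim_tensor U U' V V' : mx_rsim U U' -> mx_rsim V V' ->
  mx_rsim (tensor_rep U V) (tensor_rep U' V').
Proof.
case=> [B eB fB hB] [C eC fC hC].
exists (tprod B C); first by rewrite /= eB eC.
  case/row_freeP: fB => B' BB'; case/row_freeP: fC => C' CC'.
  by apply/row_freeP; exists (tprod B' C'); rewrite -tprodE BB' CC' tprod1.
by move=> g Gg /=; rewrite -!tprodE hB // hC.
Qed.

Fact triv_mx_repr : mx_repr G (fun _ : gT => 1%:M : 'M[F]_1).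
Proof. by split=> // g h _ _; rewrite mulmx1. Qed.

Definition triv_rep := Representation (MxRepresentation triv_mx_repr).


Lemma dadd_repA U V W :
  mx_rsim (dadd_grepr U (dadd_grepr V W)) (dadd_grepr (dadd_grepr U V) W).
Proof.
case: U V W => [a U] [b V] [c W].
apply: (@rsim_index _ _ _ _ (cast_ord (addnA a b c))).
  by exists (cast_ord (esym (addnA a b c))) => i; apply: val_inj.
have El i : cast_ord (addnA a b c) (lshift _ i) = lshift _ (lshift _ i).
  exact: val_inj.
have Em i : cast_ord (addnA a b c) (rshift _ (lshift _ i)) =
            lshift _ (rshift _ i) by exact: val_inj.
have Er i : cast_ord (addnA a b c) (rshift _ (rshift _ i)) = rshift _ i.
  by apply: val_inj; rewrite /= addnA.
move=> g Gg i j /=.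
case: (split_ordP i) => [k ->|k ->]; last case: (split_ordP k) => {}k ->;
case: (split_ordP j) => [l ->|l ->]; try case: (split_ordP l) => {}l ->;
by rewrite ?(El, Em, Er) !(block_mxEul, block_mxEur, block_mxEdl, block_mxEdr)
     ?mxE.
Qed.

Lemma dadd_repC U V : mx_rsim (dadd_grepr U V) (dadd_grepr V U).
Proof.
case: U V => [a U] [b V].
pose f m n (i : 'I_(m + n)) : 'I_(n + m) :=
  match split i with inl j => rshift _ j | inr j => lshift _ j end.
have fl m n (i : 'I_m) : f m n (lshift _ i) = rshift _ i.
  by rewrite /f -[lshift _ i]/(unsplit (inl i)) unsplitK.
have fr m n (i : 'I_n) : f m n (rshift _ i) = lshift _ i.
  by rewrite /f -[rshift _ i]/(unsplit (inr i)) unsplitK.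
apply: (@rsim_index _ _ _ _ (f a b)).
  by exists (f b a) => i; case: (split_ordP i) => j ->; rewrite ?(fl, fr).
move=> g Gg i j /=.
by case: (split_ordP i) => k ->; case: (split_ordP j) => l ->;
  rewrite ?(fl, fr) !(block_mxEul, block_mxEur, block_mxEdl, block_mxEdr).
Qed.

Lemma dadd_rep0 U : mx_rsim (dadd_grepr grepr0 U) U.
Proof.
case: U => [a U]; apply: (@rsim_index _ _ _ _ id); first by exists id.
have E (i : 'I_a) : i = rshift 0 i :> 'I_(0 + a) by apply: val_inj.
by move=> g Gg i j /=; rewrite [in RHS](E i) [in RHS](E j) block_mxEdr.
Qed.

Lemma tensor_repE U V g i j k l :
  tensor_rep U V g (mxtens_index (i, j)) (mxtens_index (k, l)) =
  U g i k * V g j l.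
Proof. by rewrite /= tprod_tens tensmxE. Qed.

Lemma tensor_repA U V W :
  mx_rsim (tensor_rep U (tensor_rep V W)) (tensor_rep (tensor_rep U V) W).
Proof.
apply: (@rsim_index _ _ _ _ (cast_ord (mulnA _ _ _))).
  by exists (cast_ord (esym (mulnA _ _ _))) => i; apply: val_inj.
have E i j k : cast_ord (mulnA _ _ _)
    (mxtens_index (i, mxtens_index (j, k))) =
    mxtens_index (mxtens_index (i, j), k)
    :> 'I_(rdegree U * rdegree V * rdegree W).
  by apply: val_inj; rewrite /= mulnDl mulnA addnA.
move=> g Gg I J; case: (mxtens_indexP I) => i {}I.
case: (mxtens_indexP I) => i' i''; case: (mxtens_indexP J) => j {}J.
by case: (mxtens_indexP J) => j' j''; rewrite !E /= !tprod_tens !tensmxE mulrA.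
Qed.

Lemma tensor_repC U V : mx_rsim (tensor_rep U V) (tensor_rep V U).
Proof.
pose f m n (i : 'I_(m * n)) : 'I_(n * m) :=
  mxtens_index ((mxtens_unindex i).2, (mxtens_unindex i).1).
have fE m n i j : f m n (mxtens_index (i, j)) = mxtens_index (j, i).
  by rewrite /f mxtens_indexK.
apply: (@rsim_index _ _ _ _ (f _ _)).
  by exists (f _ _) => I; case: (mxtens_indexP I) => i j; rewrite !fE.
move=> g Gg I J; case: (mxtens_indexP I) => i i'.
by case: (mxtens_indexP J) => j j'; rewrite !fE /= !tprod_tens !tensmxE mulrC.
Qed.

Lemma tensor_rep1 U : mx_rsim (tensor_rep triv_rep U) U.
Proof.
pose f (i : 'I_(1 * rdegree U)) := (mxtens_unindex i).2.
have fE i j : f (mxtens_index (i, j)) = j by rewrite /f mxtens_indexK.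
apply: (@rsim_index _ _ _ _ f).
  exists (fun j => mxtens_index (0, j)) => [I|j]; last exact: fE.
  by case: (mxtens_indexP I) => i j; rewrite (ord1 i) (fE 0 j).
move=> g Gg I J; case: (mxtens_indexP I) => i i'.
case: (mxtens_indexP J) => j j'; rewrite !fE.
have -> : tensor_rep triv_rep U g = tensmx 1%:M (U g) by apply: tprod_tens.
rewrite tensmxE.
by rewrite (ord1 i) (ord1 j) mxE mul1r.
Qed.

Lemma tensor_repDl U V W : mx_rsim (tensor_rep (dadd_grepr U V) W)
  (dadd_grepr (tensor_rep U W) (tensor_rep V W)).
Proof.
apply: (@rsim_index _ _ _ _ (cast_ord (mulnDl _ _ _))).
  by exists (cast_ord (esym (mulnDl _ _ _))) => i; apply: val_inj.
have El i j : cast_ord (mulnDl _ _ _) (mxtens_index (lshift _ i, j)) =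
    lshift _ (mxtens_index (i, j))
    :> 'I_(rdegree U * rdegree W + rdegree V * rdegree W).
  exact: val_inj.
have Er i j : cast_ord (mulnDl _ _ _) (mxtens_index (rshift _ i, j)) =
    rshift _ (mxtens_index (i, j))
    :> 'I_(rdegree U * rdegree W + rdegree V * rdegree W).
  by apply: val_inj; rewrite /= mulnDl addnA.
move=> g Gg I J; case: (mxtens_indexP I) => i i'.
case: (mxtens_indexP J) => j j'; rewrite /= !tprod_tens tensmxE.
by case: (split_ordP i) => k ->; case: (split_ordP j) => l ->;
  rewrite ?(El, Er) !(block_mxEul, block_mxEur, block_mxEdl, block_mxEdr)
    ?tensmxE // !mxE mul0r.
Qed.

Lemma tensor_rep0 U : mx_rsim (tensor_rep grepr0 U) grepr0.
Proof. by apply: (@rsim_index _ _ _ _ id); [exists id | move=> g Gg []]. Qed.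

Definition iso_add (u v : iso_class) :=
  iso_class_of (dadd_grepr (repr u) (repr v)).
Definition iso_mul (u v : iso_class) :=
  iso_class_of (tensor_rep (repr u) (repr v)).

Lemma iso_addE U V :
  iso_add (iso_class_of U) (iso_class_of V) = iso_class_of (dadd_grepr U V).
Proof. by apply/iso_classP/rsim_dadd; apply: iso_class_reprP. Qed.

Lemma iso_mulE U V :
  iso_mul (iso_class_of U) (iso_class_of V) = iso_class_of (tensor_rep U V).
Proof. by apply/iso_classP/rsim_tensor; apply: iso_class_reprP. Qed.

Fact iso_addA : associative iso_add.
Proof.
elim/iso_class_ind => U; elim/iso_class_ind => V; elim/iso_class_ind => W.
by rewrite !iso_addE; apply/iso_classP/dadd_repA.
Qed.

Fact iso_addC : commutative iso_add.
Proof.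
elim/iso_class_ind => U; elim/iso_class_ind => V.
by rewrite !iso_addE; apply/iso_classP/dadd_repC.
Qed.

Fact iso_add0 : left_id (iso_class_of grepr0) iso_add.
Proof.
by elim/iso_class_ind => U; rewrite iso_addE; apply/iso_classP/dadd_rep0.
Qed.

HB.instance Definition _ :=
  GRing.isNmodule.Build iso_class iso_addA iso_addC iso_add0.

Fact iso_mulA : associative iso_mul.
Proof.
elim/iso_class_ind => U; elim/iso_class_ind => V; elim/iso_class_ind => W.
by rewrite !iso_mulE; apply/iso_classP/tensor_repA.
Qed.

Fact iso_mulC : commutative iso_mul.
Proof.
elim/iso_class_ind => U; elim/iso_class_ind => V.
by rewrite !iso_mulE; apply/iso_classP/tensor_repC.
Qed.

Fact iso_mul1 : left_id (iso_class_of triv_rep) iso_mul.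
Proof.
by elim/iso_class_ind => U; rewrite iso_mulE; apply/iso_classP/tensor_rep1.
Qed.

Fact iso_mulD : left_distributive iso_mul +%R.
Proof.
elim/iso_class_ind => U; elim/iso_class_ind => V; elim/iso_class_ind => W.
rewrite [_ + _]iso_addE !iso_mulE [RHS]iso_addE.
by apply/iso_classP/tensor_repDl.
Qed.

Fact iso_mul0 : left_zero (iso_class_of grepr0) iso_mul.
Proof.
by elim/iso_class_ind => U; rewrite iso_mulE; apply/iso_classP/tensor_rep0.
Qed.

HB.instance Definition _ := GRing.Nmodule_isComPzSemiRing.Build iso_class
  iso_mulA iso_mulC iso_mul1 iso_mulD iso_mul0.

Definition Rep := groth iso_class.

Fact Rep_oner_neq0 :
  groth_class (1, 0) != groth_class (0, 0) :> groth iso_class.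
Proof.
apply/eqP => /groth_classP/groth_eqP[e]; rewrite /= !addr0 add0r.
elim/iso_class_ind: e => U.
rewrite [LHS](iso_addE triv_rep U) => /iso_classP/mxrank_rsim /= /eqP.
by rewrite -[X in _ == X]add0n eqn_add2r.
Qed.

HB.instance Definition _ := Choice.on Rep.
HB.instance Definition _ := GRing.isZmodule.Build Rep
  (@groth_addA _) (@groth_addC _) (@groth_add0 _) (@groth_addN _).
HB.instance Definition _ := GRing.Zmodule_isComNzRing.Build Rep
  (@groth_mulA _) (@groth_mulC _) (@groth_mul1 _) (@groth_mulD _)
  Rep_oner_neq0.

Definition rep_class U : Rep := groth_class (iso_class_of U, 0).

Lemma rep_classP U V : rep_class U = rep_class V <->
  exists W, mx_rsim (dadd_grepr U W) (dadd_grepr V W).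
Proof.
rewrite -groth_classP; split=> [/groth_eqP[e] | [W UV]].
  elim/iso_class_ind: e => W; rewrite /= !addr0 => e; exists W.
  apply/(iso_classP (dadd_grepr U W) (dadd_grepr V W)).
  by rewrite -!iso_addE.
apply/groth_eqP; exists (iso_class_of W); rewrite /= !addr0.
by rewrite [LHS]iso_addE [RHS]iso_addE; apply/iso_classP.
Qed.

Lemma rep_class1 : rep_class triv_rep = 1.
Proof. by []. Qed.

Lemma rep_classD U V :
  rep_class (dadd_grepr U V) = rep_class U + rep_class V.
Proof.
by rewrite /rep_class [RHS]groth_addE /= -iso_addE addr0.
Qed.

Lemma rep_classM U V :
  rep_class (tensor_rep U V) = rep_class U * rep_class V.
Proof.
by rewrite /rep_class [RHS]groth_mulE /= !mulr0 mul0r !addr0 -iso_mulE.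
Qed.

End RepresentationRing.

Section PermutationRepresentation.
Variables (F : fieldType) (aT : finGroupType) (G D : {group aT}).
Variables (T : finType) (to : action D T) (X : {set T}).
Hypothesis actsGX : [acts G, on X | to].

Definition permutation_mx (g : aT) : 'M[F]_#|X| :=
  \matrix_(i, j) (to (enum_val i) g == enum_val j)%:R.

Fact permutation_mx_repr : mx_repr G permutation_mx.
Proof.
split=> [|g h Gg Gh]; apply/matrixP => i j; rewrite !mxE.
  by rewrite act1 (inj_eq enum_val_inj).
have Xi : to (enum_val i) g \in X.
  by rewrite (acts_act actsGX) ?enum_valP.
rewrite (bigD1 (enum_rank_in Xi (to (enum_val i) g))) //= !mxE.
rewrite enum_rankK_in // eqxx mul1r big1 ?addr0 => [|k ki].
  by rewrite actMin //; apply: (subsetP (acts_dom actsGX)) => //.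
rewrite !mxE; case: eqP => [E|]; last by rewrite mul0r.
by case/eqP: ki; apply: enum_val_inj; rewrite enum_rankK_in.
Qed.

Definition permutation_rep : representation F G :=
  Representation (MxRepresentation permutation_mx_repr).

End PermutationRepresentation.

(* The vertices of the n-gon are the residues 0, ..., n - 1 modulo n, with 0
   standing for the label n. For 2 < n the dihedral group of order 2n acts
   faithfully on them and is represented by its image in 'S_n (see
   I2_isog_dihedral); its natural action is then the action 'P of permutations.
   Permutations act on the right: (g * h) i = h (g i). *)
Section DihedralGroup.
Variable n : nat.
Implicit Types (i : 'I_n) (a b : nat).

Fact ord_neg_subproof i : ((n - i) %% n < n)%N.
Proof. by rewrite ltn_mod (leq_ltn_trans _ (ltn_ord i)). Qed.
Definition ord_neg i : 'I_n := Ordinal (ord_neg_subproof i).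

Lemma ord_negK : involutive ord_neg.
Proof.
move=> i; apply: val_inj => /=; have := ltn_ord i.
have [-> n_gt0 | i_gt0 lt_in] := posnP i; first by rewrite subn0 modnn subn0 modnn.
rewrite (@modn_small (n - i)); last by lia.
by rewrite subKn ?modn_small // ltnW.
Qed.

Definition rot_perm : 'S_n := perm (@ordS_inj n).
Definition refl_perm : 'S_n := perm (can_inj ord_negK).

Definition I2 : {group 'S_n} := <<[set rot_perm; refl_perm]>>%G.

Lemma rot_perm_in : rot_perm \in I2. Proof. by rewrite mem_gen ?set21. Qed.
Lemma refl_perm_in : refl_perm \in I2. Proof. by rewrite mem_gen ?set22. Qed.

Lemma rot_permX a i : (rot_perm ^+ a)%g i = ((i + a) %% n)%N :> nat.
Proof.
elim: a => [|a IH]; first by rewrite expg0 perm1 addn0 modn_small.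
by rewrite expgSr permM permE /= IH -addn1 modnDml addn1 addnS.
Qed.

Lemma refl_permX a i :
  (refl_perm ^+ a)%g i = (if odd a then (n - i) %% n else i)%N :> nat.
Proof.
elim: a => [|a IH]; first by rewrite expg0 perm1.
rewrite expgSr permM permE /= IH; case: ifP => //= _.
exact: (congr1 val (ord_negK i)).
Qed.

Lemma rot_perm_expn : (rot_perm ^+ n = 1)%g.
Proof.
apply/permP => i; apply: val_inj; rewrite /= rot_permX perm1.
by rewrite modnDr modn_small.
Qed.

Lemma refl_perm_sqr : (refl_perm ^+ 2 = 1)%g.
Proof. by apply/permP => i; apply: val_inj; rewrite /= refl_permX perm1. Qed.

Lemma rot_refl_perm : (rot_perm * refl_perm = refl_perm * rot_perm^-1)%g.
Proof.
suff rsr : (rot_perm * refl_perm * rot_perm = refl_perm)%g.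
  by apply: (canRL (mulgK _)).
apply/permP => i; apply: val_inj; rewrite !permM !permE /= -addn1 modnDml.
have := ltn_ord i; move: (nat_of_ord i) => m; rewrite leq_eqVlt addn1.
case/predU1P => [m1 | m1].
  have -> : (n - m = 1)%N by lia.
  by rewrite m1 modnn subn0 -addn1 modnDl.
by rewrite (modn_small m1) subnSK //; apply: ltnW.
Qed.

Lemma I2_normal_form g :
  g \in I2 -> exists a b, g = (rot_perm ^+ a * refl_perm ^+ b)%g.
Proof.
have nrs : refl_perm \in 'N(<[rot_perm]>)%g.
  rewrite inE -cycleJ cycle_subG.
  have -> : (rot_perm ^ refl_perm = rot_perm^-1)%g.
    by rewrite conjgE rot_refl_perm mulKg.
  by rewrite groupV cycle_id.
have -> : I2 = (<[rot_perm]> * <[refl_perm]>)%g :> {set 'S_n}.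
  by rewrite -norm_joinEr ?cycle_subG // joing_idl joing_idr.
case/mulsgP => _ _ /cycleP[a ->] /cycleP[b ->] ->.
by exists a, b.
Qed.

Hypothesis n_gt2 : (2 < n)%N.

Lemma I2_normal_form_inj a b c d :
  (rot_perm ^+ a * refl_perm ^+ b = rot_perm ^+ c * refl_perm ^+ d)%g ->
  a = c %[mod n] /\ odd b = odd d.
Proof.
have n_gt0 : (0 < n)%N by lia.
move=> e.
have e0 : forall k, (k < n)%N ->
   (if odd b then (n - (k + a) %% n) %% n else (k + a) %% n)%N =
   (if odd d then (n - (k + c) %% n) %% n else (k + c) %% n)%N.
  move=> k ltk; have /(congr1 val) := congr1 (fun g : 'S_n => g (Ordinal ltk)) e.
  by rewrite /= !permM !refl_permX !rot_permX.
have ltm m : (m %% n < n)%N by rewrite ltn_mod.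
have oppE m : ((n - m %% n) %% n = if m %% n == 0 then 0 else n - m %% n)%N.
  by case: eqP => [->|/eqP m0]; rewrite ?subn0 ?modnn // modn_small //; lia.
have addE m : ((1 + m) %% n = if (m %% n).+1 == n then 0 else (m %% n).+1)%N.
  rewrite -modnDmr add1n; case: eqP => [->|/eqP m1]; first by rewrite modnn.
  by rewrite modn_small // ltn_neqAle m1 ltm.
have := e0 0 n_gt0; have := e0 1 (ltnW n_gt2).
rewrite !oppE !addE !add0n; have := ltm a; have := ltm c.
move: (a %% n)%N (c %% n)%N => a' c' lta ltc.
by case: (odd b); case: (odd d); do ![case: eqP]; lia.
Qed.

Lemma card_I2 : #|I2| = n.*2.
Proof.
pose f (ab : 'I_n * 'I_2) := (rot_perm ^+ ab.1 * refl_perm ^+ ab.2)%g.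
have inj_f : injective f.
  move=> [a b] [c d] /I2_normal_form_inj[].
  rewrite /= !modn_small // => /val_inj -> bd; congr pair; apply: val_inj.
  by case: b d bd => [[|[]]] // ? [[|[]]].
have -> : #|I2| = #|f @: [set: 'I_n * 'I_2]|.
  apply: eq_card => g; apply/idP/imsetP => [/I2_normal_form[a [b ->]] | [ab _ ->]].
    have n_gt0 : (0 < n)%N by lia.
    exists (Ordinal (ltn_pmod a n_gt0), Ordinal (ltn_pmod b (isT : 0 < 2)%N)) => //.
    by rewrite /f /= (expg_mod _ rot_perm_expn) (expg_mod _ refl_perm_sqr).
  by rewrite groupM ?groupX ?rot_perm_in ?refl_perm_in.
by rewrite card_imset // cardsT card_prod !card_ord muln2.
Qed.

Lemma I2_isog_dihedral : (I2 \isog 'D_n.*2)%g.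
Proof.
have n_gt1 : (1 < n)%N by lia.
apply/(isoGrpP _ (Grp_dihedral n_gt1)); split.
  by rewrite card_dihedral ?card_I2.
apply/existsP; exists (rot_perm, refl_perm); rewrite /= !xpair_eqE.
rewrite joing_idl joing_idr eqxx rot_perm_expn refl_perm_sqr !eqxx /=.
by rewrite conjgE rot_refl_perm mulKg.
Qed.

End DihedralGroup.

Section DihedralRepresentations.
Variables (R : realType) (n : nat) (n_gt2 : (2 < n)%N).
Local Notation C := R[i].
Local Open Scope complex_scope.
Implicit Types (x y : R) (a b : nat).

Definition rotation_mx x : 'M[C]_2 := \matrix_(i, j)
  if i == j then (cos x)%:C
  else if i == 0 then (- sin x)%:C else (sin x)%:C.
Definition reflection_mx : 'M[C]_2 :=
  \matrix_(i, j) if i == j then (-1) ^+ i else 0.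

Lemma rotation_mxD x y :
  rotation_mx (x + y) = rotation_mx x *m rotation_mx y.
Proof.
apply/matrixP => i j; rewrite !mxE big_ord_recl big_ord1 !mxE.
rewrite cosD sinD.
case: i => [[|[]]] // ?; case: j => [[|[]]] // ?;
  by rewrite /= ?(rmorphB, rmorphD, rmorphN, rmorphM) /=; ring.
Qed.

Lemma rotation_mx0 : rotation_mx 0 = 1%:M.
Proof.
apply/matrixP => i j; rewrite !mxE cos0 sin0 oppr0 if_same.
by case: eqP.
Qed.

Lemma rotation_mxX x a : rotation_mx x ^+ a = rotation_mx (x *+ a).
Proof.
elim: a => [|a IH]; first by rewrite expr0 mulr0n rotation_mx0.
by rewrite exprS mulrS IH rotation_mxD.
Qed.

Lemma reflection_mx_sqr : reflection_mx ^+ 2 = 1.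
Proof.
apply/matrixP => i j; rewrite expr2 !mxE big_ord_recl big_ord1 !mxE.
by case: i => [[|[]]] // ?; case: j => [[|[]]] // ?; rewrite /=; ring.
Qed.

Lemma reflection_rotation_mx x :
  reflection_mx * rotation_mx x = rotation_mx (- x) * reflection_mx.
Proof.
apply/matrixP => i j; rewrite !mxE !big_ord_recl !big_ord0 !mxE cosN sinN.
case: i => [[|[]]] // ?; case: j => [[|[]]] // ?; rewrite /= ?rmorphN; ring.
Qed.

Definition polygon_angle : R := pi *+ 2 / n%:R.

(* For 2 < n every element of I2 n is r^a s^b for a unique (a, b), so that
   the choice made by pick is immaterial; see z1_mxE. *)
Definition z1_mx (g : 'S_n) : 'M[C]_2 :=
  if [pick ab : 'I_n * 'I_2 |
      g == rot_perm n ^+ ab.1 * refl_perm n ^+ ab.2]%g is Some ab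
  then rotation_mx polygon_angle ^+ ab.1 * reflection_mx ^+ ab.2
  else 1.

Lemma rotation_mx_expn : rotation_mx polygon_angle ^+ n = 1.
Proof.
rewrite rotation_mxX /polygon_angle -[_ *+ n]mulr_natr divfK; last first.
  by rewrite pnatr_eq0 -lt0n; lia.
rewrite -[1]rotation_mx0; apply/matrixP => i j.
by rewrite !mxE cos2pi sin2pi cos0 sin0.
Qed.

Lemma z1_mxE a b : z1_mx (rot_perm n ^+ a * refl_perm n ^+ b)%g =
  rotation_mx polygon_angle ^+ a * reflection_mx ^+ b.
Proof.
rewrite /z1_mx; case: pickP => [[c d] /= /eqP/(I2_normal_form_inj n_gt2)[ac bd] | no].
  rewrite -(expr_mod a rotation_mx_expn) -(expr_mod c rotation_mx_expn) ac.
  rewrite -(expr_mod b reflection_mx_sqr) -(expr_mod d reflection_mx_sqr).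
  by rewrite !modn2 bd.
have n_gt0 : (0 < n)%N by lia.
have /negP[] := no (Ordinal (ltn_pmod a n_gt0),
                    Ordinal (ltn_pmod b (isT : 0 < 2)%N)).
by rewrite /= (expg_mod _ (rot_perm_expn n)) (expg_mod _ (refl_perm_sqr n)).
Qed.

Lemma z1_mx_rot : z1_mx (rot_perm n) = rotation_mx polygon_angle.
Proof. by have := z1_mxE 1 0; rewrite expg1 mulg1 expr1 mulr1. Qed.

Lemma z1_mx_refl : z1_mx (refl_perm n) = reflection_mx.
Proof. by have := z1_mxE 0 1; rewrite expg1 mul1g expr1 mul1r. Qed.

Fact z1_mx_repr : mx_repr (I2 n) z1_mx.
Proof.
split=> [|g h]; first by have := z1_mxE 0 0; rewrite mul1g mulr1.
move=> /I2_normal_form[a [b ->]] /I2_normal_form[c [d ->]].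
have rs e : (refl_perm n * rot_perm n ^+ e =
    rot_perm n ^+ (e * n.-1) * refl_perm n)%g.
  have Er : (rot_perm n ^+ n.-1 = (rot_perm n)^-1)%g.
    apply: (mulgI (rot_perm n)); rewrite -expgS prednK ?rot_perm_expn ?mulgV //.
    by lia.
  have sr : (refl_perm n * rot_perm n = rot_perm n ^+ n.-1 * refl_perm n)%g.
    rewrite Er; apply: (mulgI (rot_perm n)); rewrite mulgA rot_refl_perm.
    by rewrite mulgKV mulKVg.
  elim: e => [|e IH]; first by rewrite mul0n !expg0 mulg1 mul1g.
  by rewrite expgSr mulgA IH -mulgA sr mulgA -expgD mulSn addnC.
have RS e : reflection_mx * rotation_mx polygon_angle ^+ e =
    rotation_mx polygon_angle ^+ (e * n.-1) * reflection_mx.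
  have Er : rotation_mx polygon_angle ^+ n.-1 = rotation_mx (- polygon_angle).
    rewrite -[RHS]mulr1 -rotation_mx_expn !rotation_mxX -[RHS]rotation_mxD.
    by rewrite -[in RHS](ltn_predK n_gt2) mulrS addKr.
  elim: e => [|e IH]; first by rewrite mul0n !expr0 mulr1 mul1r.
  rewrite exprSr mulrA IH -mulrA reflection_rotation_mx -Er mulrA -exprD.
  by rewrite mulSn addnC.
have rsb e f : exists k, (refl_perm n ^+ f * rot_perm n ^+ e =
    rot_perm n ^+ k * refl_perm n ^+ f)%g /\
    reflection_mx ^+ f * rotation_mx polygon_angle ^+ e =
    rotation_mx polygon_angle ^+ k * reflection_mx ^+ f.
  elim: f => [|f [k [IHg IHm]]].
    by exists e; rewrite !(expg0, expr0, mulg1, mul1g, mulr1, mul1r).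
  exists (k * n.-1)%N; rewrite !expgS !exprS -!mulgA -!mulrA IHg IHm.
  by rewrite !mulgA !mulrA rs RS.
have [k [Eg Em]] := rsb c b.
transitivity (rotation_mx polygon_angle ^+ (a + k) * reflection_mx ^+ (b + d)).
  by rewrite -z1_mxE -mulgA (mulgA (_ ^+ b)%g) Eg -!mulgA -expgD !mulgA -expgD.
by rewrite !z1_mxE -[RHS]mulrA (mulrA (_ ^+ b)) Em -!mulrA -exprD !mulrA -exprD.
Qed.

Definition z1 : representation C (I2 n) :=
  Representation (MxRepresentation z1_mx_repr).

Fact det_mx_repr : mx_repr (I2 n) (fun g => (\det (z1 g))%:M : 'M[C]_1).
Proof.
split=> [|g h Gg Gh]; first by rewrite repr_mx1 det1.
by rewrite repr_mxM // det_mulmx scalar_mxM.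
Qed.

Definition det_rep : representation C (I2 n) :=
  Representation (MxRepresentation det_mx_repr).

Lemma det_mx22 (A : 'M[C]_2) : \det A = A 0 0 * A 1 1 - A 0 1 * A 1 0.
Proof.
rewrite (expand_det_row _ 0) !big_ord_recl big_ord0 /cofactor !det_mx11 !mxE.
rewrite /= expr0 expr1 addr0 mul1r mulN1r mulrN.
congr (A _ _ * A _ _ - A _ _ * A _ _); exact: val_inj.
Qed.

Lemma det_rep_rot : det_rep (rot_perm n) = 1%:M.
Proof.
rewrite /= z1_mx_rot det_mx22 !mxE /= (rmorphN (real_complex R)) /=.
rewrite mulNr opprK -(rmorphM (real_complex R)) -(rmorphM (real_complex R)).
by rewrite -(rmorphD (real_complex R)) /= -!expr2 cos2Dsin2.
Qed.

Lemma det_rep_refl : det_rep (refl_perm n) = (-1)%:M.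
Proof. by rewrite /= z1_mx_refl det_mx22 !mxE /= !mulr0 subr0 mul1r. Qed.

End DihedralRepresentations.

(* The natural action on vertices induces 'P^* on blocks and 'P^*^* on
   partitions. Being non-crossing only depends on the cyclic order, so that
   numbering the vertices from 0 is harmless. *)
Section NoncrossingPartitions.
Variable n : nat.
Implicit Types P : {set {set 'I_n}}.

Definition noncrossing P : bool :=
  [forall B in P, forall B' in P, (B != B') ==>
    ~~ [exists a in B, exists b in B', exists c in B, exists d in B',
          (a < b < c)%N && (c < d)%N]].

Definition ncp m : {set {set {set 'I_n}}} :=
  [set P | [&& partition P [set: 'I_n], noncrossing P & #|P| == m]].

Lemma noncrossingP P : reflect
  (forall B B' a b c d, B \in P -> B' \in P -> B != B' -> a \in B -> b \in B' ->
    c \in B -> d \in B' -> ~~ [&& a < b, b < c & c < d]%N)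
  (noncrossing P).
Proof.
apply: (iffP idP) => [nc B B' a b c d PB PB' neB aB bB' cB dB' | nc].
  have /implyP/(_ neB)/existsP := forall_inP (forall_inP nc B PB) B' PB'.
  move=> no; apply/and3P => -[ab bc cd]; apply: no.
  exists a; rewrite aB; apply/exists_inP; exists b => //.
  apply/exists_inP; exists c => //; apply/exists_inP; exists d => //.
  by rewrite ab bc cd.
apply/forall_inP => B PB; apply/forall_inP => B' PB'; apply/implyP => neB.
apply/negP => /exists_inP[a aB] /exists_inP[b bB'] /exists_inP[c cB].
move=> /exists_inP[d dB'] /andP[/andP[ab bc] cd].
by have /negP[] := nc _ _ _ _ _ _ PB PB' neB aB bB' cB dB'; rewrite ab bc cd.
Qed.

Lemma noncrossing_imset (f : 'I_n -> 'I_n) P : injective f ->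
  (forall a b c d, (f a < f b < f c)%N -> (f c < f d)%N ->
     [\/ (a < b < c)%N && (c < d)%N, (b < c < d)%N && (d < a)%N,
         (d < c < b)%N && (b < a)%N | (a < d < c)%N && (c < b)%N]) ->
  noncrossing P -> noncrossing [set f @: (B : {set 'I_n}) | B in P].
Proof.
move=> inj_f f_cyc /noncrossingP nc; apply/noncrossingP.
move=> C C' a' b' c' d' /imsetP[B PB ->{C}] /imsetP[B' PB' ->{C'}] neB.
move=> /imsetP[a aB ->{a'}] /imsetP[b bB' ->{b'}].
move=> /imsetP[c cB ->{c'}] /imsetP[d dB' ->{d'}].
have {}neB : B != B' by apply: contraNneq neB => ->.
have neB' : B' != B by rewrite eq_sym.
apply/negP => /and3P[ab bc cd].
have := f_cyc a b c d; rewrite ab bc cd => /(_ isT isT) [] /andP[/andP[h1 h2] h3].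
- by move: (nc _ _ _ _ _ _ PB PB' neB aB bB' cB dB'); rewrite h1 h2 h3.
- by move: (nc _ _ _ _ _ _ PB' PB neB' bB' cB dB' aB); rewrite h1 h2 h3.
- by move: (nc _ _ _ _ _ _ PB' PB neB' dB' cB bB' aB); rewrite h1 h2 h3.
- by move: (nc _ _ _ _ _ _ PB PB' neB aB dB' cB bB'); rewrite h1 h2 h3.
Qed.

Lemma ncp_acts m : [acts I2 n, on ncp m | 'P^*^*].
Proof.
rewrite gen_subG subUset !sub1set.
suff stab (g : 'S_n) : (forall a b c d, (g a < g b < g c)%N -> (g c < g d)%N ->
     [\/ (a < b < c)%N && (c < d)%N, (b < c < d)%N && (d < a)%N,
         (d < c < b)%N && (b < a)%N | (a < d < c)%N && (c < b)%N]) ->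
    g \in 'N(ncp m | 'P^*^*)%g.
  apply/andP; split; apply: stab => a b c d; rewrite !permE /=.
    have E (x : 'I_n) : (x.+1 %% n = if x.+1 == n then 0 else x.+1)%N.
      case: eqP => [->|/eqP ne]; first by rewrite modnn.
      by rewrite modn_small // ltn_neqAle ne ltn_ord.
    have := (ltn_ord a, ltn_ord b, ltn_ord c, ltn_ord d) => -[[[la lb] lc] ld].
    rewrite !E; have [a0|a0] := eqVneq a.+1 n => h1 h2;
      [constructor 2 | constructor 1]; move: h1 h2;
      by do ![case: eqP => ?]; lia.
  have E (x : 'I_n) : ((n - x) %% n = if x == 0 :> nat then 0 else n - x)%N.
    case: eqP => [->|/eqP ne]; first by rewrite subn0 modnn.
    by rewrite modn_small //; have := ltn_ord x; lia.
  have := (ltn_ord a, ltn_ord b, ltn_ord c, ltn_ord d) => -[[[la lb] lc] ld].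
  rewrite !E; have [a0|a0] := eqVneq (a : nat) 0%N => h1 h2;
    [constructor 4 | constructor 3]; move: h1 h2;
    by do ![case: eqP => ?]; lia.
move=> g_cyc; rewrite !inE /=; apply/subsetP => P; rewrite !inE.
case/and3P => partP ncP /eqP cardP.
have -> : ('P^*^*)%act P g = [set g @: (B : {set 'I_n}) | B in P] by [].
apply/and3P; split.
- have gT : g @: [set: 'I_n] = [set: 'I_n].
    by apply/setP => x; rewrite inE -(permKV g x) imset_f.
  by rewrite -gT imset_partition //; apply: perm_inj.
- exact: noncrossing_imset (@perm_inj _ g) g_cyc ncP.
- by rewrite card_imset ?cardP //; apply: imset_inj; apply: perm_inj.
Qed.

End NoncrossingPartitions.

(* Z[s, t] is {poly {poly int}} with s = 'X and t = 'Y, so that P.[x, y] is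
   P(s := x, t := y). *)
Fixpoint fibpoly m : {poly {poly int}} :=
  match m with
  | 0%N => 0
  | 1%N => 1
  | (m''.+1 as m').+1 => 'X * fibpoly m' + 'Y * fibpoly m''
  end.

Definition fibfact m : {poly {poly int}} := \prod_(1 <= i < m.+1) fibpoly i.

Notation "x %:F" := (@FracField.tofrac _ x) : ring_scope.

Definition fibonomial m k : {fraction {poly {poly int}}} :=
  (fibfact m)%:F / ((fibfact k)%:F * (fibfact (m - k))%:F).

Definition dihedral_sieving (R : realType) (n : nat) (n_gt2 : (2 < n)%N)
    (D : {group 'S_n}) (T : finType) (to : action D T) (X : {set T})
    (actsX : [acts I2 n, on X | to]) (P : {poly {poly int}}) : Prop :=
  rep_class (permutation_rep R[i] actsX) =
  (map_poly (map_poly intr) P).[rep_class (z1 R n_gt2),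
                                - rep_class (det_rep R n_gt2)].

(* Main.v *)
Require Import Defs.
From HB Require Import structures.
From mathcomp Require Import all_boot all_order all_algebra all_fingroup.
From mathcomp Require Import fraction reals.
From mathcomp Require Import polyXY mxrepresentation character boolp trigo complex.
From mathcomp Require Import ring zify.
Set Implicit Arguments.
Unset Strict Implicit.
Unset Printing Implicit Defensive.
Import Order.TTheory GRing.Theory Num.Theory.
Local Open Scope ring_scope.

(** Over a field of characteristic zero a virtual representation is determined by
its character ([affords_inj]), so the sieving identity says that, for every g in
the dihedral group, the polynomial evaluated at s = tr z1(g), t = - det(g) is the
number of non-crossing partitions with n - k blocks fixed by g.

The quotient in the statement is a polynomial because, with m = n - 1,
{n} divides the product of Fibonomials through the determinantal identity
  {k+1} {m-k+1} + t {k} {m-k} = {m+1},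
which gives the explicit form
  {m choose k}^2 + t {m choose k+1} {m choose k-1}
([lucas_narayana], [narayana_fraction]). Three specialisations occur. At the
identity (s, t) = (2, -1) and {i} = i. At a reflection (s, t) = (0, 1) and {i} is
the parity of i. At a rotation by the angle x one has t = -1, s = 2 cos x and
{i} = sin (i x) / sin x, which vanishes exactly at the multiples of the order d of
the rotation. In the last two cases an analogue of the theorem of Lucas
([lucasnomial_Lucas]) turns Fibonomials into ordinary binomials.

The fixed points are counted by one encoding. A non-crossing equivalence on the
integers is determined by the positions of the first and of the last elements of
its blocks: if D i is the number of blocks open at i, then i and j lie in one
block when D i = D j and the number of open blocks does not fall below this value
on the way from i to j ([arch_equiv]). Conversely this formula always defines a
non-crossing equivalence ([arch_noncrossing_equiv]).

On the line 0, ..., n - 1 the positions of firsts and lasts form a ballot word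
([word_of_ballot], [word_of_surj]); such words are counted by a two by two
determinant of binomials ([ballot_numberE]), which is the polynomial at the
identity. A reflection reverses the word and exchanges firsts with lasts, so that
fixed partitions are palindromes, given by their first halves
([card_ncp_rev_fixed]).

A partition fixed by the rotation by M steps, n = d M with d > 2, unrolls to a
non-crossing equivalence on the integers of period M ([unroll_nce],
[roll_up_cyclic]), hence is given by two subsets A and B of Z/M of the same size j,
which are arbitrary ([mark_sets_inj], [mark_sets_surj]). It has d j blocks, plus
one if there is a block stable under the rotation. A cyclic argument decides how
often this happens: among the M rotations of B, exactly j yield no stable block
([sum_gap_turn]). *)

(** * Characters determine classes in the representation ring *)
Section TraceRank.
Variable F : fieldType.

(** The summand cut out by e, as an inclusion b and a projection c. *)
Lemma idempotent_factor n (e : 'M[F]_n) : e *m e = e ->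
  exists (c : 'M_(n, \rank e)) (b : 'M_(\rank e, n)), e = c *m b /\ b *m c = 1%:M.
Proof.
move=> ee; exists (col_base e), (row_base e); split; first by rewrite mulmx_base.
apply: (row_free_inj (row_base_free e)).
apply: (row_full_inj (col_base_full e)).
by rewrite mul1mx -mulmxA mulmxA mulmx_base ee.
Qed.

Lemma mxtrace_idempotent n (e : 'M[F]_n) : e *m e = e -> \tr e = (\rank e)%:R.
Proof.
by case/idempotent_factor=> c [b [def_e bc]];
  rewrite [in LHS]def_e mxtrace_mulC bc mxtrace1.
Qed.

(** The coefficient of lin_mx f at the index of (i, j) is the (i, j) entry of the
image of the matrix unit at (i, j). *)
Lemma mxtrace_lin_mx m n (f : {linear 'M[F]_(m, n) -> 'M[F]_(m, n)}) :
  \tr (lin_mx f) = \sum_i \sum_j f (delta_mx i j) i j.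
Proof.
rewrite pair_big /= /mxtrace.
have [h hK Kh] := curry_mxvec_bij m n.
rewrite (reindex (uncurry (@mxvec_index m n))) /=; last first.
  by exists h => ? _; [apply: hK | apply: Kh].
apply: eq_bigr => -[i j] _ /=.
have -> : lin_mx f (mxvec_index i j) (mxvec_index i j) =
    (delta_mx (0 : 'I_1) (mxvec_index i j) *m lin_mx f) 0 (mxvec_index i j).
  by rewrite -rowE [RHS]mxE.
by rewrite mul_rV_lin vec_mx_delta mxvecE.
Qed.

End TraceRank.

Section CharactersDetermine.
Variables (F : fieldType) (gT : finGroupType) (G : {group gT}).
Hypothesis pcharF0 : [pchar F] =i pred0.
Local Notation representation := (representation F G).
Implicit Types U V W : representation.

Definition intertwines U V (f : 'M[F]_(rdegree U, rdegree V)) :=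
  {in G, forall g, U g *m f = f *m V g}.

Definition group_average U V (f : 'M[F]_(rdegree U, rdegree V)) :=
  (#|G|%:R)^-1 *: \sum_(g in G) U g^-1%g *m f *m V g.

Lemma group_average_is_linear U V : linear (@group_average U V).
Proof.
move=> a f h; rewrite /group_average scalerA mulrC -scalerA -scalerDr.
congr (_ *: _); rewrite scaler_sumr -big_split; apply: eq_bigr => g _ /=.
by rewrite mulmxDr mulmxDl -scalemxAr -scalemxAl.
Qed.

HB.instance Definition _ U V :=
  GRing.isSemilinear.Build _ _ _ _ (@group_average U V)
    (GRing.semilinear_linear (@group_average_is_linear U V)).

Lemma natr_inj_pchar0 : injective (fun m => m%:R : F).
Proof.
move=> m n; wlog le_mn : m n / (m <= n)%N => [IH | /eqP].
  by case/orP: (leq_total m n) => /IH // h /esym/h.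
rewrite eq_sym -subr_eq0 -natrB //; move/pcharf0P: pcharF0 => ->.
by rewrite subn_eq0 => le_nm; apply/eqP; rewrite eqn_leq le_mn.
Qed.

Lemma natG_neq0 : #|G|%:R != 0 :> F.
Proof. by move/pcharf0P: pcharF0 => ->; rewrite -lt0n cardG_gt0. Qed.

Lemma group_averageP U V (f : 'M[F]_(rdegree U, rdegree V)) :
  intertwines (group_average f).
Proof.
move=> h Gh; rewrite /group_average -scalemxAr -scalemxAl; congr (_ *: _).
rewrite mulmx_sumr mulmx_suml (reindex_inj (mulIg h)) /=.
apply: eq_big => [g | g]; first by rewrite groupMr.
rewrite groupMr // => Gg; rewrite invMg !repr_mxM ?groupV //.
by rewrite !mulmxA -repr_mxM ?groupV // mulgV repr_mx1 mul1mx.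
Qed.

Lemma group_average_id U V (f : 'M[F]_(rdegree U, rdegree V)) :
  intertwines f -> group_average f = f.
Proof.
move=> fP; rewrite /group_average (eq_bigr (fun=> f)) => [|g Gg].
  by rewrite sumr_const -scaler_nat scalerA mulVf ?scale1r ?natG_neq0.
by rewrite -mulmxA -fP // mulmxA -repr_mxM ?groupV // mulVg repr_mx1 mul1mx.
Qed.

(** The average of A |-> U(g)^-1 A V(g) projects the matrices onto the
intertwiners; its trace is the inner product of the two characters. *)
Lemma mxtrace_group_average U V :
  \tr (lin_mx (@group_average U V)) =
  (#|G|%:R)^-1 * \sum_(g in G) \tr (U g^-1%g) * \tr (V g).
Proof.
rewrite mxtrace_lin_mx.
under eq_bigr => i _ do under eq_bigr => j _ do
  (rewrite /group_average mxE summxE).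
under eq_bigr => i _ do rewrite -mulr_sumr.
rewrite -mulr_sumr; congr (_ * _).
under eq_bigr => i _ do rewrite exchange_big /=.
rewrite exchange_big /=; apply: eq_bigr => g _.
rewrite /mxtrace big_distrlr /=; apply: eq_bigr => i _; apply: eq_bigr => j _.
rewrite mxE (bigD1 j) //= big1 => [|k kj].
  rewrite addr0 mxE (bigD1 i) //= big1 => [|l li]; first by rewrite addr0 mxE !eqxx mulr1.
  by rewrite mxE (negPf li) mulr0.
rewrite mxE big1 ?mul0r // => l _.
by rewrite mxE (negPf kj) andbF mulr0.
Qed.

(** If every intertwiner from U to V vanished, the inner product of the characters
would be zero; as they agree it is also the trace of the projection onto the
endomorphisms of U, that is, its rank, and the identity is such an endomorphism. *)
Lemma nonzero_intertwiner U V : (0 < rdegree U)%N ->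
  {in G, forall g, \tr (U g) = \tr (V g)} ->
  exists2 f : 'M[F]_(rdegree U, rdegree V), intertwines f & f != 0.
Proof.
move=> U_gt0 eqUV; apply: contrapT => no.
pose a U' V' := lin_mx (@group_average U' V').
have aUV : a U V = 0.
  apply/row_matrixP => i; rewrite rowE mul_rV_lin row0 /=.
  set f := group_average _; have [-> | f0] := eqVneq f 0; first by rewrite linear0.
  by case: no; exists f => //; apply: group_averageP.
have trUU : \tr (a U U) = 0.
  transitivity (\tr (a U V)); last by rewrite aUV mxtrace0.
  rewrite !mxtrace_group_average; congr (_ * _); apply: eq_bigr => g Gg.
  by rewrite (eqUV g Gg).
have aa : a U U *m a U U = a U U.
  apply/row_matrixP => i; rewrite !rowE mulmxA !mul_rV_lin mxvecK /=.
  by rewrite (group_average_id (@group_averageP _ _ _)).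
move: trUU; rewrite mxtrace_idempotent // => /eqP; move/pcharf0P: pcharF0 => ->.
rewrite mxrank_eq0 => /eqP aUU.
have : group_average (1%:M : 'M[F]_(rdegree U)) = 0.
  by apply: (can_inj mxvecK); rewrite -mul_vec_lin -/(a U U) aUU mulmx0 linear0.
rewrite group_average_id => [/matrixP/(_ (Ordinal U_gt0) (Ordinal U_gt0))/eqP|].
  by rewrite !mxE eqxx oner_eq0.
by move=> g _; rewrite mulmx1 mul1mx.
Qed.

(** Averaging any pseudo-inverse of f keeps the equation f p f = f. *)
Lemma intertwines_pinv U V (f : 'M[F]_(rdegree U, rdegree V)) :
  intertwines f -> exists2 p : 'M[F]_(rdegree V, rdegree U),
    intertwines p & f *m p *m f = f.
Proof.
move=> fP; move: (pinvmx f) (mulmxKpV (submx_refl f)) => x fxf.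
exists (group_average x); first exact: group_averageP.
rewrite -[RHS](group_average_id fP) /group_average -scalemxAr -scalemxAl.
congr (_ *: _); rewrite mulmx_sumr mulmx_suml; apply: eq_bigr => g Gg.
rewrite !mulmxA -fP ?groupV // -(mulmxA _ (U g)) (fP g) // !mulmxA; congr (_ *m _).
by rewrite -!mulmxA (mulmxA f) fxf.
Qed.

Lemma subrepresentation_repr U r (b : 'M[F]_(r, rdegree U)) c :
  b *m c = 1%:M -> intertwines (c *m b : 'M_(rdegree U, rdegree U)) ->
  mx_repr G (fun g => b *m U g *m c).
Proof.
move=> bc cbP; split=> [|g h Gg Gh]; first by rewrite repr_mx1 mulmx1.
rewrite repr_mxM // !mulmxA -(mulmxA (b *m U g) c b) -(mulmxA b (U g) (c *m b)).
by rewrite cbP // !mulmxA bc mul1mx.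
Qed.

Lemma trace_rsim U V : mx_rsim U V -> {in G, forall g, \tr (U g) = \tr (V g)}.
Proof.
by case/mx_rsim_def=> B [B' BB' hB] g Gg; rewrite hB // mxtrace_mulC mulmxA BB' mul1mx.
Qed.

Lemma rep_class_rsim U V : mx_rsim U V -> rep_class U = rep_class V.
Proof. by move=> UV; rewrite /rep_class; congr (groth_class (_, _));
  apply/iso_classP. Qed.

(** Take a nonzero intertwiner f from U to V with equivariant pseudo-inverse p. The
kernel K of f and a complement C of its image satisfy U + C = V + K, by a block
matrix isomorphism. So K and C have equal characters, and smaller dimension than
U; by induction their classes agree and can be cancelled. *)
Theorem rep_class_trace U V :
  {in G, forall g, \tr (U g) = \tr (V g)} -> rep_class U = rep_class V.
Proof.
have [m] := ubnP (rdegree U); elim: m => // m IHm in U V *.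
rewrite ltnS => leUm eqUV.
have eqd : rdegree U = rdegree V.
  have := eqUV 1%g (group1 G); rewrite !repr_mx1 !mxtrace1.
  by move/natr_inj_pchar0.
have [U0 | U_gt0] := posnP (rdegree U).
  apply: rep_class_rsim; case: U V U0 eqd {IHm leUm eqUV} => [a U] [b V] /= a0 ab.
  by subst a b; exists 1%:M => // [|g _];
    [rewrite row_free_unit unitmx1 | apply/matrixP => -[]].
have [f fP f0] := nonzero_intertwiner U_gt0 eqUV.
have [p pP fpf] := intertwines_pinv fP.
have compP U1 U2 U3 (x : 'M_(rdegree U1, rdegree U2)) (y : 'M_(rdegree U2, rdegree U3)) :
    intertwines x -> intertwines y -> intertwines (x *m y).
  by move=> xP yP g Gg; rewrite mulmxA xP // -(mulmxA x (U2 g)) yP // mulmxA.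
have subP W (x : 'M[F]_(rdegree W)) : intertwines x -> intertwines (1%:M - x).
  by move=> xP g Gg; rewrite mulmxBr mulmxBl mulmx1 mul1mx xP.
(* e projects U onto the kernel of f, e' projects V onto a complement of its image. *)
set e := 1%:M - f *m p; set e' := 1%:M - p *m f.
have ee : e *m e = e.
  by rewrite /e mulmxBl mul1mx mulmxBr mulmx1 !mulmxA fpf subrr subr0.
have ee' : e' *m e' = e'.
  by rewrite /e' mulmxBl mul1mx mulmxBr mulmx1 -!mulmxA (mulmxA f) fpf subrr subr0.
have [c [b [def_e bc]]] := idempotent_factor ee.
have [c' [b' [def_e' bc']]] := idempotent_factor ee'.
have eP : intertwines (c *m b : 'M_(rdegree U)).
  by rewrite -def_e; apply: subP; apply: compP.
have eP' : intertwines (c' *m b' : 'M_(rdegree V)).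
  by rewrite -def_e'; apply: subP; apply: compP.
pose K := Representation (MxRepresentation (subrepresentation_repr bc eP)).
pose C := Representation (MxRepresentation (subrepresentation_repr bc' eP')).
have trfp : \tr e = \tr e'.
  by rewrite /e /e' !linearB /= !mxtrace1 [\tr (f *m p)]mxtrace_mulC; congr (_%:R - _).
have rkE : \rank e = \rank e'.
  by apply: natr_inj_pchar0; rewrite -!mxtrace_idempotent.
have ltKm : (rdegree K < m)%N.
  rewrite (leq_trans _ leUm) // ltn_neqAle rank_leq_row andbT.
  apply: contraNneq f0 => /= e_full; rewrite -fpf.
  have e1 : e = 1%:M.
    have : row_free e by rewrite /row_free; apply/eqP.
    by move/row_free_inj; apply; rewrite ee mul1mx.
  have -> : f *m p = 0 by rewrite -[LHS](subKr 1%:M) -/e e1 subrr.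
  by rewrite mul0mx.
have eqm : mx_rsim (dadd_grepr U C) (dadd_grepr V K).
  exists (block_mx f c b' 0) => [||g Gg] /=.
  - by rewrite rkE; congr addn.
  - apply/row_freeP; exists (block_mx (p *m f *m p) c' b 0).
    have fe' : f *m e' = 0 by rewrite mulmxBr mulmx1 mulmxA fpf subrr.
    have e'p : e' *m (p *m f *m p) = 0.
      by rewrite mulmxBl mul1mx !mulmxA -(mulmxA p f p) -(mulmxA p _ f) fpf mulmxA subrr.
    have fc' : f *m c' = 0.
      by rewrite -[c']mulmx1 -bc' mulmxA mulmxA -(mulmxA f) -def_e' fe' mul0mx.
    have b'p : b' *m (p *m f *m p) = 0.
      by rewrite -[b']mul1mx -bc' -2!mulmxA (mulmxA _ b') -def_e' e'p mulmx0.
    rewrite mulmx_block !(mul0mx, mulmx0, addr0) fc' b'p bc' -def_e.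
    by rewrite !mulmxA fpf subrKC -scalar_mx_block.
  - rewrite !mulmx_block !(mul0mx, mulmx0, addr0, add0r) fP //.
    congr block_mx.
      by rewrite !mulmxA -eP // -mulmxA -(mulmxA _ b) bc mulmx1.
    by rewrite -(mulmxA _ c') -mulmxA eP' // !mulmxA bc' mul1mx.
have eqKC : {in G, forall g, \tr (K g) = \tr (C g)}.
  move=> g Gg; have := trace_rsim eqm Gg.
  by rewrite /= !mxtrace_block eqUV // => /addrI.
have /rep_class_rsim := eqm.
by rewrite !rep_classD (IHm K C ltKm eqKC) => /addIr.
Qed.

End CharactersDetermine.

Section VirtualCharacters.
Variables (F : fieldType) (gT : finGroupType) (G : {group gT}).
Implicit Types (u v : Rep F G) (phi psi : gT -> F).

(** Characters are attached to elements of the quotient ring by a relation, which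
avoids choosing representatives. *)
Definition affords u phi := exists U V : representation F G,
  u = rep_class U - rep_class V /\ {in G, forall g, phi g = \tr (U g) - \tr (V g)}.

Lemma affords_inj u v phi : [pchar F] =i pred0 -> affords u phi -> affords v phi -> u = v.
Proof.
move=> F0 [U [V [-> UV]]] [U' [V' [-> UV']]].
apply/eqP; rewrite subr_eq addrAC eq_sym subr_eq -!rep_classD; apply/eqP.
apply: rep_class_trace => // g Gg /=; rewrite !mxtrace_block.
by apply/eqP; rewrite -subr_eq addrAC eq_sym -subr_eq -UV // UV'.
Qed.

Lemma affords_rep (U : representation F G) : affords (rep_class U) (fun g => \tr (U g)).
Proof.
exists U, (@grepr0 F gT G); split; last by move=> g _; rewrite /= mxtrace1 subr0.
suff -> : rep_class (@grepr0 F gT G) = 0 by rewrite subr0.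
by [].
Qed.

Lemma affords0 : affords 0 (fun=> 0).
Proof. by exists (@grepr0 F gT G), (@grepr0 F gT G); split=> [|g _]; rewrite subrr. Qed.

Lemma affords1 : affords 1 (fun=> 1).
Proof.
have [U [V [def1 tr1]]] := affords_rep (triv_rep F G).
exists U, V; split; first by rewrite -def1 rep_class1.
by move=> g Gg; rewrite -tr1 //= mxtrace1.
Qed.

Lemma affordsN u phi : affords u phi -> affords (- u) (fun g => - phi g).
Proof.
move=> [U [V [-> UV]]]; exists V, U; split=> [|g Gg]; first by rewrite opprB.
by rewrite UV // opprB.
Qed.

Lemma affordsD u v phi psi :
  affords u phi -> affords v psi -> affords (u + v) (fun g => phi g + psi g).
Proof.
move=> [U [V [-> UV]]] [U' [V' [-> UV']]].
exists (dadd_grepr U U'), (dadd_grepr V V'); split=> [|g Gg].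
  by rewrite !rep_classD opprD addrACA.
by rewrite UV // UV' //= !mxtrace_block opprD addrACA.
Qed.

Lemma affordsM u v phi psi :
  affords u phi -> affords v psi -> affords (u * v) (fun g => phi g * psi g).
Proof.
move=> [U [V [-> UV]]] [U' [V' [-> UV']]].
exists (dadd_grepr (tensor_rep U U') (tensor_rep V V')).
exists (dadd_grepr (tensor_rep U V') (tensor_rep V U')); split=> [|g Gg].
  by rewrite !rep_classD !rep_classM; ring.
by rewrite UV // UV' //= !mxtrace_block !mxtrace_prod; ring.
Qed.

End VirtualCharacters.

(** * Lucas sequences and the Narayana polynomial *)
Section LucasSequences.
Variables (A : comNzRingType) (s t : A).
Implicit Types i j k l m n : nat.

Fixpoint lucas m : A :=
  match m with
  | 0%N => 0
  | 1%N => 1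
  | (m''.+1 as m').+1 => s * lucas m' + t * lucas m''
  end.

Definition lucas_fact m : A := \prod_(1 <= i < m.+1) lucas i.

(** This is the Fibonomial coefficient with i + j above i. The recursion shows that
it is polynomial in s and t. *)
Fixpoint lucasnomial i : nat -> A :=
  match i with
  | 0%N => fun=> 1
  | i'.+1 => fix lucasnomial_i j :=
      match j with
      | 0%N => 1
      | j'.+1 => lucas i'.+2 * lucasnomial_i j' + t * lucas j' * lucasnomial i' j'.+1
      end
  end.

(** With m = k + l this is {m choose k}^2 + t {m choose k+1} {m choose k-1}; if k or
l is 0 the second term is absent and the first one is 1. *)
Definition lucas_narayana k l : A :=
  match k, l with
  | k'.+1, l'.+1 =>
      lucasnomial k l ^+ 2 + t * (lucasnomial k.+1 l' * lucasnomial k' l.+1)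
  | _, _ => 1
  end.

Lemma lucasSS m : lucas m.+2 = s * lucas m.+1 + t * lucas m.
Proof. by []. Qed.

Lemma lucas_factS m : lucas_fact m.+1 = lucas_fact m * lucas m.+1.
Proof. by rewrite /lucas_fact big_nat_recr. Qed.

Lemma lucasnomial0 j : lucasnomial 0 j = 1. Proof. by []. Qed.

Lemma lucasnomialn0 i : lucasnomial i 0 = 1. Proof. by case: i. Qed.

Lemma lucasnomialSS i j : lucasnomial i.+1 j.+1 =
  lucas i.+2 * lucasnomial i.+1 j + t * lucas j * lucasnomial i j.+1.
Proof. by []. Qed.

Lemma lucasD i j :
  lucas (i + j).+1 = lucas i.+1 * lucas j.+1 + t * (lucas i * lucas j).
Proof.
suff [] : lucas (i + j).+1 = lucas i.+1 * lucas j.+1 + t * (lucas i * lucas j) /\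
  lucas (i + j).+2 = lucas i.+1 * lucas j.+2 + t * (lucas i * lucas j.+1) by [].
elim: j => [|j [IH1 IH2]]; rewrite ?addn0 ?addnS; first by split; rewrite ?lucasSS /=;
  ring.
by split=> //; rewrite lucasSS IH1 IH2 !lucasSS; ring.
Qed.

(** Induction through [lucasD], which splits {i+j+2} in the same way as the
recursion splits the binomial. *)
Lemma lucasnomial_fact i j :
  lucasnomial i j * (lucas_fact i * lucas_fact j) = lucas_fact (i + j).
Proof.
have [m] := ubnP (i + j); elim: m => // m IHm in i j *.
have F0 : lucas_fact 0 = 1 by rewrite /lucas_fact big_geq.
case: i j => [|i] [|j] lt_m; rewrite ?lucasnomialn0 ?lucasnomial0 ?F0 ?addn0 ?add0n
  ?mul1r ?mulr1 //.
rewrite lucasnomialSS addnS [RHS]lucas_factS lucasD.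
have := IHm i.+1 j; have := IHm i j.+1; rewrite !lucas_factS addnS addSn => IH1 IH2.
transitivity (lucas i.+2 * lucas j.+1 * (lucasnomial i.+1 j *
  (lucas_fact i * lucas i.+1 * lucas_fact j)) +
  t * lucas j * lucas i.+1 * (lucasnomial i j.+1 * (lucas_fact i *
    (lucas_fact j * lucas j.+1)))).
  by ring.
by rewrite IH1 ?IH2 ?lucas_factS ?addSn; try lia; ring.
Qed.

(** Cleared of denominators, both terms of the left-hand side contain the square of
{k+l}!, with coefficients {k+1}{l+1} and t{k}{l}; by [lucasD] these add up to
{k+l+1}. *)
Lemma lucas_narayana_fact k l :
  lucas_narayana k l *
    (lucas_fact k * lucas_fact l.+1 * (lucas_fact k.+1 * lucas_fact l)) =
  lucas (k + l).+1 * lucas_fact (k + l) ^+ 2.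
Proof.
have F0 : lucas_fact 0 = 1 by rewrite /lucas_fact big_geq.
case: k l => [|k] [|l].
- by rewrite /= !lucas_factS F0 /=; ring.
- by rewrite add0n /= !lucas_factS F0 /=; ring.
- by rewrite addn0 /= !lucas_factS F0 /=; ring.
rewrite /lucas_narayana lucasD.
have H1 := lucasnomial_fact k.+1 l.+1.
have H2 : lucasnomial k.+2 l * (lucas_fact k.+2 * lucas_fact l) = lucas_fact
  (k.+1 + l.+1).
  by rewrite lucasnomial_fact; congr lucas_fact; lia.
have H3 : lucasnomial k l.+2 * (lucas_fact k * lucas_fact l.+2) = lucas_fact
  (k.+1 + l.+1).
  by rewrite lucasnomial_fact; congr lucas_fact; lia.
transitivity ((lucasnomial k.+1 l.+1 * (lucas_fact k.+1 * lucas_fact l.+1)) ^+ 2 *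
    lucas k.+2 * lucas l.+2 +
  t * lucas k.+1 * lucas l.+1 * (lucasnomial k.+2 l * (lucas_fact k.+2 * lucas_fact l)) *
   (lucasnomial k l.+2 * (lucas_fact k * lucas_fact l.+2))).
  by rewrite !lucas_factS; ring.
by rewrite H1 H2 H3; ring.
Qed.

End LucasSequences.

Section LucasMorphism.
Variables (A B : comNzRingType) (f : {rmorphism A -> B}) (s t : A).

Lemma rmorph_lucas m : f (lucas s t m) = lucas (f s) (f t) m.
Proof.
suff [] : f (lucas s t m) = lucas (f s) (f t) m /\
          f (lucas s t m.+1) = lucas (f s) (f t) m.+1 by [].
elim: m => [|m [IH1 IH2]]; first by rewrite rmorph0 rmorph1.
by rewrite !lucasSS rmorphD !rmorphM -IH1 -IH2.
Qed.

Lemma rmorph_lucasnomial i j :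
  f (lucasnomial s t i j) = lucasnomial (f s) (f t) i j.
Proof.
elim: i j => [|i IHi] j; first by rewrite rmorph1.
elim: j => [|j IHj]; first by rewrite rmorph1.
by rewrite !lucasnomialSS rmorphD !rmorphM !rmorph_lucas IHi IHj.
Qed.

Lemma rmorph_lucas_narayana k l :
  f (lucas_narayana s t k l) = lucas_narayana (f s) (f t) k l.
Proof.
case: k l => [|k] [|l]; rewrite ?rmorph1 // /lucas_narayana.
by rewrite rmorphD rmorphXn !rmorphM !rmorph_lucasnomial.
Qed.

End LucasMorphism.

Lemma fibpolyE m : fibpoly m = lucas 'X 'Y m.
Proof.
suff [] : fibpoly m = lucas 'X 'Y m /\ fibpoly m.+1 = lucas 'X 'Y m.+1 by [].
by elim: m => // m [IH1 IH2]; split=> //; rewrite lucasSS -IH1 -IH2.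
Qed.

Lemma fibfactE m : fibfact m = lucas_fact 'X 'Y m.
Proof. by apply: eq_bigr => i _; apply: fibpolyE. Qed.

Lemma fibpoly_neq0 m : fibpoly m.+1 != 0.
Proof.
(* At s = t = 1 the values are the Fibonacci numbers. *)
pose ev : {rmorphism {poly {poly int}} -> int} := horner_eval 1 \o horner_eval 1.
suff: 0 < ev (fibpoly m.+1) by apply: contraTneq => ->; rewrite rmorph0.
have -> : ev (fibpoly m.+1) = lucas 1 1 m.+1.
  by rewrite fibpolyE rmorph_lucas /ev /= !horner_evalE !hornerE.
suff [] : 0 < lucas 1 1 m.+1 :> int /\ 0 <= lucas 1 1 m :> int by [].
elim: m => // m [h1 h2]; split; last exact: Order.POrderTheory.ltW.
rewrite lucasSS !mul1r; lia.
Qed.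

Lemma fibfact_neq0 m : fibfact m != 0.
Proof.
rewrite /fibfact big_add1 /= big_mkord; apply/prodf_neq0 => i _.
exact: fibpoly_neq0.
Qed.

Lemma narayana_fraction n k : (k < n)%N ->
  (lucas_narayana 'X 'Y k (n - k.+1))%:F =
  (fibpoly n)%:F^-1 * fibonomial n k * fibonomial n k.+1.
Proof.
move=> lt_kn; set l := (n - k.+1)%N.
have def_n : n = (k + l).+1 by rewrite /l; lia.
rewrite /fibonomial -/l.
have -> : (n - k = l.+1)%N by rewrite /l; lia.
have tofracE (x y : {poly {poly int}}) : x = y -> x%:F = y%:F by move=> ->.
have := tofracE _ _ (lucas_narayana_fact 'X 'Y k l).
rewrite -fibpolyE -!fibfactE -def_n expr2 !rmorphM /= => e.
have nz x : x != 0 -> (x : {poly {poly int}})%:F != 0 by rewrite tofrac_eq0.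
have := nz _ (fibfact_neq0 k); have := nz _ (fibfact_neq0 l).
have := nz _ (fibfact_neq0 k.+1); have := nz _ (fibfact_neq0 l.+1).
have : (fibpoly n)%:F != 0 by apply: nz; rewrite def_n fibpoly_neq0.
have -> : fibfact n = fibfact (k + l) * fibpoly n.
  by rewrite !fibfactE fibpolyE def_n lucas_factS.
rewrite rmorphM /=.
have algebra (K : fieldType) (p a b c d f g : K) :
    p * (a * b * (c * d)) = f * (g * g) ->
    f != 0 -> b != 0 -> c != 0 -> d != 0 -> a != 0 ->
  p = f^-1 * (g * f / (a * b)) * (g * f / (c * d)).
  move=> e' f0 b0 c0 d0 a0; have D0 : a * b * (c * d) != 0 by rewrite !mulf_neq0.
  by apply: (mulIf D0); rewrite e'; field; rewrite a0 b0 c0 d0 f0.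
exact: algebra.
Qed.

(** The hypotheses say that the sequence has period d and vanishes only at multiples
of d. *)
Section LucasTheorem.
Variables (K : fieldType) (s t : K) (d : nat).
Hypothesis d_gt1 : (1 < d)%N.
Hypothesis lucas_d : lucas s t d = 0.
Hypothesis lucas_dS : lucas s t d.+1 = 1.
Hypothesis lucas_neq0 : forall i, (0 < i < d)%N -> lucas s t i != 0.
Local Notation f := (lucas s t).
Local Notation lbin := (lucasnomial s t).

Lemma lucas_period m : f (m + d)%N = f m.
Proof.
suff [] : f (m + d) = f m /\ f (m + d).+1 = f m.+1 by [].
elim: m => [|m [IH1 IH2]]; rewrite ?add0n ?lucas_d ?lucas_dS // addSn.
by split=> //; rewrite lucasSS IH1 IH2.
Qed.

Lemma lucas_periodM m k : f (d * k + m)%N = f m.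
Proof. by elim: k => [|k IH]; rewrite ?muln0 // mulnS -addnA addnC lucas_period. Qed.

Lemma lucas_dP : t * f d.-1 = 1.
Proof.
case: d d_gt1 lucas_d lucas_dS => [|d'] // _ e1 e2.
by move: e2; rewrite lucasSS e1 mulr0 add0r.
Qed.

Lemma lucas_fact_neq0 i : (i < d)%N -> lucas_fact s t i != 0.
Proof.
move=> lt_id; rewrite /lucas_fact big_add1 big_mkord; apply/prodf_neq0 => j _.
by apply: lucas_neq0; have := ltn_ord j; lia.
Qed.

(** {u+v}! contains the factor {d} = 0, while {u}! and {v}! are nonzero. *)
Lemma lucasnomial_overflow u v :
  (u < d)%N -> (v < d)%N -> (d <= u + v)%N -> lbin u v = 0.
Proof.
move=> ud vd uvd; have := lucasnomial_fact s t u v.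
have -> : lucas_fact s t (u + v) = 0.
  rewrite /lucas_fact (big_cat_nat (n := d)) /=; try lia.
  by rewrite [X in _ * X]big_ltn ?ltnS // lucas_d mul0r mulr0.
move/eqP; rewrite !mulf_eq0 (negPf (lucas_fact_neq0 ud)) (negPf (lucas_fact_neq0 vd)).
by rewrite !orbF => /eqP.
Qed.

(** Both sides satisfy the recursion of [lucasnomial]. When u or v is 0 the index
that is decreased wraps around to d - 1: one of the two terms then vanishes by
[lucasnomial_overflow], or, if u = v = 0, the recursion becomes that of Pascal,
since t {d-1} = 1. *)
Theorem lucasnomial_Lucas I u J v : (u < d)%N -> (v < d)%N ->
  lbin (d * I + u)%N (d * J + v)%N = 'C(I + J, I)%:R * lbin u v.
Proof.
have [m] := ubnP (d * I + u + (d * J + v)).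
elim: m => // m IHm in I u J v *; move=> lt_m ud vd.
case: u v ud vd lt_m => [|u] [|v] ud vd lt_m.
- rewrite !addn0; case: I J lt_m => [|I] [|J] lt_m;
  rewrite ?muln0 ?lucasnomial0 ?lucasnomialn0 ?bin0 ?mulr1 ?addn0 ?binn //.
  have eI : (d * I.+1 = (d * I + d.-1).+1)%N by lia.
  have eJ : (d * J.+1 = (d * J + d.-1).+1)%N by lia.
  rewrite eI eJ lucasnomialSS -eI -eJ.
  have -> : ((d * I.+1).+1 = d * I.+1 + 1)%N by lia.
  rewrite !lucas_periodM -[X in lbin X _]addn0 -[X in _ + _ * lbin _ X]addn0.
  rewrite !IHm; try lia.
  rewrite lucas_dP lucasnomial0 lucasnomialn0 !mulr1 !mul1r.
  by rewrite !addSn !addnS [in RHS]binS natrD.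
- case: I lt_m => [|I] lt_m; first by rewrite muln0 add0n bin0 mul1r.
  have eI : (d * I.+1 + 0 = (d * I + d.-1).+1)%N by lia.
  rewrite eI addnS lucasnomialSS -eI -(addnS (d * J)).
  have -> : ((d * I.+1 + 0).+1 = d * I.+1 + 1)%N by lia.
  rewrite !lucas_periodM !IHm; try lia.
  rewrite (lucasnomial_overflow (u := d.-1)); try lia.
  by rewrite !lucasnomial0 !mulr0 addr0 !mulr1 mul1r.
- case: J lt_m => [|J] lt_m; first by rewrite muln0 !addn0 !lucasnomialn0 binn mulr1.
  have eJ : (d * J.+1 + 0 = (d * J + d.-1).+1)%N by lia.
  rewrite eJ addnS lucasnomialSS -eJ -!(addnS (d * I)).
  rewrite !lucas_periodM !IHm; try lia.
  rewrite (lucasnomial_overflow (v := d.-1)); try lia.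
  by rewrite lucas_dP !lucasnomialn0 !mulr0 add0r !mulr1 mul1r.
rewrite !addnS lucasnomialSS -!(addnS (d * I)) -!(addnS (d * J)) !lucas_periodM !IHm;
  try lia.
by rewrite lucasnomialSS; ring.
Qed.

End LucasTheorem.

(** Unlike 'C(n, k.-1), this is 0 at k = 0. *)
Definition bin_pred n k := if k is k'.+1 then 'C(n, k') else 0%N.

Section LucasNarayanaValues.
Variable K : fieldType.
Implicit Types (k l m : nat).

Lemma lucas_natural m : lucas (2 : K) (-1) m = m%:R.
Proof.
suff [] : lucas (2 : K) (-1) m = m%:R /\ lucas (2 : K) (-1) m.+1 = m.+1%:R by [].
elim: m => // m [IH1 IH2]; split=> //; rewrite lucasSS IH1 IH2 -!natr1; ring.
Qed.

Lemma lucasnomial_binomial i j : [pchar K] =i pred0 ->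
  lucasnomial (2 : K) (-1) i j = 'C(i + j, i)%:R.
Proof.
move=> /pcharf0P K0.
have Fm m : lucas_fact (2 : K) (-1) m = (m`!)%:R.
  rewrite /lucas_fact fact_prod natr_prod; apply: eq_bigr => p _.
  exact: lucas_natural.
have nz : (i`! * j`!)%:R != 0 :> K by rewrite K0 -lt0n muln_gt0 !fact_gt0.
apply: (mulIf nz); rewrite -natrM.
have := bin_fact (leq_addr j i); rewrite addKn => ->.
by rewrite -Fm -lucasnomial_fact !Fm natrM.
Qed.

Lemma lucas_narayana_identity k l : [pchar K] =i pred0 ->
  lucas_narayana (2 : K) (-1) k l =
  ('C(k + l, k) ^ 2)%:R - ('C(k + l, k.+1) * bin_pred (k + l) k)%:R.
Proof.
move=> K0; case: k l => [|k] [|l].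
- by rewrite muln0 subr0.
- by rewrite bin0 muln0 subr0.
- by rewrite addn0 binn bin_small // subr0.
rewrite /lucas_narayana !lucasnomial_binomial // /bin_pred.
have -> : (k.+2 + l = k.+1 + l.+1)%N by lia.
have -> : (k + l.+2 = k.+1 + l.+1)%N by lia.
by rewrite natrX natrM mulN1r.
Qed.

Lemma lucas_narayana_reflection k l : ~~ odd (k + l) ->
  lucas_narayana (0 : K) 1 k l =
  ('C((k + l)./2, k./2) * 'C((k + l)./2, uphalf k))%:R.
Proof.
move=> even_kl.
have f2 : lucas (0 : K) 1 2 = 0 by rewrite /=; ring.
have f3 : lucas (0 : K) 1 3 = 1 by rewrite /=; ring.
have fn0 i : (0 < i < 2)%N -> lucas (0 : K) 1 i != 0.
  by case: i => [|[|]] // _; rewrite /= oner_neq0.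
(* {i} is the parity of i, so that Lucas applies with d = 2. *)
have luc := lucasnomial_Lucas (isT : 1 < 2)%N f2 f3 fn0.
have l11 : lucasnomial (0 : K) 1 1 1 = 0 by rewrite /=; ring.
case: k l even_kl => [|k] [|l] even_kl.
- by rewrite /= bin0 mul1n.
- by rewrite /= !bin0 mul1n.
- rewrite addn0 in even_kl *.
  have e : uphalf k.+1 = (k.+1)./2 by rewrite uphalfE; lia.
  by rewrite e !binn mul1n.
rewrite /lucas_narayana.
have [k_odd | k_even] := boolP (odd k).
  set I := (k.+1)./2; set J := (l.+1)./2.
  have eI : k.+1 = (2 * I + 0)%N by rewrite /I; lia.
  have eJ : l.+1 = (2 * J + 0)%N by rewrite /J; lia.
  rewrite eI eJ luc //.
  have -> : lucasnomial (0 : K) 1 (2 * I + 0).+1 l = 0.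
    have -> : l = (2 * J.-1 + 1)%N by lia.
    have -> : ((2 * I + 0).+1 = 2 * I + 1)%N by lia.
    by rewrite luc // l11 mulr0.
  have -> : ((2 * I + 0 + (2 * J + 0))./2 = I + J)%N by lia.
  have -> : uphalf (2 * I + 0) = I by lia.
  by rewrite lucasnomial0 natrM mulr1; ring.
set I := (k.+1)./2; set J := (l.+1)./2.
have eI : k.+1 = (2 * I + 1)%N by rewrite /I; lia.
have eJ : l.+1 = (2 * J + 1)%N by rewrite /J; lia.
rewrite [in X in X ^+ 2]eI [in X in X ^+ 2]eJ luc // l11.
have -> : k.+2 = (2 * I.+1 + 0)%N by lia.
have -> : l = (2 * J + 0)%N by lia.
have -> : k = (2 * I + 0)%N by lia.
have -> : ((2 * J + 0).+2 = 2 * J.+1 + 0)%N by lia.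
rewrite !luc // lucasnomial0.
have -> : (((2 * I + 0).+1 + (2 * J + 0).+1)./2 = I.+1 + J)%N by lia.
have -> : uphalf (2 * I + 0).+1 = I.+1 by lia.
by rewrite addnS -addSn natrM; ring.
Qed.

Section Rotation.
Variables (s : K) (d : nat).
Hypotheses (d_gt2 : (2 < d)%N) (d_odd : odd d).
Local Notation f := (lucas s (-1)).
Local Notation lbin := (lucasnomial s (-1)).
Hypothesis lucas_d : f d = 0.
Hypothesis lucas_dS : f d.+1 = 1.
Hypothesis lucas_neq0 : forall i, (0 < i < d)%N -> f i != 0.

(** For t = -1 the recursion is symmetric under reversal, and {d} = 0. *)
Lemma lucas_antisym i j : (i + j)%N = d -> f i = - f j.
Proof.
suff h m : (m < d)%N -> f (d - m)%N = - f m /\ f (d - m.+1)%N = - f m.+1.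
  move=> ij; have [jd|j_neq] := eqVneq j d; last first.
    by have [] := h j ltac:(lia); rewrite -ij addnK.
  by rewrite jd lucas_d (_ : i = 0%N) ?oppr0 //=; lia.
elim: m => [|m IH] lt_m.
  rewrite subn0 lucas_d oppr0; split=> //; rewrite subn1.
  have := lucas_dP (ltnW d_gt2) lucas_d lucas_dS; rewrite mulN1r => e.
  by apply: oppr_inj; rewrite e opprK.
have [IH1 IH2] := IH ltac:(lia); split=> //.
have e : f (d - m)%N = s * f (d - m.+1)%N + -1 * f (d - m.+2)%N.
  have -> : (d - m = (d - m.+2).+2)%N by lia.
  by rewrite lucasSS; congr (s * f _ + _); lia.
have -> : f (d - m.+2)%N = s * f (d - m.+1)%N - f (d - m)%N by rewrite e; ring.
by rewrite IH1 IH2 lucasSS; ring.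
Qed.

(** Passing from u to u + 1 multiplies by {d-1-u} / {u+1} = -1. *)
Lemma lucasnomial_alternate u v : (u + v)%N = d.-1 -> lbin u v = (-1) ^+ u.
Proof.
elim: u v => [|u IH] v uv; first by rewrite lucasnomial0.
have fu : f u.+1 != 0 by apply: lucas_neq0; lia.
have Fu : lucas_fact s (-1) u != 0 by apply: (lucas_fact_neq0 (d := d)) => //; lia.
have Fv : lucas_fact s (-1) v != 0 by apply: (lucas_fact_neq0 (d := d)) => //; lia.
rewrite exprS mulN1r -(IH v.+1); last by lia.
apply: (mulIf fu); apply: (mulIf Fu); apply: (mulIf Fv).
have := lucasnomial_fact s (-1) u.+1 v; rewrite addSnnS -lucasnomial_fact !lucas_factS.
have -> : f v.+1 = - f u.+1 by apply: lucas_antisym; lia.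
move=> h; transitivity (lbin u.+1 v * (lucas_fact s (-1) u * f u.+1 * lucas_fact s (-1)
  v)).
  by ring.
by rewrite h; ring.
Qed.

Local Notation narayana := (lucas_narayana s (-1)).
Let luc := lucasnomial_Lucas (ltnW d_gt2) lucas_d lucas_dS lucas_neq0.

(** By Lucas the three Fibonomials in the definition reduce to binomials with signs;
Pascal's rule combines the two terms that are left. *)
Lemma lucas_narayana_rotation_gap I J :
  narayana (d * I)%N (d * J + d.-1)%N = ('C(I + J, I) * 'C((I + J).+1, I))%:R.
Proof.
case: I => [|I].
  by rewrite muln0 add0n !bin0; case: (d * J + d.-1)%N.
have eI : (d * I.+1 = (d * I + d.-1).+1)%N by lia.
have eJ : (d * J + d.-1 = (d * J + d.-2).+1)%N by lia.
rewrite [in LHS]eI [in LHS]eJ /lucas_narayana -eI -eJ.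
have -> : ((d * I.+1).+1 = d * I.+1 + 1)%N by lia.
have -> : ((d * J + d.-1).+1 = d * J.+1 + 0)%N by lia.
rewrite -[X in lbin X _ ^+ 2]addn0 !luc; try lia.
rewrite !lucasnomial_alternate; try lia.
rewrite expr0 expr1 -signr_odd (_ : odd d.-1 = false) ?expr0; last by lia.
by rewrite natrM [in RHS]binS natrD addnS -addSn; ring.
Qed.

Lemma lucas_narayana_rotation_block I J :
  narayana (d * I + d.-1)%N (d * J)%N = ('C(I + J, I) * 'C((I + J).+1, I.+1))%:R.
Proof.
case: J => [|J].
  by rewrite muln0 addn0 !binn; case: (d * I + d.-1)%N.
have eI : (d * I + d.-1 = (d * I + d.-2).+1)%N by lia.
have eJ : (d * J.+1 = (d * J + d.-1).+1)%N by lia.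
rewrite [in LHS]eI [in LHS]eJ /lucas_narayana -eI -eJ.
have -> : ((d * J.+1).+1 = d * J.+1 + 1)%N by lia.
have -> : ((d * I + d.-1).+1 = d * I.+1 + 0)%N by lia.
rewrite -[X in lbin _ X ^+ 2]addn0 !luc; try lia.
rewrite !lucasnomial_alternate; try lia.
have e1 : (-1) ^+ d.-1 = 1 :> K by rewrite -signr_odd (_ : odd d.-1 = false) ?expr0 //;
  lia.
have e2 : (-1) ^+ d.-2 = -1 :> K by rewrite -signr_odd (_ : odd d.-2 = true) ?expr1 //;
  lia.
by rewrite e1 e2 expr0 natrM [in RHS]binS natrD addnS -addSn; ring.
Qed.

(** Both terms reduce to the same square, with opposite signs. *)
Lemma lucas_narayana_rotation_zero I u J v : (u.+1 + v.+1)%N = d.-1 ->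
  narayana (d * I + u.+1)%N (d * J + v.+1)%N = 0.
Proof.
move=> uv; rewrite !addnS /lucas_narayana -!addnS !luc; try lia.
by rewrite !lucasnomial_alternate; try lia; rewrite !exprS; ring.
Qed.

End Rotation.
End LucasNarayanaValues.

(** * Non-crossing equivalences on the integers *)
Section Arches.
Implicit Types a b c d i j k w x y z : int.

Lemma int_max (P : int -> Prop) a b : P a -> (forall x, P x -> x <= b) ->
  exists m, [/\ P m, a <= m & forall x, P x -> x <= m].
Proof.
move=> Pa Pb; have [n] := ubnP `|b - a|%N; elim: n => // n IH in a Pa *.
move=> lt_n; have [h | /existsNP[x /not_implyP[Px /negP x_gt]]] :=
  pselect (forall x, P x -> x <= a); first by exists a; split=> //; lia.
have le_b := Pb _ Px; have [|m [Pm xm mP]] := IH x Px; first by lia.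
by exists m; split=> //; lia.
Qed.

Lemma int_min (P : int -> Prop) a b : P a -> (forall x, P x -> b <= x) ->
  exists m, [/\ P m, m <= a & forall x, P x -> m <= x].
Proof.
move=> Pa Pb; have [||m [Pm am mP]] := @int_max (fun x => P (- x)) (- a) (- b).
- by rewrite opprK.
- by move=> x /Pb; lia.
exists (- m); split=> // [|x Px]; first by lia.
by have := mP (- x); rewrite opprK => /(_ Px); lia.
Qed.

Definition is_first (e : int -> int -> Prop) i := forall x, x < i -> ~ e x i.
Definition is_last (e : int -> int -> Prop) i := forall x, i < x -> ~ e i x.

(** D i counts, up to a constant, the blocks that have begun at or before i and have
not ended before i; L marks the first elements and R the last ones. *)
Definition heights (L R : int -> bool) (D : int -> int) :=
  forall i, D (i + 1) = D i - (R i)%:Z + (L (i + 1))%:Z.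

(** D k - R k is the number of blocks that pass over the edge from k to k + 1, so
that i and j are related when they are at the same level and no edge between them
is below this level. The disjunction on k makes the definition symmetric. *)
Definition arch (R : int -> bool) (D : int -> int) i j :=
  D i = D j /\ forall k, (i <= k < j) || (j <= k < i) -> D i <= D k - (R k)%:Z.

Record noncrossing_equiv (e : int -> int -> Prop) : Prop := NoncrossingEquiv {
  nce_refl : forall a, e a a;
  nce_sym : forall a b, e a b -> e b a;
  nce_trans : forall b a c, e a b -> e b c -> e a c;
  nce_nc : forall a b c d, a < b -> b < c -> c < d -> e a c -> e b d -> e a b }.

Section ArchesOfBlocks.
Variables (e : int -> int -> Prop) (L R : int -> bool) (D : int -> int).
Hypothesis eP : noncrossing_equiv e.
Hypothesis firstP : forall i, L i <-> is_first e i.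
Hypothesis lastP : forall i, R i <-> is_last e i.
Hypothesis DP : heights L R D.

Let refl := nce_refl eP.
Let sym := nce_sym eP.
Let trans := nce_trans eP.
Let nc := nce_nc eP.

Definition closed_interval i j := forall x y, i < x -> x < j -> e x y -> i < y < j.

(** An interval whose points are only related to one another consists of complete
blocks, hence the level returns to its initial value after it and never falls
below. Two related points are joined by steps within their block; the points
strictly between consecutive elements form such an interval, because nothing
crosses. The two claims feed each other in an induction on the length. *)
Lemma arch_bounds (n : nat) :
  (forall i j, i < j -> j - i <= n%:Z -> closed_interval i j ->
     D i - (R i)%:Z = D j - (L j)%:Z /\
     forall k, i <= k < j -> D i - (R i)%:Z <= D k - (R k)%:Z) /\
  (forall i j, i < j -> j - i <= n%:Z -> e i j ->
     D i = D j /\ forall k, i <= k < j -> D i <= D k - (R k)%:Z).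
Proof.
elim: n => [|n [IHc IHe]]; first by split=> i j; lia.
have closedP i j : i < j -> j - i <= n.+1%:Z -> closed_interval i j ->
     D i - (R i)%:Z = D j - (L j)%:Z /\
     forall k, i <= k < j -> D i - (R i)%:Z <= D k - (R k)%:Z.
  move=> lt_ij len cl; have Di := DP i.
  have [ej | nej] := eqVneq j (i + 1).
    rewrite ej; split=> [|k hk]; first by lia.
    by have -> : k = i by lia.
  have [x def_x] : {x : int | x = i + 1} by exists (i + 1).
  rewrite -def_x in Di nej; have lt_xj : x < j by lia.
  have Lx : L x.
    apply/firstP => z lt_zx /sym e_xz.
    by have := cl x z ltac:(lia) ltac:(lia) e_xz; lia.
  (* y is the last element of the block that begins at x. *)
  have [|z [_ hz]|y [[e_xy yj] le_xy y_max]] := @int_max (fun y => e x y /\ y < j) x j.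
  - by split=> //; lia.
  - by lia.
  have Ry : R y.
    apply/lastP => z lt_yz e_yz; have e_xz := trans e_xy e_yz.
    have := cl x z ltac:(lia) ltac:(lia) e_xz => hz.
    have lt_zj : z < j by lia.
    by have := y_max z (conj e_xz lt_zj); lia.
  have [Dxy Exy] : D x = D y /\ forall k, x <= k < y -> D x <= D k - (R k)%:Z.
    have [<-|nxy] := eqVneq x y; first by split=> // k hk; lia.
    by apply: IHe => //; lia.
  have [|||Dyj Eyj] := IHc y j; try lia.
    move=> z w yz zj e_zw; have := cl z w ltac:(lia) ltac:(lia) e_zw => hw.
    have no_xz : ~ e x z by move=> e_xz; have := y_max z (conj e_xz zj); lia.
    suff : ~ (w <= y) by lia.
    move=> le_wy; apply: no_xz; apply: trans (sym e_zw).
    have [-> //|nxw] := eqVneq x w; have [-> //|nwy] := eqVneq w y.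
    by apply: (nc (c := y) (d := z)) => //; try lia; apply: sym.
  split=> [|k hk]; first by lia.
  have [k_i|k_x] := ltP k x; first by have -> : k = i by lia.
  have [k_y|k_y] := ltP k y; first by have := Exy k ltac:(lia); lia.
  by have := Eyj k ltac:(lia); lia.
split=> // i j lt_ij len e_ij.
have [[x [ix xj e_ix]] | no] := pselect (exists x, [/\ i < x, x < j & e i x]).
  have [D1 E1] := IHe i x ix ltac:(lia) e_ix.
  have [D2 E2] := IHe x j xj ltac:(lia) (trans (sym e_ix) e_ij).
  split=> [|k hk]; first by lia.
  have [kx|kx] := ltP k x; first by apply: E1; lia.
  by rewrite D1; apply: E2; lia.
have cl : closed_interval i j.
  move=> x y ix xj e_xy; have nx : ~ e i x by move=> h; apply: no; exists x.
  apply/andP; split.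
    have [] // := ltP i y => le_yi; case: nx.
    have [<-|yi] := eqVneq y i; first exact: sym.
    have e_yi : e y i by apply: (nc (c := x) (d := j)) => //; [lia | apply: sym].
    by apply: trans (sym e_yi) (sym e_xy).
  have [] // := ltP y j => le_jy; case: nx.
  have [jy|yj] := eqVneq j y; first by rewrite -jy in e_xy; apply: trans e_ij (sym e_xy).
  by apply: (nc (c := j) (d := y)) => //; lia.
have [D1 E1] := closedP i j lt_ij len cl.
have nR : ~~ R i by apply/negP => /lastP/(_ j lt_ij).
have nL : ~~ L j by apply/negP => /firstP/(_ i lt_ij).
by split=> [|k hk]; [lia | have := E1 k hk; lia].
Qed.

Lemma arch_of_equiv i j : e i j -> arch R D i j.
Proof.
move=> e_ij; have [lt_ij | lt_ji | ->] := ltgtP i j.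
- have [D1 E1] := (arch_bounds `|j - i|).2 i j lt_ij ltac:(lia) e_ij.
  by split=> // k hk; apply: E1; lia.
- have [D1 E1] := (arch_bounds `|j - i|).2 j i lt_ji ltac:(lia) (sym e_ij).
  by split=> // k hk; rewrite -D1; apply: E1; lia.
by split=> // k hk; lia.
Qed.

(** Since the level does not drop after i, the block of i continues to some i'. If
i' <= j, go on from i'. Otherwise j lies below the step from i to i', so that its
block begins strictly after i and its level is higher than that of i. *)
Lemma equiv_of_arch_le i j : i <= j -> arch R D i j -> e i j.
Proof.
have [n] := ubnP `|j - i|%N; elim: n => // n IH in i j *.
move=> len le_ij [Dij Eij]; have [<-|nij] := eqVneq i j; first exact: refl.
have lt_ij : i < j by lia.
have nR : ~ is_last e i by move/lastP => Ri; have := Eij i ltac:(lia); rewrite Ri; lia.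
have [x [ix e_ix]] : exists x, i < x /\ e i x.
  by apply: contrapT => no; apply: nR => x ix e_ix; apply: no; exists x.
have [||i' [[ii' e_ii'] _ i'_min]] := @int_min (fun x => i < x /\ e i x) x i.
- by split.
- by move=> y [iy _]; apply: ltW.
have [Dii' Eii'] := arch_of_equiv e_ii'.
have [le_i'j | lt_ji'] := leP i' j.
  apply: trans e_ii' _; apply: IH => //; first by lia.
  by split=> [|k hk]; [lia | rewrite -Dii'; apply: Eij; lia].
have nij' : ~ e i j by move=> e_ij; have := i'_min j (conj lt_ij e_ij); lia.
have [||y [[iy e_yj] le_yj y_min]] := @int_min (fun y => i < y /\ e y j) j i.
- by split=> //; apply: refl.
- by move=> z [h _]; lia.
have Ly : L y.
  apply/firstP => z lt_zy e_zy; have e_zj := trans e_zy e_yj.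
  have [iz | le_zi] := ltP i z; first by have := y_min z (conj iz e_zj); lia.
  have [zi|nzi] := eqVneq z i; first by rewrite zi in e_zj.
  have lt_zi : z < i by lia.
  exact: nij' (trans (sym (nc lt_zi lt_ij lt_ji' e_zj e_ii')) e_zj).
have [Dyj _] := arch_of_equiv e_yj.
have := DP (y - 1); rewrite subrK Ly; have := Eij (y - 1) ltac:(lia); lia.
Qed.

Theorem arch_equiv i j : e i j <-> arch R D i j.
Proof.
split; first exact: arch_of_equiv.
have [le_ij | lt_ji] := leP i j; first exact: equiv_of_arch_le.
move=> [Dij Eij]; apply: sym; apply: equiv_of_arch_le; first by lia.
by split=> [|k hk]; [| rewrite -Dij; apply: Eij; lia].
Qed.

End ArchesOfBlocks.

Section BlocksOfArches.
Variables (L R : int -> bool) (D : int -> int).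
Hypothesis DP : heights L R D.

Lemma arch_noncrossing_equiv : noncrossing_equiv (arch R D).
Proof.
split=> [a|a b [Dab Eab]|b a c [Dab Eab] [Dbc Ebc]|a b c d ab bc cd [Dac Eac] [Dbd Ebd]].
- by split=> // k hk; lia.
- by split=> // k hk; rewrite -Dab; apply: Eab; lia.
- split=> [|k hk]; first by lia.
  have [h|h] : (a <= k < b) || (b <= k < a) \/ (b <= k < c) || (c <= k < b) by lia.
    exact: Eab.
  by rewrite Dab; apply: Ebc.
have := Eac b ltac:(lia); have := Ebd c ltac:(lia) => h1 h2.
by split=> [|k hk]; [lia | apply: Eac; lia].
Qed.

Lemma arch_first i : L i -> is_first (arch R D) i.
Proof.
move=> Li x lt_xi [Dxi Exi]; have := DP (i - 1); rewrite subrK Li.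
by have := Exi (i - 1) ltac:(lia); lia.
Qed.

Lemma arch_last i : R i -> is_last (arch R D) i.
Proof. by move=> Ri x lt_ix [Dix Eix]; have := Eix i ltac:(lia); rewrite Ri; lia. Qed.

(** The partner is the last point before i where the level is at most D i. *)
Lemma arch_not_first i x0 : ~~ L i -> x0 < i -> D x0 <= D i ->
  exists x, x < i /\ arch R D x i.
Proof.
move=> nLi x0i Dx0.
have [||x [[xi Dx] _ x_max]] := @int_max (fun x => x < i /\ D x <= D i) x0 i.
- by split.
- by move=> y [h _]; lia.
have Dgt k : x < k -> k < i -> D i + 1 <= D k.
  move=> xk ki; have [//|Dk] := leP (D i + 1) (D k).
  have Dk' : D k <= D i by lia.
  by have := x_max k (conj ki Dk'); lia.
have Ege k : x <= k -> k < i -> D i <= D k - (R k)%:Z.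
  move=> xk ki; have := DP k.
  have [->|nki] := eqVneq (k + 1) i; first by lia.
  by have := Dgt (k + 1) ltac:(lia) ltac:(lia); lia.
exists x; split=> //; have Ex := Ege x ltac:(lia) xi.
by split=> [|k hk]; [lia | have := Ege k ltac:(lia) ltac:(lia); lia].
Qed.

(** The partner is the first point after i where the level is at most D i. *)
Lemma arch_not_last i x0 : ~~ R i -> i < x0 -> D x0 <= D i ->
  exists x, i < x /\ arch R D i x.
Proof.
move=> nRi x0i Dx0.
have [||x [[xi Dx] _ x_min]] := @int_min (fun x => i < x /\ D x <= D i) x0 i.
- by split.
- by move=> y [h _]; lia.
have Dgt k : i < k -> k < x -> D i + 1 <= D k.
  move=> xk ki; have [//|Dk] := leP (D i + 1) (D k).
  have Dk' : D k <= D i by lia.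
  by have := x_min k (conj xk Dk'); lia.
have Ege k : i <= k -> k < x -> D i <= D k - (R k)%:Z.
  move=> xk ki; have [->|nki] := eqVneq k i; first by lia.
  by have := Dgt k ltac:(lia) ltac:(lia); lia.
exists x; split=> //; have := DP (x - 1); rewrite subrK.
have := Ege (x - 1) ltac:(lia) ltac:(lia) => h1 h2.
by split=> [|k hk]; [lia | apply: Ege; lia].
Qed.

End BlocksOfArches.

End Arches.

(** * Ballot words *)
Section BallotWords.
Local Open Scope nat_scope.
Implicit Types (w v : seq (bool * bool)) (c : bool * bool) (N p q e h k : nat).

Definition ups w := count fst w.
Definition downs w := count snd w.

(** A letter carries an up step, a down step, both or neither, so that a word
encodes a pair of subsets of its positions. *)
Definition ballot w := all (fun k => downs (take k w) <= ups (take k w)) (iota 0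
  (size w).+1).

Lemma ballotP w : reflect (forall k, k <= size w -> downs (take k w) <= ups (take k w))
  (ballot w).
Proof.
apply: (iffP allP) => [h k le_k | h k]; first by apply: h; rewrite mem_iota; lia.
by rewrite mem_iota => hk; apply: h; lia.
Qed.

Lemma ups_rcons w c : ups (rcons w c) = ups w + c.1.
Proof. by rewrite /ups -cats1 count_cat /= addn0. Qed.

Lemma downs_rcons w c : downs (rcons w c) = downs w + c.2.
Proof. by rewrite /downs -cats1 count_cat /= addn0. Qed.

Lemma ballot_rcons w c :
  ballot (rcons w c) = ballot w && (downs (rcons w c) <= ups (rcons w c)).
Proof.
apply/ballotP/andP => [h | [/ballotP h hc] k]; rewrite ?size_rcons.
  split; last by have := h _ (leqnn _); rewrite take_size.
  apply/ballotP => k le_k; have := h k; rewrite size_rcons => /(_ ltac:(lia)).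
  by rewrite -cats1 takel_cat.
rewrite leq_eqVlt => /predU1P[-> | le_k]; first by rewrite -(size_rcons w c) take_size.
by rewrite -cats1 takel_cat ?h //; lia.
Qed.

Lemma sum_tuple_rcons N (F : seq (bool * bool) -> nat) :
  \sum_(w : N.+1.-tuple (bool * bool)) F w =
  \sum_(w : N.-tuple (bool * bool)) \sum_(c : bool * bool) F (rcons w c).
Proof.
rewrite pair_big /=.
rewrite (reindex (fun p : N.-tuple (bool * bool) * (bool * bool) =>
  [tuple of rcons p.1 p.2])) //=.
exists (fun w : N.+1.-tuple _ => ([tuple of belast (thead w) (behead w)], last
  (thead w) (behead w))).
  move=> [w c] _; have /(congr1 val)/= := tuple_eta [tuple of rcons w c].
  by rewrite lastI => /rcons_inj[e1 e2]; congr pair; [apply: val_inj => /= |];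
    rewrite -?e1 -?e2.
move=> w _; apply: val_inj => /=; rewrite -lastI;
  exact: (congr1 val (esym (tuple_eta w))).
Qed.

Definition ballot_number N p q :=
  \sum_(w : N.-tuple (bool * bool)) (ballot w && (ups w == p) && (downs w == q)).

(** Remove the last letter; as q <= p, only the shorter word has to be checked. *)
Lemma ballot_numberS N p q : q <= p -> ballot_number N.+1 p q =
  ballot_number N p q + (if p is p'.+1 then ballot_number N p' q else 0)
  + (if q is q'.+1 then ballot_number N p q' else 0)
  + (if (p, q) is (p'.+1, q'.+1) then ballot_number N p' q' else 0).
Proof.
move=> le_qp; rewrite /ballot_number.
rewrite (sum_tuple_rcons N (fun w => (ballot w && (ups w == p) && (downs w == q) : nat))).
have pair_sum (G : bool * bool -> nat) :
    \sum_c G c = G (true, true) + G (true, false) + (G (false, true) + G (false, false)).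
  transitivity (\sum_a \sum_b G (a, b)); last by rewrite !big_bool.
  by rewrite pair_bigA; apply: eq_bigr => -[].
have chk u d : (d <= u) && (u == p) && (d == q) = (u == p) && (d == q).
  by case: eqP => [->|]; [case: eqP => [->|]; rewrite ?andbF ?andbT | rewrite andbF].
case: p q le_qp chk => [|p] [|q] // le_qp chk; rewrite ?addn0 -?big_split /=;
  apply: eq_bigr => w _; rewrite pair_sum !ballot_rcons !ups_rcons !downs_rcons /=;
  case: (ballot w) => //=; rewrite !chk ?addn1 ?addn0 ?eqSS //=.
all: move: (ups w) (downs w) => u d; rewrite ?(andbF, add0n, addn0) //; try exact: addnC.
by move: (_ && _) (_ && _) (_ && _) (_ && _) => a b c d'; ring.
Qed.

Lemma ballot_number_gt N p q : p < q -> ballot_number N p q = 0.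
Proof.
move=> lt_pq; rewrite /ballot_number big1 // => w _; apply/eqP; rewrite eqb0.
apply/negP => /andP[/andP[/ballotP/(_ _ (leqnn _))]]; rewrite take_size; lia.
Qed.

Lemma bin_predS N k : bin_pred N.+1 k = bin_pred N k + bin_pred N k.-1.
Proof. by case: k => [|[|k]] //; rewrite /= !bin0 ?addn0. Qed.

(** The determinant 'C(N, p) 'C(N, q) - 'C(N, p+1) 'C(N, q-1) satisfies the recursion
of [ballot_numberS] and vanishes on the boundary q = p + 1, where there is no
ballot word. *)
Theorem ballot_numberE N p q : q <= p.+1 ->
  ballot_number N p q + 'C(N, p.+1) * bin_pred N q = 'C(N, p) * 'C(N, q).
Proof.
elim: N p q => [|N IH] p q.
  rewrite /ballot_number => le_qp; rewrite (big_pred1 [tuple]) => [|w]; last first.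
    by apply/esym/eqP; apply: tuple0.
  by case: p q le_qp => [|p] [|[|q]].
rewrite leq_eqVlt => /predU1P[-> | le_qp].
  by rewrite ballot_number_gt // add0n mulnC.
rewrite ballot_numberS //.
have := IH p q; have := IH p q.-1; have := IH p.-1 q; have := IH p.-1 q.-1.
case: p q le_qp => [|p] [|q] //= le_qp; rewrite ?bin0 ?bin_predS ?binS /=.
- lia.
- lia.
move=> /(_ ltac:(lia)) h1 /(_ ltac:(lia)) h2 /(_ ltac:(lia)) h3 /(_ ltac:(lia)) h4.
move: h1 h2 h3 h4; case: q {le_qp} => [|q] /=; rewrite ?binS ?bin0; nia.
Qed.

(** The sum of determinants telescopes. *)
Lemma sum_ballot_number h e Q : Q <= e./2 ->
  \sum_(q < Q.+1) ballot_number h (e - q) q = 'C(h, e - Q) * 'C(h, Q).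
Proof.
elim: Q => [|Q IH] le_Q.
  rewrite big_ord_recr big_ord0 /= add0n -ballot_numberE ?muln0 ?addn0 //; lia.
rewrite big_ord_recr /= IH; last by lia.
have := @ballot_numberE h (e - Q.+1) Q.+1 ltac:(lia).
have -> : (e - Q.+1).+1 = e - Q by lia.
by move=> /= <-; exact: addnC.
Qed.

Lemma ballot_total h e :
  \sum_(v : h.-tuple (bool * bool)) (ballot v && (ups v + downs v == e)) =
  'C(h, e./2) * 'C(h, uphalf e).
Proof.
have -> : uphalf e = e - e./2 by lia.
rewrite mulnC -sum_ballot_number // /ballot_number exchange_big /=.
apply: eq_bigr => v _; case bv: (ballot v) => /=; last first.
  by rewrite big1 // => q _; rewrite bv.
have {bv}/ballotP/(_ _ (leqnn _)) := bv; rewrite take_size => le_du.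
have [ud | ud] := eqVneq (ups v + downs v) e.
  have lt_d : downs v < e./2.+1 by lia.
  rewrite (bigD1 (Ordinal lt_d)) //= big1 => [|q nq].
    by rewrite eqxx andbT; case: eqP; lia.
  apply/eqP; rewrite eqb0; apply: contraNN nq => /andP[_ /eqP dq].
  by apply/eqP/val_inj.
by rewrite big1 // => q _; apply/eqP; rewrite eqb0; have := ltn_ord q; lia.
Qed.

(** Reading a word backwards turns up steps into down steps. *)
Definition mirror w := rev [seq (c.2, c.1) | c <- w].

Lemma size_mirror w : size (mirror w) = size w.
Proof. by rewrite size_rev size_map. Qed.

Lemma nth_mirror k w : k < size w -> let c := nth (false, false) w (size w - k.+1) in
  nth (false, false) (mirror w) k = (c.2, c.1).
Proof.
move=> lt_k; rewrite /mirror nth_rev ?size_map // (nth_map (false, false)) //; lia.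
Qed.

Lemma mirrorK : involutive mirror.
Proof. by move=> w; rewrite /mirror map_rev revK -map_comp map_id_in // => -[]. Qed.

Lemma mirror_cat v w : mirror (v ++ w) = mirror w ++ mirror v.
Proof. by rewrite /mirror map_cat rev_cat. Qed.

Lemma ups_mirror w : ups (mirror w) = downs w.
Proof. by rewrite /ups /mirror count_rev count_map. Qed.

Lemma downs_mirror w : downs (mirror w) = ups w.
Proof. by rewrite -[w in RHS]mirrorK ups_mirror. Qed.

Lemma take_mirror k w : take k (mirror w) = mirror (drop (size w - k) w).
Proof. by rewrite /mirror take_rev size_map map_drop. Qed.

Lemma ups_cat v w : ups (v ++ w) = ups v + ups w. Proof. exact: count_cat. Qed.
Lemma downs_cat v w : downs (v ++ w) = downs v + downs w. Proof. exact: count_cat. Qed.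

Lemma ballot_cat_mirror v : ballot (v ++ mirror v) = ballot v.
Proof.
apply/ballotP/ballotP => h k le_k.
  have := h k; rewrite size_cat size_mirror takel_cat // => -> //; lia.
have [le_kv | lt_vk] := leqP k (size v); first by rewrite takel_cat // h.
rewrite take_cat ifN -?leqNgt ?(ltnW lt_vk)
  // take_mirror ups_cat downs_cat ups_mirror downs_mirror.
set j := size v - _; have := h j ltac:(lia).
have := ups_cat (take j v) (drop j v); have := downs_cat (take j v) (drop j v).
rewrite cat_take_drop; lia.
Qed.

Lemma palindromic_ballot h e :
  #|[set w : (h + h).-tuple (bool * bool) | [&& ballot w, ups w == e & w
    == mirror w :> seq _]]| =
  'C(h, e./2) * 'C(h, uphalf e).
Proof.
rewrite -ballot_total -big_mkcond /= sum1_card.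
pose f (v : h.-tuple (bool * bool)) : (h + h).-tuple (bool * bool) :=
  insubd [tuple of nseq _ (true, true)] (v ++ mirror v).
have fE (v : h.-tuple (bool * bool)) : f v = v ++ mirror v :> seq _.
  by rewrite /f val_insubd size_cat size_mirror size_tuple eqxx.
rewrite -(card_in_imset (f := f)); last first.
  move=> v w _ _ /(congr1 val); rewrite /= !fE => /eqP; rewrite eqseq_cat ?size_tuple //.
  by case/andP => /eqP /val_inj.
apply: eq_card => w; rewrite inE; apply/and3P/imsetP => [[bw uw /eqP pw] | [v]].
  have sv : size (take h w) == h by rewrite size_takel // size_tuple leq_addr.
  exists (Tuple sv).
    rewrite unfold_in /=; move: bw uw; rewrite -[X in ballot X -> ups X == _
      -> _](cat_take_drop h w).
    have -> : drop h w = mirror (take h w).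
      rewrite {2}pw take_mirror size_tuple addnK mirrorK //.
    by rewrite ballot_cat_mirror ups_cat ups_mirror => -> ->.
  apply: val_inj; rewrite /= fE /= -[LHS](cat_take_drop h w); congr (_ ++ _).
  by rewrite {2}pw take_mirror size_tuple addnK mirrorK.
rewrite unfold_in => /andP[bv uv] ->; rewrite fE ballot_cat_mirror ups_cat ups_mirror
  mirror_cat.
by rewrite mirrorK eqxx.
Qed.

End BallotWords.

(** * Partitions as relations *)
Section SameBlock.
Variable T : finType.
Implicit Types (P Q : {set {set T}}) (x y z : T).

Definition same P x y := y \in pblock P x.

Section OnePartition.
Variable P : {set {set T}}.
Hypothesis partP : partition P setT.

Let covP : cover P = setT. Proof. by case/and3P: partP => /eqP. Qed.
Let trivP : trivIset P. Proof. by case/and3P: partP. Qed.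
Let in_cover x : x \in cover P. Proof. by rewrite covP inE. Qed.

Lemma sameE x y : same P x y = (pblock P x == pblock P y).
Proof. by rewrite eq_pblock. Qed.

Lemma same_refl x : same P x x. Proof. by rewrite sameE. Qed.
Lemma same_sym x y : same P x y = same P y x. Proof. by rewrite !sameE eq_sym. Qed.
Lemma same_trans y x z : same P x y -> same P y z -> same P x z.
Proof. by rewrite !sameE => /eqP->. Qed.

Lemma same_block B x y : B \in P -> x \in B -> same P x y = (y \in B).
Proof. by move=> PB Bx; rewrite /same (def_pblock trivP PB Bx). Qed.

Lemma pblock_in x : pblock P x \in P. Proof. by rewrite pblock_mem. Qed.

Lemma block_repr B : B \in P -> exists2 x, x \in B & B = pblock P x.
Proof.
move=> PB; have /set0Pn[x Bx] : B != set0.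
  by case/and3P: partP => _ _; apply: contraNneq => <-.
by exists x; rewrite // (def_pblock trivP PB Bx).
Qed.

(** F is a system of representatives of the blocks. *)
Lemma card_blocks (F : {set T}) :
  (forall x, exists2 y, y \in F & same P y x) ->
  {in F &, forall y z, same P y z -> y = z} -> #|P| = #|F|.
Proof.
move=> Fcov Finj; rewrite -(card_in_imset (f := pblock P)) => [|y z Fy Fz /eqP].
  apply: eq_card => B; apply/idP/imsetP => [/block_repr[x _ ->] | [y _ ->]].
    by have [y Fy] := Fcov x; rewrite sameE => /eqP; exists y.
  exact: pblock_in.
by rewrite -sameE => /Finj->.
Qed.

Lemma partition_imset (g : {perm T}) :
  partition [set g @: (B : {set T}) | B in P] setT.
Proof.
have <- : g @: [set: T] = [set: T].
  by apply/setP => x; rewrite inE -(permKV g x) imset_f.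
by rewrite imset_partition //; apply: perm_inj.
Qed.

Lemma same_imset (g : {perm T}) x y :
  same [set g @: (B : {set T}) | B in P] (g x) (g y) = same P x y.
Proof.
have gx : g x \in g @: pblock P x by rewrite imset_f // mem_pblock.
have gB : g @: pblock P x \in [set g @: (B : {set T}) | B in P].
  by apply: imset_f; apply: pblock_in.
rewrite /same (def_pblock _ gB gx) ?(mem_imset _ _ (@perm_inj _ g)) //.
exact: partition_trivIset (partition_imset g).
Qed.

End OnePartition.

Lemma eq_partition P Q : partition P setT -> partition Q setT ->
  same P =2 same Q -> P = Q.
Proof.
move=> partP partQ PQ.
have pb x : pblock P x = pblock Q x by apply/setP => y; apply: PQ.
apply/setP => B; apply/idP/idP => [/(block_repr partP)[x _ ->] |
  /(block_repr partQ)[x _ ->]].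
  by rewrite pb pblock_in.
by rewrite -pb pblock_in.
Qed.

Lemma partition_of_rel (r : rel T) : equivalence_rel r ->
  exists2 P, partition P setT & same P =2 r.
Proof.
move=> rP; have rP' : {in [set: T] & &, equivalence_rel r} by move=> x y z _ _ _;
  apply: rP.
exists (equivalence_partition r setT); first exact: equivalence_partitionP.
by move=> x y; rewrite /same pblock_equivalence_partition ?inE.
Qed.

End SameBlock.

Lemma noncrossing_same n (P : {set {set 'I_n}}) : partition P setT ->
  noncrossing P <-> (forall a b c d : 'I_n, (a < b)%N -> (b < c)%N -> (c < d)%N ->
     same P a c -> same P b d -> same P a b).
Proof.
move=> partP; split=> [/noncrossingP nc a b c d ab bc cd Pac Pbd | nc].
  rewrite sameE //; apply: contraT => neq.
  have aP := pblock_in partP a; have bP := pblock_in partP b.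
  have := nc _ _ a b c d aP bP neq; rewrite ab bc cd; apply=> //.
    exact: same_refl.
  exact: same_refl.
apply/noncrossingP => B B' a b c d PB PB' neq aB bB' cB dB'.
apply: contra neq => /and3P[ab bc cd].
have := nc a b c d ab bc cd; rewrite (same_block partP c PB aB)
  (same_block partP d PB' bB').
rewrite sameE // => /(_ cB dB').
by rewrite (def_pblock _ PB aB) ?(def_pblock _ PB' bB') //; case/and3P: partP.
Qed.

(** * Non-crossing partitions of a line as ballot words *)
Section LinearArches.
Variable N : nat.
Implicit Types (P : {set {set 'I_N.+1}}) (x y z : int) (w : seq (bool * bool)).

Definition inside x := 0 <= x <= N%:Z.

(** The letter k belongs to the edge from k to k + 1: it records whether k + 1 is
first and whether k is last in its block. Vertex 0 is always first and vertex N
always last, so that these need no letter. *)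
Definition word_first w x := inside x && ((x == 0) || (nth (false, false) w `|x - 1|).1).
Definition word_last w x := inside x && ((x == N%:Z) || (nth (false, false) w `|x|).2).

Definition word_height w k : int := 1 + (ups (take k w))%:Z - (downs (take k w))%:Z.
(** On the right of the line the level stays at its final value. That this value is
0 is a property of the words that come from partitions. *)
Definition word_level w x :=
  if x < 0 then 0 else if x <= N%:Z then word_height w `|x| else word_height w N - 1.

Lemma word_heights w : size w = N -> heights (word_first w) (word_last w) (word_level w).
Proof.
move=> sw x; rewrite /word_first /word_last /word_level /inside.
have [x_lt | x_ge] := ltP x (-1).
  have -> : (x + 1 < 0) = true by lia.
  have -> : (x < 0) = true by lia.
  have -> : (0 <= x <= N%:Z) = false by lia.
  by have -> : (0 <= x + 1 <= N%:Z) = false by lia.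
have [-> | x_neq] := eqVneq x (-1).
  by rewrite addNr /= /word_height take0 /=.
have x_ge0 : 0 <= x by lia.
have [k def_x] : {k : nat | x = k%:Z} by exists `|x|%N; lia.
rewrite def_x; have -> : k%:Z + 1 = k.+1%:Z by lia.
have -> : k.+1%:Z - 1 = k%:Z by lia.
have -> : (k.+1%:Z < 0) = false by lia.
have -> : (k%:Z < 0) = false by lia.
rewrite !absz_nat; have [kN | Nk] := ltnP k N.
  have -> : (k.+1%:Z <= N%:Z) = true by lia.
  have -> : (k%:Z <= N%:Z) = true by lia.
  have -> : (k.+1%:Z == 0) = false by lia.
  have -> : (k%:Z == N%:Z) = false by lia.
  rewrite /word_height (take_nth (false, false)) ?sw // ups_rcons downs_rcons.
  by case: (nth _ w k) => -[] [] /=; lia.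
have -> : (k.+1%:Z <= N%:Z) = false by lia.
have [-> | kN] := eqVneq k N; first by rewrite lexx eqxx /=; lia.
have -> : (k%:Z <= N%:Z) = false by lia.
by rewrite !andbF /=; lia.
Qed.

(** Putting all integers outside the line into one block makes the theory of
non-crossing equivalences on the integers applicable. *)
Definition linear_ext P x y : Prop :=
  if inside x && inside y then same P (inord `|x|) (inord `|y|)
  else ~~ inside x && ~~ inside y.

Definition first_in P (i : 'I_N.+1) := [forall j : 'I_N.+1, (j < i)%N ==> ~~ same P j i].
Definition last_in P (i : 'I_N.+1) := [forall j : 'I_N.+1, (i < j)%N ==> ~~ same P i j].

Definition word_of P : N.-tuple (bool * bool) :=
  [tuple (first_in P (inord k.+1), last_in P (inord k)) | k < N].

Lemma nth_word_of P k : (k < N)%N ->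
  nth (false, false) (word_of P) k = (first_in P (inord k.+1), last_in P (inord k)).
Proof.
by move=> ltk; rewrite -[k]/(val (Ordinal ltk)) -tnth_nth tnth_mktuple.
Qed.

Lemma linear_ext_ord P (i j : 'I_N.+1) : linear_ext P i%:Z j%:Z <-> same P i j.
Proof.
have ins (k : 'I_N.+1) : inside k%:Z by rewrite /inside; have := ltn_ord k; lia.
by rewrite /linear_ext !ins /= !inord_val.
Qed.

Lemma inside_ord x : inside x -> exists i : 'I_N.+1, x = i%:Z.
Proof.
by move=> ix; exists (inord `|x|); rewrite inordK; move: ix; rewrite /inside; lia.
Qed.

Lemma outsideE P x y : ~~ inside x -> linear_ext P x y <-> ~~ inside y.
Proof. by rewrite /linear_ext; case: (inside x). Qed.

Lemma linear_ext_inside P x y : inside x -> linear_ext P x y -> inside y.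
Proof. by rewrite /linear_ext => ->; case: (inside y). Qed.

Section OnePartition.
Variable P : {set {set 'I_N.+1}}.
Hypotheses (partP : partition P setT) (ncP : noncrossing P).

Lemma linear_ext_nce : noncrossing_equiv (linear_ext P).
Proof.
have sym x y : linear_ext P x y -> linear_ext P y x.
  by rewrite /linear_ext; case: (inside x); case: (inside y) => //=; rewrite same_sym.
have trans y x z : linear_ext P x y -> linear_ext P y z -> linear_ext P x z.
  rewrite /linear_ext; case: (inside x); case: (inside y); case: (inside z) => //=.
  exact: same_trans.
split=> // [x|a b c d ab bc cd Pac Pbd].
  by rewrite /linear_ext; case: (inside x) => //=; exact: same_refl.
have [ia | oa] := boolP (inside a); have [ib | ob] := boolP (inside b).
- have ic := linear_ext_inside ia Pac; have id := linear_ext_inside ib Pbd.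
  have [i ai] := inside_ord ia; have [j bj] := inside_ord ib.
  have [k ck] := inside_ord ic; have [l dl] := inside_ord id; subst a b c d.
  move: Pac Pbd; rewrite !linear_ext_ord.
  by apply: ((noncrossing_same partP).1 ncP) => //; lia.
- have ic := linear_ext_inside ia Pac.
  by move: ia ic ob; rewrite /inside; lia.
- have id := linear_ext_inside ib Pbd.
  have := (outsideE P c oa).1 Pac; move: ib id; rewrite /inside; lia.
by apply/outsideE.
Qed.

Lemma word_firstP x : word_first (word_of P) x <-> is_first (linear_ext P) x.
Proof.
rewrite /word_first; have [ix | ox] := boolP (inside x) => /=; last first.
  split=> // h; exfalso; have [x0|x0] := ltP x 0.
    by apply: (h (x - 1)); [lia | apply/outsideE; move: ox; rewrite /inside; lia].
  by apply: (h (-1)); [lia | apply: (nce_sym linear_ext_nce); apply/outsideE => //;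
    rewrite /inside; lia].
have [i def_x] := inside_ord ix; rewrite {x}def_x in ix *.
have -> : (i%:Z == 0) || (nth (false, false) (word_of P) `|i%:Z - 1|).1 = first_in P i.
  have [i0|i0] := eqVneq (i : nat) 0%N.
    rewrite i0 eqxx; apply/esym/forallP => j; apply/implyP; lia.
  have -> : (i%:Z == 0) = false by lia.
  have -> : `|i%:Z - 1|%N = i.-1 by lia.
  rewrite nth_word_of ?prednK ?inord_val //; have := ltn_ord i; lia.
split=> [/forallP h z zi Pzi | h].
  have iz := linear_ext_inside ix (nce_sym linear_ext_nce Pzi).
  have [j def_z] := inside_ord iz; subst z; move: Pzi; rewrite linear_ext_ord => Pji.
  by have := h j; rewrite Pji implybF; lia.
apply/forallP => j; apply/implyP => lt_ji; apply/negP => Pji.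
by apply: (h j%:Z); [lia | apply/linear_ext_ord].
Qed.

Lemma word_lastP x : word_last (word_of P) x <-> is_last (linear_ext P) x.
Proof.
rewrite /word_last; have [ix | ox] := boolP (inside x) => /=; last first.
  split=> // h; exfalso; have [x0|x0] := ltP x 0.
    by apply: (h (N.+1)%:Z); [lia | apply/outsideE => //; rewrite /inside; lia].
  by apply: (h (x + 1)); [lia | apply/outsideE => //; move: ox; rewrite /inside; lia].
have [i def_x] := inside_ord ix; rewrite {x}def_x in ix *.
have lt_iN := ltn_ord i.
have -> : (i%:Z == N%:Z) || (nth (false, false) (word_of P) `|i%:Z|).2 = last_in P i.
  have [iN|iN] := eqVneq (i : nat) N.
    by rewrite iN eqxx; apply/esym/forallP => j; apply/implyP; have := ltn_ord j; lia.
  have -> : (i%:Z == N%:Z) = false by lia.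
  by rewrite absz_nat nth_word_of ?inord_val //; lia.
split=> [/forallP h z zi Pzi | h].
  have iz := linear_ext_inside ix Pzi.
  have [j def_z] := inside_ord iz; subst z; move: Pzi; rewrite linear_ext_ord => Pji.
  by have := h j; rewrite Pji implybF; lia.
apply/forallP => j; apply/implyP => lt_ji; apply/negP => Pji.
by apply: (h j%:Z); [lia | apply/linear_ext_ord].
Qed.

Lemma linear_ext_arch x y : linear_ext P x y <->
  arch (word_last (word_of P)) (word_level (word_of P)) x y.
Proof.
apply: (arch_equiv linear_ext_nce word_firstP word_lastP).
by apply: word_heights; rewrite size_tuple.
Qed.

(** The points -1 and N + 1 are related, hence the level does not fall below 0 between
them; it is not 0 on the line, whose points are unrelated to -1. *)
Lemma word_of_ballot : ballot (word_of P) /\ ups (word_of P) = downs (word_of P).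
Proof.
have : linear_ext P (-1) N.+1%:Z by apply/outsideE; rewrite /inside; lia.
move/linear_ext_arch => [D0 Dge].
have lN : word_level (word_of P) N.+1%:Z = word_height (word_of P) N - 1.
  by rewrite /word_level; have -> : (N.+1%:Z <= N%:Z) = false by lia.
have l1 : word_level (word_of P) (-1) = 0 by [].
rewrite lN l1 in D0; rewrite l1 in Dge; split; last first.
  by move: D0; rewrite /word_height take_oversize ?size_tuple //; lia.
apply/ballotP => k; rewrite size_tuple => le_kN.
have lk : word_level (word_of P) k%:Z = word_height (word_of P) k.
  by rewrite /word_level; have -> : (k%:Z <= N%:Z) by lia.
have := Dge k%:Z ltac:(lia); rewrite lk => h0.
suff : word_height (word_of P) k != 0 by move: h0; rewrite /word_height; lia.
apply/eqP => hk0.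
have : linear_ext P (-1) k%:Z.
  apply/linear_ext_arch; split; first by rewrite lk hk0.
  by move=> i hi; apply: Dge; lia.
by move/(outsideE P _ _).1 => /(_ ltac:(by rewrite /inside; lia)); rewrite /inside; lia.
Qed.

Lemma card_firsts : #|P| = #|[set i | first_in P i]|.
Proof.
apply: (card_blocks partP) => [i | i j]; last first.
  rewrite !inE => /forallP fi /forallP fj Pij; apply/eqP; rewrite -val_eqE /=.
  have := fi j; have := fj i; rewrite Pij same_sym // Pij !implybF; lia.
have [j Pji j_min] := @arg_minnP _ i (fun j => same P j i) (fun j => j : nat)
  (same_refl partP i).
exists j => //; rewrite inE; apply/forallP => l; apply/implyP => lt_lj; apply/negP => Plj.
by have := j_min l (same_trans partP Plj Pji); lia.
Qed.

Lemma card_word_of : #|P| = (ups (word_of P)).+1.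
Proof.
rewrite card_firsts; move: (word_of P) (@nth_word_of P) => w nth_w.
rewrite -sum1_card big_mkcond big_ord_recl /= inE.
have -> : first_in P ord0 by apply/forallP => j; apply/implyP; rewrite ltn0.
rewrite add1n; congr _.+1; rewrite /ups -sum1_count (big_nth (false, false)) size_tuple.
rewrite big_mkord [RHS]big_mkcond; apply: eq_bigr => k _; rewrite inE nth_w //=.
by rewrite (_ : inord _ = lift ord0 k) //; apply: val_inj; rewrite /= inordK ?ltnS.
Qed.

End OnePartition.

Lemma word_of_inj P Q : partition P setT -> noncrossing P ->
  partition Q setT -> noncrossing Q -> word_of P = word_of Q -> P = Q.
Proof.
have sub P' Q' (pP : partition P' setT) (nP : noncrossing P') (pQ : partition Q' setT)
    (nQ : noncrossing Q') (i j : 'I_N.+1) : word_of P' = word_of Q' -> same P' i j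
      -> same Q' i j.
  move=> eqw /linear_ext_ord/(linear_ext_arch pP nP).
  by rewrite eqw => /(linear_ext_arch pQ nQ)/linear_ext_ord.
move=> partP ncP partQ ncQ eqw; apply: eq_partition => // i j.
by apply/idP/idP; apply: sub.
Qed.

(** The ballot condition keeps the level positive on the line, so that no point of
the line is related to a point outside. *)
Lemma word_of_surj (w : N.-tuple (bool * bool)) : ballot w -> ups w = downs w ->
  exists P, [/\ partition P setT, noncrossing P & word_of P = w].
Proof.
move=> /ballotP bw ud; have sw := size_tuple w.
have DP := word_heights sw; set L := word_first w in DP; set R := word_last w in DP.
set D := word_level w in DP; have eP := arch_noncrossing_equiv R D.
pose r (i j : 'I_N.+1) := `[< arch R D i%:Z j%:Z >].
have rP : equivalence_rel r.
  move=> i j k; split; first by apply/asboolP; apply: (nce_refl eP).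
  move=> /asboolP ij; apply/asboolP/asboolP => h; last exact: nce_trans eP _ _ _ ij h.
  exact: nce_trans eP _ _ _ (nce_sym eP ij) h.
have [P partP Pr] := partition_of_rel rP.
have sameP (i j : 'I_N.+1) : same P i j <-> arch R D i%:Z j%:Z.
  by rewrite Pr; split=> [/asboolP|?]; [|apply/asboolP].
have D_in (i : 'I_N.+1) : 1 <= D i%:Z.
  have lt_i := ltn_ord i.
  rewrite /D /word_level /=; have -> : (i%:Z <= N%:Z) by lia.
  by rewrite /word_height /=; have := bw i; rewrite sw => /(_ ltac:(lia)); lia.
have D_out x : ~~ inside x -> D x = 0.
  rewrite /inside /D /word_level; have [//|x0 xN] := ltP x 0.
  have -> : (x <= N%:Z) = false by lia.
  by rewrite /word_height take_oversize ?sw // ud; lia.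
have arch_in x (i : 'I_N.+1) : arch R D x i%:Z -> inside x.
  by move=> [Dxi _]; apply: contraT => /D_out; have := D_in i; lia.
have ncP : noncrossing P.
  apply/noncrossing_same => // a b c d ab bc cd /sameP ac /sameP bd; apply/sameP.
  by apply: (nce_nc eP) ac bd; lia.
exists P; split=> //; apply: eq_from_tnth => k; have lt_k := ltn_ord k.
rewrite !(tnth_nth (false, false)) nth_word_of // [RHS]surjective_pairing.
have inK m : (m <= N)%N -> (inord m : 'I_N.+1)%:Z = m%:Z by move=> le_m; rewrite inordK.
congr pair; apply/idP/idP.
- move=> /forallP h; have : L k.+1%:Z; last first.
    by rewrite /L /word_first; have -> : `|k.+1%:Z - 1|%N = k; [lia | case: inside].
  apply: contraT => nL; have [||x [xi xarc]] := arch_not_first DP (x0 := -1) nL;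
    first by lia.
    by rewrite -(inK k.+1) // [D (-1)]D_out //; have := D_in (inord k.+1); lia.
  rewrite -(inK k.+1) // in xi xarc; have [j def_x] := inside_ord (arch_in _ _ xarc).
  rewrite def_x in xi xarc; have := h j; rewrite (sameP _ _).2 // implybF; lia.
- move=> wk; apply/forallP => j; apply/implyP; rewrite inordK // => lt_j.
  apply/negP => /sameP; rewrite inK //; apply: (arch_first DP); last by lia.
  rewrite -/L /L /word_first; have -> : `|k.+1%:Z - 1|%N = k by lia.
  by rewrite wk orbT andbT /inside; lia.
- move=> /forallP h; have : R k%:Z; last first.
    rewrite /R /word_last absz_nat; have -> : (k%:Z == N%:Z) = false by lia.
    by case: inside.
  apply: contraT => nR; have [||x [xi xarc]] := arch_not_last DP (x0 := N.+1%:Z) nR;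
    first by lia.
    rewrite -(inK k) ?[D N.+1%:Z]D_out //; [|rewrite /inside; lia|lia].
    by have := D_in (inord k); lia.
  rewrite -(inK k) // in xi xarc; last by lia.
  have [j def_x] := inside_ord (arch_in _ _ (nce_sym eP xarc)).
  rewrite def_x in xi xarc; have := h j; rewrite (sameP _ _).2 // implybF; lia.
move=> wk; have le_kN : (k <= N)%N by lia.
apply/forallP => j; apply/implyP; rewrite inordK // => lt_j.
apply/negP => /sameP; rewrite inK //; apply: (arch_last (R := R)); last by lia.
rewrite /R /word_last absz_nat wk orbT andbT /inside; lia.
Qed.

End LinearArches.

(** * Counting all partitions and those fixed by a reflection *)
Lemma ncpP n m (P : {set {set 'I_n}}) :
  reflect [/\ partition P setT, noncrossing P & #|P| = m] (P \in ncp n m).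
Proof.
rewrite inE; apply: (iffP and3P) => -[partP ncP]; first by move/eqP.
by move=> cardP; split=> //; apply/eqP.
Qed.

Section LinearCounts.
Variable N : nat.

Lemma card_word_of_ncp b (A : pred (N.-tuple (bool * bool))) :
  #|[set P in ncp N.+1 b.+1 | A (word_of P)]| =
  #|[set w : N.-tuple (bool * bool) | [&& ballot w, ups w == b, downs w == b & A w]]|.
Proof.
rewrite -(card_in_imset (f := @word_of N)) => [|P Q].
  apply: eq_card => w; rewrite inE; apply/imsetP/and4P => [[P]|[bw /eqP uw /eqP dw Aw]].
    rewrite inE => /andP[/ncpP[partP ncP cardP] AP] ->.
    have [bP <-] := word_of_ballot partP ncP.
    by move: cardP; rewrite card_word_of // => -[->].
  have [|P [partP ncP eqw]] := word_of_surj bw; first by rewrite uw dw.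
  exists P => //; rewrite inE eqw Aw andbT; apply/ncpP; split=> //.
  by rewrite card_word_of // eqw uw.
rewrite inE => /andP[/ncpP[pP nP _] _]; rewrite inE => /andP[/ncpP[pQ nQ _] _].
exact: word_of_inj.
Qed.

Theorem card_ncp b : #|ncp N.+1 b.+1| = ballot_number N b b.
Proof.
have <- : [set P in ncp N.+1 b.+1 | xpredT (word_of P)] = ncp N.+1 b.+1.
  by apply/setP => P; rewrite inE andbT.
rewrite (card_word_of_ncp b predT) /ballot_number -sum1_card big_mkcond.
by apply: eq_bigr => w _; rewrite inE andbT -andbA; case: (_ && _).
Qed.

(** This reflection reverses the linear order of the vertices, hence acts on words by
[mirror]. *)
Definition rev_perm : 'S_N.+1 := perm (@rev_ord_inj N.+1).

Lemma rev_permE (i : 'I_N.+1) : rev_perm i = (N - i)%N :> nat.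
Proof. by rewrite permE /= subSS. Qed.

Lemma rev_permM : (rev_perm * rot_perm N.+1 = refl_perm N.+1)%g.
Proof.
apply/permP => i; apply: val_inj; rewrite permM !permE /= subSS.
by rewrite subSn // -ltnS.
Qed.

Lemma rev_perm_in : rev_perm \in I2 N.+1.
Proof. by rewrite -(groupMr _ (rot_perm_in _)) rev_permM refl_perm_in. Qed.

Section Mirror.
Variable P : {set {set 'I_N.+1}}.
Hypothesis partP : partition P setT.
Local Notation revP := [set rev_perm @: (B : {set 'I_N.+1}) | B in P].

Let rev_permK : involutive rev_perm.
Proof. by move=> i; rewrite !permE rev_ordK. Qed.

Let revPE i j : same revP i j = same P (rev_perm i) (rev_perm j).
Proof. by rewrite -(same_imset partP rev_perm) !rev_permK. Qed.

Lemma first_in_rev i : first_in revP i = last_in P (rev_perm i).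
Proof.
apply/forallP/forallP => h j; apply/implyP.
  have := h (rev_perm j); rewrite revPE !rev_permE rev_permK same_sym // =>
    /implyP h' lt_j.
  by apply: h'; have := ltn_ord i; have := ltn_ord j; lia.
move=> lt_ji; rewrite revPE same_sym //; have := h (rev_perm j).
by rewrite !rev_permE => /implyP; apply; have := ltn_ord i; lia.
Qed.

Lemma last_in_rev i : last_in revP i = first_in P (rev_perm i).
Proof.
apply/forallP/forallP => h j; apply/implyP.
  have := h (rev_perm j); rewrite revPE !rev_permE rev_permK same_sym // =>
    /implyP h' lt_j.
  by apply: h'; have := ltn_ord i; have := ltn_ord j; lia.
move=> lt_ji; rewrite revPE same_sym //; have := h (rev_perm j).
by rewrite !rev_permE => /implyP; apply; have := ltn_ord j; lia.
Qed.

Lemma word_of_rev : word_of revP = mirror (word_of P) :> seq _.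
Proof.
have le_inord k : (k <= N)%N -> (inord k : 'I_N.+1) = k :> nat by move=> le_k;
  rewrite inordK.
apply: (@eq_from_nth _ (false, false)); rewrite ?size_mirror !size_tuple // => k lt_k.
rewrite nth_word_of // nth_mirror size_tuple // nth_word_of; last by lia.
rewrite first_in_rev last_in_rev /=.
by congr (last_in P _, first_in P _); apply: val_inj;
  rewrite [LHS]rev_permE [RHS]le_inord ?le_inord; lia.
Qed.

End Mirror.

End LinearCounts.

Theorem card_ncp_rev_fixed h b :
  #|[set P in ncp (h + h).+1 b.+1 | [set rev_perm (h + h) @: (B : {set 'I_(h + h).+1})
    | B in P] == P]| =
  ('C(h, b./2) * 'C(h, uphalf b))%N.
Proof.
rewrite -palindromic_ballot.
pose A (w : (h + h).-tuple (bool * bool)) := w == mirror w :> seq _.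
transitivity #|[set P in ncp (h + h).+1 b.+1 | A (word_of P)]|.
  apply: eq_card => P; rewrite inE [in RHS]inE.
  apply: andb_id2l => Pncp; have /ncpP[pP nP _] := Pncp.
  have Qncp : [set rev_perm (h + h) @: (B : {set _}) | B in P] \in ncp (h + h).+1 b.+1.
    by have := acts_act (ncp_acts (h + h).+1 b.+1) (rev_perm_in _) P; rewrite Pncp.
  have /ncpP[pQ nQ _] := Qncp.
  rewrite /A -(word_of_rev pP); apply/eqP/eqP => [-> //|/val_inj e].
  by apply: word_of_inj => //.
rewrite (card_word_of_ncp b A); apply: eq_card => w; rewrite !inE.
rewrite /A; case: (ballot w); case: (ups w =P b) => //= uw.
by apply: andb_idl => /eqP ew; rewrite ew downs_mirror uw.
Qed.

(** * Unrolling a cyclic equivalence *)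
Section CyclicEquivalences.
Implicit Types a b c i j k w x y z : int.

Definition periodic_rel (m : int) (r : int -> int -> Prop) :=
  forall a b, r (a + m) (b + m) <-> r a b.

Lemma periodic_relM m r k a b :
  periodic_rel m r -> r (a + k * m) (b + k * m) <-> r a b.
Proof.
move=> rP; have pos (p : nat) x y : r (x + p%:Z * m) (y + p%:Z * m) <-> r x y.
  elim: p => [|p IH]; first by rewrite mul0r !addr0.
  have e z : z + p.+1%:Z * m = z + p%:Z * m + m by lia.
  by rewrite !e; split=> [/rP/IH|h]; last by apply/rP/IH.
case: k => p; first exact: pos.
have e z : z = z + Negz p * m + p.+1%:Z * m by lia.
by rewrite [in X in _ <-> X](e a) [in X in _ <-> X](e b); split=> /pos.
Qed.

Lemma int_mod_interval a m y : 0 < m -> exists k, a <= y + k * m < a + m.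
Proof.
move=> m_gt0; exists (- ((y - a) %/ m)%Z).
have := divz_eq (y - a) m; have := modz_ge0 (y - a) (lt0r_neq0 m_gt0).
have := ltz_pmod (y - a) m_gt0; move: (_ %% _)%Z (_ %/ _)%Z => r q; lia.
Qed.

Lemma mul_far (n k : int) : 0 < n -> k != 0 -> n <= `|k * n|.
Proof. by move=> n_gt0 k0; rewrite normrM (gtr0_norm n_gt0) ler_peMl //; lia. Qed.

(** A non-crossing equivalence on the vertices of an n-gon that is stable under the
rotation by m, seen as a relation between integers modulo n. *)
Record cyclic_equiv (n m : int) (s : int -> int -> Prop) : Prop := CyclicEquiv {
  ce_refl : forall a, s a a;
  ce_sym : forall a b, s a b -> s b a;
  ce_trans : forall b a c, s a b -> s b c -> s a c;
  ce_turn : forall a, s a (a + n);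
  ce_shift : periodic_rel m s;
  ce_nc : forall a b c d : int, a < b -> b < c -> c < d -> d < a + n ->
    s a c -> s b d -> s a b }.

Lemma central_iter (m : int) (r : int -> int -> Prop) x k :
  (forall a, r a a) -> (forall a b, r a b -> r b a) ->
  (forall b a c, r a b -> r b c -> r a c) -> periodic_rel m r ->
  r x (x + m) -> r x (x + k * m).
Proof.
move=> refl sym trans rP cx.
have pos (p : nat) y : r y (y + m) -> r y (y + p%:Z * m).
  move=> cy; elim: p => [|p IH]; first by rewrite mul0r addr0.
  apply: trans (IH) _; have -> : y + p.+1%:Z * m = y + m + p%:Z * m by lia.
  exact/periodic_relM.
case: k => p; first exact: pos.
have e : x = x + Negz p * m + p.+1%:Z * m by lia.
apply: sym; rewrite {2}e; apply: pos.
have -> : x + Negz p * m + m = x + m + Negz p * m by lia.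
exact/periodic_relM.
Qed.

Section Unroll.
Variables (n m : int).
Hypotheses (m_gt0 : 0 < m) (n_ge : 3 * m <= n).

(** Read on the integers, a block of the n-gon becomes the union of its translates by
n, which cross other blocks. The cure is to relate points only when they are close,
except inside a block that contains x and x + m: this central block is kept whole. *)
Definition unroll (s : int -> int -> Prop) x y := s x y /\ (`|x - y| < m \/ s x (x + m)).

Section FromCyclic.
Variable s : int -> int -> Prop.
Hypothesis sP : cyclic_equiv n m s.
Let refl := ce_refl sP.
Let sym := ce_sym sP.
Let trans := ce_trans sP.
Let nc := ce_nc sP.
Let shift := ce_shift sP.
Let iter x k := @central_iter m s x k refl sym trans shift.

Lemma central_shift x z : s x (x + m) -> s x z -> s z (z + m).
Proof. by move=> cx xz; apply: trans (trans (sym xz) cx) ((shift _ _).2 xz). Qed.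

(** Otherwise the step from x to y would cross its image under the shift by m. *)
Lemma central_far x y : s x y -> m <= y - x -> y - x <= n - m -> s x (x + m).
Proof.
move=> xy le_m le_n; have xy' := (shift _ _).2 xy.
have [-> //|y_neq] := eqVneq (x + m) y.
have [e|y_neq'] := eqVneq (y + m) (x + n).
  by rewrite e in xy'; apply: trans (ce_turn sP x) (sym xy').
by apply: (nc (c := y) (d := y + m)) => //; lia.
Qed.

(** A translate of y by a multiple of m lies between x and x + m, and its own step by m
crosses that of x. *)
Lemma central_unique x y : s x (x + m) -> s y (y + m) -> s x y.
Proof.
move=> cx cy; have [k yk] := @int_mod_interval x m y m_gt0.
set y' := y + k * m in yk; have yy' : s y y' := iter k cy.
apply: trans (sym yy'); have [-> //|y'_neq] := eqVneq x y'.
have cy' := central_shift cy yy'.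
by apply: (nc (c := x + m) (d := y' + m)) => //; lia.
Qed.

(** Points of a block that is not central are at distance less than m or more than
n - m; as 3 m <= n, two short steps never add up to the second case, which gives
transitivity. If one of two crossing blocks is central, translating its elements by
multiples of m brings all four points into one turn. *)
Lemma unroll_nce : noncrossing_equiv (unroll s).
Proof.
split=> [a|a b [ab h]|b a c [ab hab] [bc hbc]|a b c d ab bc cd [ac hac] [bd hbd]].
- by split=> //; left; lia.
- split; first exact: sym.
  by case: h => [h|h]; [left; lia | right; apply: central_shift ab].
- have ac := trans ab bc; split=> //.
  case: hab => [hab|]; last by right.
  case: hbc => [hbc|cb]; last by right; apply: central_shift (sym ab).
  have [lt_m | ge_m] := ltP `|a - c| m; [by left | right].
  have [le_ac | lt_ca] := leP a c; first by apply: central_far ac _ _; lia.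
  by apply: central_shift (sym ac); apply: central_far (sym ac) _ _; lia.
have [ca|nca] := pselect (s a (a + m)); have [cb|ncb] := pselect (s b (b + m)).
- by split; [apply: central_unique | right].
- exfalso; apply: ncb; case: hbd => // lt_bd.
  have [k ak] := @int_mod_interval (b - m) m a m_gt0.
  have aa' := iter k ca; apply: central_shift (ca) (trans aa' _).
  by apply: (nc (c := c) (d := d)) => //; try lia; apply: trans (sym aa') ac.
- exfalso; apply: nca; case: hac => // lt_ac.
  have [k dk] := @int_mod_interval (c + 1) m d m_gt0.
  have dd' := iter k (central_shift cb bd).
  apply: central_shift (cb) (sym _).
  by apply: (nc (c := c) (d := d + k * m)) => //; try lia; apply: trans bd dd'.
case: hac => // lt_ac; case: hbd => // lt_bd; split; last by left; lia.
by apply: (nc (c := c) (d := d)) => //; lia.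
Qed.

Lemma unroll_shift : periodic_rel m (unroll s).
Proof.
move=> a b; rewrite /unroll; have -> : a + m - (b + m) = a - b by lia.
by split=> -[/shift ab [h|/shift h]]; split=> //; [left|right|left|right].
Qed.

Lemma unroll_central x : unroll s x (x + m) <-> s x (x + m).
Proof. by split=> [[]//|h]; split=> //; right. Qed.

Lemma unroll_cover x y : s x y -> exists k, unroll s x (y + k * n).
Proof.
move=> xy; have [|k yk] := @int_mod_interval x n y; first by lia.
have turn z : s z (z + n) := ce_turn sP z.
have sturn : periodic_rel n s.
  move=> a b; split=> ab; first exact: trans (trans (turn a) ab) (sym (turn b)).
  exact: trans (trans (sym (turn a)) ab) (turn b).
have iturn l z : s z (z + l * n) by apply: central_iter.
set y' := y + k * n in yk; have xy' : s x y' := trans xy (iturn k y).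
have [far | near] := leP (y' - x) (n - m).
  exists k; split=> //; have [lt_m|ge_m] := ltP `|x - y'| m; [by left | right].
  by apply: central_far xy' _ _; lia.
exists (k - 1); have e : y + (k - 1) * n = y' - n by rewrite /y'; lia.
rewrite e; split; last by left; lia.
by apply: trans xy' (sym _); have := turn (y' - n); rewrite subrK.
Qed.

Lemma unroll_first i : is_first (unroll s) i <-> forall z, i - m <= z < i -> ~ s z i.
Proof.
split=> [h z hz zi | h z lt_zi [zi hzi]].
  have [lt_m|ge_m] := ltP `|z - i| m; first by apply: (h z); [lia | split=> //; left].
  have e : z + m = i by lia.
  by apply: (h z); [lia | split=> //; right; rewrite e].
have [lt_m|ge_m] := ltP `|z - i| m; first by apply: (h z) => //; lia.
case: hzi => [|cz]; first by lia.
apply: (h (i - m)); first by lia.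
apply/shift; rewrite subrK; apply: central_shift cz zi.
Qed.

End FromCyclic.

Definition roll_up (e : int -> int -> Prop) x y := exists k, e x (y + k * n).

Section FromPeriodic.
Variables (e : int -> int -> Prop) (d : int).
Hypotheses (eP : noncrossing_equiv e) (shift : periodic_rel m e) (n_dm : n = d * m).
Let refl := nce_refl eP.
Let sym := nce_sym eP.
Let trans := nce_trans eP.
Let nc := nce_nc eP.
Let iter x k := @central_iter m e x k refl sym trans shift.

Let n_gt0 : 0 < n. Proof. lia. Qed.

Let turn a b k : e (a + k * n) (b + k * n) <-> e a b.
Proof. by rewrite n_dm mulrA; apply: periodic_relM. Qed.

(** In a non-crossing relation of period m, a step of length at least m crosses its own
translate by m. *)
Lemma central_of_long x y : e x y -> m <= `|x - y| -> e x (x + m) /\ e y (y + m).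
Proof.
have main a b : e a b -> m <= b - a -> e a (a + m).
  move=> ab le_m; have ab' := (shift _ _).2 ab.
  have [-> //|neq] := eqVneq (a + m) b.
  by apply: (nc (c := b) (d := b + m)) => //; lia.
have tr a b : e a b -> e a (a + m) -> e b (b + m).
  by move=> ab ca; apply: trans (trans (sym ab) ca) ((shift _ _).2 ab).
move=> xy le_m; have [le_xy | lt_yx] := leP x y.
  by have cx := main _ _ xy ltac:(lia); split=> //; apply: tr xy cx.
by have cy := main _ _ (sym xy) ltac:(lia); split=> //; apply: tr (sym xy) cy.
Qed.

Let central_turn y k : e y (y + m) -> e y (y + k * n).
Proof. by move=> cy; rewrite n_dm mulrA; apply: iter. Qed.

Lemma roll_up_near x y : roll_up e x y -> x < y < x + n -> e x y \/ e x (y - n).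
Proof.
move=> [k xy] hxy; have [far | near] := leP m `|x - (y + k * n)|.
  have [_ cy] := central_of_long xy far; left; apply: trans (xy) (sym _).
  have cy' : e y (y + m).
    by apply/(turn _ _ k); have -> : y + m + k * n = y + k * n + m by lia.
  exact: central_turn.
have [k0|k0] : k = 0 \/ k = -1 by move: near hxy; nia.
  by left; move: xy; rewrite k0 mul0r addr0.
by right; move: xy; rewrite k0 mulN1r.
Qed.

(** Within one turn, a relation modulo n comes either from the same turn or from the
previous one ([roll_up_near]); in each case the crossing is already present on the
integers. *)
Lemma roll_up_cyclic : cyclic_equiv n m (roll_up e).
Proof.
have wsym a b : roll_up e a b -> roll_up e b a.
  move=> [k ab]; exists (- k); apply: sym; apply/(turn _ _ k).
  by have -> : a + - k * n + k * n = a by lia.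
split=> // [a|b a c [k ab] [l bc]|a|a b|a b c f ab bc cf fa wac wbf].
- by exists 0; rewrite mul0r addr0.
- exists (k + l); apply: trans ab _; have -> : c + (k + l) * n = c + l * n + k * n by lia.
  exact/turn.
- by exists (-1); rewrite mulN1r addrK.
- split=> -[k h]; exists k.
    by apply/shift; have -> : b + k * n + m = b + m + k * n by lia.
  have -> : b + m + k * n = b + k * n + m by lia.
  exact: (shift _ _).2 h.
have [ac|ac] := roll_up_near wac ltac:(lia); have [bf|bf] := roll_up_near wbf ltac:(lia).
- by exists 0; rewrite mul0r addr0; apply: (nc (c := c) (d := f)).
- exists 0; rewrite mul0r addr0; apply: trans (sym _) (sym bf).
  by apply: (nc (c := b) (d := c)) => //; [lia | apply: sym].
- apply: wsym; exists 1; rewrite mul1r.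
  have ca : e c (a + n) by apply: sym; apply/(turn _ _ (-1)); rewrite !mulN1r addrK.
  by apply: trans (ca); apply: (nc (c := f) (d := a + n)); try lia.
exists 0; rewrite mul0r addr0; apply: trans (trans ac _) (sym bf).
by apply: (nc (c := a) (d := b)) => //; try lia; apply: sym.
Qed.

Lemma roll_up_unroll x y : unroll (roll_up e) x y <-> e x y.
Proof.
have ew a b : e a b -> roll_up e a b by move=> ab; exists 0; rewrite mul0r addr0.
have cw a : roll_up e a (a + m) -> e a (a + m).
  move=> [k ak]; apply: (central_of_long ak _).1.
  have [-> | /(mul_far n_gt0) far] := eqVneq k 0; first by rewrite mul0r; lia.
  by move: far; move: (k * n) => kn; lia.
split=> [[[k xy] h] | xy]; last first.
  split; first exact: ew.
  have [lt_m|ge_m] := ltP `|x - y| m; [by left | right].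
  by apply: ew; apply: (central_of_long xy ge_m).1.
have fin : e (y + k * n) (y + k * n + m) -> e x y.
  move=> cy; apply: trans (xy) (sym _); apply: central_turn.
  by apply/(turn _ _ k); have -> : y + m + k * n = y + k * n + m by lia.
case: h => [h | /cw cx]; last first.
  by apply: fin; apply: trans (trans (sym xy) cx) ((shift _ _).2 xy).
have [k0|k0] := eqVneq k 0; first by move: xy; rewrite k0 mul0r addr0.
apply: fin; apply: (central_of_long xy _).2.
by move: (mul_far n_gt0 k0); move: (k * n) => kn; lia.
Qed.

End FromPeriodic.
End Unroll.

End CyclicEquivalences.

(** * First and last elements modulo the period, and the cyclic argument *)
Section Residues.
Variable N : nat.
Implicit Types x y k : int.

Definition residue x : 'I_N.+1 := inord `|(x %% N.+1)%Z|.

Lemma residueP x : exists k, x = (residue x)%:Z + k * N.+1%:Z.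
Proof.
exists (x %/ N.+1)%Z; have := divz_eq x N.+1%:Z.
have := modz_ge0 x (isT : N.+1%:Z != 0); have := ltz_pmod x (isT : 0 < N.+1%:Z).
rewrite /residue => lt_n ge0 ex.
by rewrite inordK; move: lt_n ge0 ex; move: (_ %% _)%Z (_ %/ _)%Z => r q; lia.
Qed.

Lemma residue_ord (i : 'I_N.+1) : residue i%:Z = i.
Proof. by rewrite /residue modz_small /= ?inord_val //; have := ltn_ord i; lia. Qed.

Lemma residueD x k : residue (x + k * N.+1%:Z) = residue x.
Proof. by rewrite /residue addrC modzMDl. Qed.

End Residues.

Section CountingFunction.
Implicit Types (L : int -> bool) (g : int -> int) (x m : int).

Lemma int_shift_invariant g x : (forall x, g (x + 1) = g x) -> g x = g 0.
Proof.
move=> gS; case: x => p.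
  by elim: p => // p <-; rewrite -[RHS]gS; congr g; lia.
elim: p => [|p <-]; first by rewrite -[LHS]gS; congr g; lia.
by rewrite -[LHS]gS; congr g; lia.
Qed.

(** The signed number of marked points in [0, x). *)
Definition cumul L x : int :=
  match x with
  | Posz p => \sum_(i < p) (L i%:Z)%:Z
  | Negz p => - \sum_(i < p.+1) (L (Negz i))%:Z
  end.

Lemma cumulS L x : cumul L (x + 1) = cumul L x + (L x)%:Z.
Proof.
case: x => [p|[|p]].
- have -> : Posz p + 1 = Posz p.+1 by lia.
  by rewrite /= big_ord_recr.
- have -> : Negz 0 + 1 = 0 by lia.
  by rewrite /= big_ord0 big_ord1 addNr.
have -> : Negz p.+1 + 1 = Negz p by lia.
by rewrite /= [in RHS]big_ord_recr /= opprD addrNK.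
Qed.

Lemma cumul0 L : cumul L 0 = 0. Proof. by rewrite /= big_ord0. Qed.

Lemma cumul_period L m : (forall x, L (x + m) = L x) ->
  forall x, cumul L (x + m) = cumul L x + cumul L m.
Proof.
move=> Lm x; have := @int_shift_invariant (fun x => cumul L (x + m) - cumul L x) x.
rewrite cumul0 add0r subr0 => h.
have {}h : cumul L (x + m) - cumul L x = cumul L m.
  apply: h => y; have -> : y + 1 + m = y + m + 1 by lia.
  by rewrite !cumulS Lm; lia.
by lia.
Qed.

Lemma sum_Posz n (f : 'I_n -> nat) : (\sum_(i < n) f i)%N%:Z = \sum_(i < n) (f i)%:Z.
Proof. exact: (big_morph Posz PoszD (erefl _)). Qed.

Lemma cumul_residue N (A : {set 'I_N.+1}) :
  cumul (fun x => residue N x \in A) N.+1%:Z = #|A|%:Z.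
Proof.
have -> : #|A| = (\sum_(i < N.+1) (i \in A))%N.
  by rewrite -sum1_card big_mkcond; apply: eq_bigr => i _; case: (i \in A).
by rewrite sum_Posz; apply: eq_bigr => i _; rewrite residue_ord.
Qed.

Lemma int_inf g m : 0 < m -> (forall x, g (x + m) = g x) ->
  exists v, (exists x, g x = v) /\ forall x, v <= g x.
Proof.
move=> m_gt0 gm.
have gM x k : g (x + k * m) = g x.
  have : periodic_rel m (fun a b => g a = g b) by move=> a b; rewrite !gm.
  move/(@central_iter m (fun a b => g a = g b) x k) => h; apply/esym/h => //.
  by move=> b a c -> ->.
pose p := `|m|.-1%N; have def_m : m = p.+1%:Z by rewrite /p; lia.
have [i _ i_min] := @arg_minP _ _ _ (ord0 : 'I_p.+1) xpredT (fun i => g i%:Z) isT.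
exists (g i%:Z); split=> [|x]; first by exists i%:Z.
have [k ex] := residueP p x; rewrite ex -def_m gM; exact: i_min.
Qed.

End CountingFunction.

Section Gaps.
Variable N : nat.
Local Notation M := N.+1.
Implicit Types (A B : {set 'I_M}) (x y z k : int) (c j : nat).

(** The periodic set of integers that lies over A. *)
Definition marks A x := residue N x \in A.

Lemma marksD A x k : marks A (x + k * M%:Z) = marks A x.
Proof. by rewrite /marks residueD. Qed.

Lemma marks_period A x : marks A (x + M%:Z) = marks A x.
Proof. by rewrite -[in RHS](marksD A x 1) mul1r. Qed.

(** The lowest level over edges is smaller than the lowest level over vertices: the
centre of the polygon then lies between blocks and not inside one, see
[central_gap]. *)
Definition gap (L R : int -> bool) := forall x, exists k,
  cumul L (k + 1) - cumul R (k + 1) < cumul L (x + 1) - cumul R x.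

Definition gapb A B : bool := `[< gap (marks A) (marks B) >].

Definition turn_set c B := (rot_perm M ^+ c)%g @: B.

Lemma marks_turn c B x : marks (turn_set c B) x = marks B (x - c%:Z).
Proof.
rewrite /marks -{1}(permKV (rot_perm M ^+ c) (residue N x))%g.
rewrite (mem_imset _ _ (@perm_inj _ _)); congr (_ \in B).
apply: (@perm_inj _ (rot_perm M ^+ c)%g); rewrite permKV; apply: val_inj.
rewrite /= rot_permX.
have [k ex] := residueP N (x - c%:Z); set r := residue N (x - c%:Z) in ex *.
have -> : x = (r + c)%N%:Z + k * M%:Z by lia.
rewrite residueD /residue; have -> : ((r + c)%N%:Z %% M)%Z = ((r + c) %% M)%N%:Z by
  rewrite modz_nat.
by rewrite absz_nat inordK // ltn_mod.
Qed.

Lemma cumul_turn c B : exists v : int, forall x,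
  cumul (marks (turn_set c B)) x = cumul (marks B) (x - c%:Z) + v.
Proof.
set F := cumul (marks (turn_set c B)); set H := cumul (marks B).
exists (F 0 - H (0 - c%:Z)) => x.
have h y : F (y + 1) - H (y + 1 - c%:Z) = F y - H (y - c%:Z).
  have -> : y + 1 - c%:Z = y - c%:Z + 1 by lia.
  by rewrite /F /H !cumulS marks_turn; lia.
have e : F x - H (x - c%:Z) = F 0 - H (0 - c%:Z).
  exact: (@int_shift_invariant (fun x => F x - H (x - c%:Z)) x h).
by lia.
Qed.

(** Let mu c be the minimum over x of F(x+1) - H(x-c), where F and H count the marks of
A and B. After rotating B by c, the lowest level is mu c over vertices and mu (c-1)
over edges, so that there is a gap exactly when mu (c-1) < mu c. Now mu increases by
0 or 1 at each step and by #|A| in a full turn. *)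
Lemma sum_gap_turn A B : #|A| = #|B| -> (\sum_(c < M) gapb A (turn_set c B))%N = #|A|.
Proof.
move=> eqAB; set F := cumul (marks A); set H := cumul (marks B).
have FM x : F (x + M%:Z) = F x + #|A|%:Z.
  by rewrite /F cumul_period ?cumul_residue //; apply: marks_period.
have HM x : H (x + M%:Z) = H x + #|A|%:Z.
  by rewrite /H cumul_period ?cumul_residue ?eqAB //; apply: marks_period.
have inf (c : int) : exists v : int,
    (exists x, F (x + 1) - H (x - c) = v) /\ forall x, v <= F (x + 1) - H (x - c).
  apply: (@int_inf (fun x => F (x + 1) - H (x - c)) M%:Z) => // x.
  have -> : x + M%:Z + 1 = x + 1 + M%:Z by lia.
  have -> : x + M%:Z - c = x - c + M%:Z by lia.
  by rewrite FM HM; lia.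
have [mu muP] := choice inf.
have mu_step (c : int) : mu (c - 1) <= mu c <= mu (c - 1) + 1.
  have [[x ex] xmin] := muP (c - 1); have [[y ey] ymin] := muP c.
  have := xmin y; have := ymin x; rewrite -ex -ey.
  have := cumulS (marks B) (x - c); have := cumulS (marks B) (y - c); rewrite -/H.
  have -> : x - c + 1 = x - (c - 1) by lia.
  have -> : y - c + 1 = y - (c - 1) by lia.
  by case: (marks B (x - c)); case: (marks B (y - c)); lia.
have mu_M (c : int) : mu (c + M%:Z) = mu c + #|A|%:Z.
  have [[x ex] xmin] := muP (c + M%:Z); have [[y ey] ymin] := muP c.
  have HM' z : H (z - c) = H (z - (c + M%:Z)) + #|A|%:Z.
    by rewrite -HM; congr H; lia.
  have := xmin y; have := ymin x; rewrite -ex -ey !HM'; lia.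
have gapE (c : nat) : (gapb A (turn_set c B))%:Z = mu c%:Z - mu (c%:Z - 1).
  have [v ev] := cumul_turn c B.
  have [[x ex] xmin] := muP (c%:Z - 1); have [[y ey] ymin] := muP c%:Z.
  have := mu_step c%:Z.
  have [g|ng] := pselect (gap (marks A) (marks (turn_set c B))).
    rewrite /gapb asboolT //; have [k] := g y; rewrite !ev -/F -/H.
    have -> : k + 1 - c%:Z = k - (c%:Z - 1) by lia.
    by have := xmin k; lia.
  rewrite /gapb asboolF // => step; suff : ~ (mu (c%:Z - 1) < mu c%:Z) by lia.
  move=> lt_mu; apply: ng => z; exists x; rewrite !ev -/F -/H.
  have -> : x + 1 - c%:Z = x - (c%:Z - 1) by lia.
  by have := ymin z; lia.
apply/eqP; rewrite -eqz_nat sum_Posz; apply/eqP.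
have tel (p : nat) : \sum_(c < p) (gapb A (turn_set c B))%:Z = mu (p%:Z - 1) - mu (-1).
  elim: p => [|p IH]; first by rewrite big_ord0 sub0r subrr.
  rewrite big_ord_recr /= IH gapE; have -> : p.+1%:Z - 1 = p%:Z by lia.
  by lia.
have := mu_M (-1); have -> : -1 + M%:Z = M%:Z - 1 by lia.
by rewrite tel => ->; lia.
Qed.

Definition gap_pairs j : {set {set 'I_M} * {set 'I_M}} :=
  [set AB : {set 'I_M} * {set 'I_M} | [&& #|AB.1| == j, #|AB.2| == j & gapb AB.1 AB.2]].

Definition equicard_pairs j : {set {set 'I_M} * {set 'I_M}} :=
  [set AB : {set 'I_M} * {set 'I_M} | (#|AB.1| == j) && (#|AB.2| == j)].

Lemma card_equicard_pairs j : #|equicard_pairs j| = ('C(M, j) ^ 2)%N.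
Proof.
have -> : equicard_pairs j =
    setX [set A : {set 'I_M} | #|A| == j] [set B : {set 'I_M} | #|B| == j].
  by apply/setP => -[A B]; rewrite !inE.
by rewrite cardsX !card_draws card_ord.
Qed.

Lemma card_turn_set c B : #|turn_set c B| = #|B|.
Proof. by rewrite card_imset //; apply: perm_inj. Qed.

(** Rotating B permutes the pairs, so summing [sum_gap_turn] over all pairs counts each
pair with a gap M times. *)
Theorem card_gap_pairs j : (M * #|gap_pairs j| = j * 'C(M, j) ^ 2)%N.
Proof.
set S := equicard_pairs j.
have turned c : (\sum_(AB in S) gapb AB.1 (turn_set c AB.2))%N = #|gap_pairs j|.
  pose f (AB : {set 'I_M} * {set 'I_M}) := (AB.1, turn_set c AB.2).
  have f_inj : injective f.
    move=> [A B] [A' B'] [-> /imset_inj e]; congr pair; apply: e; exact: perm_inj.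
  rewrite -sum1_card [RHS](reindex_inj f_inj) /= big_mkcond [RHS]big_mkcond /=.
  apply: eq_bigr => -[A B] _; rewrite !inE /= card_turn_set.
  by case: (#|A| == j) => //; case: (#|B| == j) => //=; case: gapb.
have -> : (M * #|gap_pairs j| =
    \sum_(c < M) \sum_(AB in S) gapb AB.1 (turn_set c AB.2))%N.
  by rewrite (eq_bigr (fun=> #|gap_pairs j|)) => [|c _];
    rewrite ?turned // sum_nat_const card_ord.
rewrite exchange_big /=.
rewrite (eq_bigr (fun=> j)) => [|[A B]];
  first by rewrite sum_nat_const card_equicard_pairs mulnC.
by rewrite inE /= => /andP[/eqP eA /eqP eB]; rewrite sum_gap_turn ?eA.
Qed.

End Gaps.

(** * Partitions fixed by a rotation *)
Section PeriodicMarks.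
Variable N : nat.
Local Notation M := N.+1.
Implicit Types (A B : {set 'I_M}) (x y z k : int) (e : int -> int -> Prop).

Definition first_set e : {set 'I_M} := [set i : 'I_M | `[< is_first e i%:Z >]].
Definition last_set e : {set 'I_M} := [set i : 'I_M | `[< is_last e i%:Z >]].

Lemma first_setP e x : periodic_rel M%:Z e -> marks (first_set e) x <-> is_first e x.
Proof.
move=> eM; have [k ex] := residueP N x; rewrite {2}ex /marks inE.
move: (residue N x) => i {x ex}; split=> [/asboolP h z lt_z ezi | h].
  apply: (h (z - k * M%:Z)); first by lia.
  by apply/(periodic_relM k _ _ eM); rewrite subrK.
apply/asboolP => z lt_z ezi; apply: (h (z + k * M%:Z)); first by lia.
exact/(periodic_relM k _ _ eM).
Qed.

Lemma last_setP e x : periodic_rel M%:Z e -> marks (last_set e) x <-> is_last e x.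
Proof.
move=> eM; have [k ex] := residueP N x; rewrite {2}ex /marks inE.
move: (residue N x) => i {x ex}; split=> [/asboolP h z lt_z ezi | h].
  apply: (h (z - k * M%:Z)); first by lia.
  by apply/(periodic_relM k _ _ eM); rewrite subrK.
apply/asboolP => z lt_z ezi; apply: (h (z + k * M%:Z)); first by lia.
exact/(periodic_relM k _ _ eM).
Qed.

Definition level A B x := cumul (marks A) (x + 1) - cumul (marks B) x.

Lemma level_heights A B : heights (marks A) (marks B) (level A B).
Proof. by move=> x; rewrite /level !cumulS; lia. Qed.

Lemma level_period A B x : level A B (x + M%:Z) = level A B x + #|A|%:Z - #|B|%:Z.
Proof.
rewrite /level; have -> : x + M%:Z + 1 = x + 1 + M%:Z by lia.
rewrite !(@cumul_period _ M%:Z) ?cumul_residue; try exact: marks_period.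
by lia.
Qed.

Lemma level_periodM A B x k :
  level A B (x + k * M%:Z) = level A B x + k * (#|A|%:Z - #|B|%:Z).
Proof.
set D := level A B; set v := _ - _.
pose g (y : int) := D (x + y * M%:Z) - y * v.
have gS y : g (y + 1) = g y.
  rewrite /g; have -> : x + (y + 1) * M%:Z = x + y * M%:Z + M%:Z by lia.
  by rewrite /D level_period /v; ring.
by have := int_shift_invariant k gS; rewrite /g !mul0r addr0 subr0; lia.
Qed.

(** If there were more firsts than lasts, the level would tend to infinity on the right
and to minus infinity on the left. At the last point where it is at most 0 no block
can end, but a block that continues would return to the same level further on. The
other case is symmetric. *)
Lemma card_first_last e : noncrossing_equiv e -> periodic_rel M%:Z e ->
  #|first_set e| = #|last_set e|.
Proof.
move=> eP eM; set A := first_set e; set B := last_set e; set D := level A B.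
have eD x y : e x y <-> arch (marks B) D x y.
  apply: (arch_equiv eP); last exact: level_heights.
    by move=> i; apply: first_setP.
  by move=> i; apply: last_setP.
have DS x : D (x + 1) = D x - (marks B x)%:Z + (marks A
  (x + 1))%:Z by apply: level_heights.
have DM x k : D (x + k * M%:Z) = D x + k * (#|A|%:Z - #|B|%:Z) by apply: level_periodM.
have [C CP] : exists C : int, forall i : 'I_M, - C <= D i%:Z <= C.
  exists (\sum_(i < M) `|D i%:Z|) => i; rewrite (bigD1 i) //=.
  have : 0 <= \sum_(j < M | j != i) `|D j%:Z| by apply: sumr_ge0 => j _; apply: normr_ge0.
  move: (\sum_(j < M | j != i) `|D j%:Z|) => S; lia.
have C_ge0 : 0 <= C by have := CP ord0; lia.
have push (u v : int) : v <= -1 -> u + `|u| * v <= 0.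
  by move=> hv; have := ler_wpM2l (normr_ge0 u) hv; lia.
have bounded (u k v : int) : v <= -1 -> - C <= u <= C -> u + k * v <= 0 -> - C <= k.
  move=> hv hu; have [//|lt_k] := leP (- C) k.
  by have := ler_wnM2l (ltac:(lia) : k <= 0) hv; lia.
have [ltAB | ltBA | //] := ltngtP #|A| #|B|.
  have v_le : #|A|%:Z - #|B|%:Z <= -1 by lia.
  have [||x [Dx _ x_min]] := @int_min (fun x => D x <= 0) (`|D 0| * M%:Z) (- C * M%:Z).
  - have -> : `|D 0| * M%:Z = 0 + `|D 0| * M%:Z by rewrite add0r.
    by rewrite DM; apply: push.
  - move=> x Dx; have [k ex] := residueP N x; move: Dx; rewrite ex DM.
    move: (residue N x) => i Dx.
    have hk := bounded _ _ _ v_le (CP i) Dx.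
    have : - C * M%:Z <= k * M%:Z by rewrite ler_pM2r.
    by move: (k * M%:Z); lia.
  have gtD y : y < x -> 0 < D y by move=> lt_yx; rewrite ltNge; apply/negP => /x_min; lia.
  have nL : ~ is_first e x.
    move/(first_setP x eM); rewrite -/A => Lx.
    have := DS (x - 1); rewrite subrK Lx; have := gtD (x - 1) ltac:(lia); lia.
  exfalso; apply: nL => z lt_zx /eD[Dzx _]; have := gtD z lt_zx; lia.
have v_le : - (#|A|%:Z - #|B|%:Z) <= -1 by lia.
have [||x [Dx _ x_max]] := @int_max (fun x => D x <= 0) (- `|D 0| * M%:Z) ((C + 1)
  * M%:Z).
- have -> : - `|D 0| * M%:Z = 0 + - `|D 0| * M%:Z by rewrite add0r.
  by rewrite DM mulNr -mulrN; apply: push.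
- move=> x Dx; have [k ex] := residueP N x; move: Dx; rewrite ex DM.
  have := ltn_ord (residue N x); move: (residue N x) => i lt_i.
  rewrite -mulrNN => Dx; have hk := bounded _ _ _ v_le (CP i) Dx.
  have : - k * M%:Z >= - C * M%:Z by rewrite ler_pM2r.
  by rewrite mulrDl !mulNr mul1r; move: (k * M%:Z) (C * M%:Z); lia.
have gtD y : x < y -> 0 < D y by move=> lt_yx; rewrite ltNge; apply/negP => /x_max; lia.
have nR : ~ is_last e x.
  move/(last_setP x eM); rewrite -/B => Rx.
  have := DS x; rewrite Rx; have := gtD (x + 1) ltac:(lia); lia.
exfalso; apply: nR => z lt_xz /eD[Dxz _]; have := gtD z lt_xz; lia.
Qed.

Lemma arch_marks_period A B : #|A| = #|B| ->
  periodic_rel M%:Z (arch (marks B) (level A B)).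
Proof.
move=> eAB a b; rewrite /arch !level_period eAB; split=> -[e h]; split; try lia.
  move=> k hk; have := h (k + M%:Z) ltac:(lia).
  by rewrite level_period marks_period eAB; lia.
move=> k hk; have := h (k - M%:Z) ltac:(lia).
have := level_period A B (k - M%:Z); have := marks_period B (k - M%:Z).
by rewrite subrK eAB => <-; lia.
Qed.

(** A point x whose level is minimal among vertices and not above any edge is related to
x + M, and conversely. *)
Lemma central_gap A B : #|A| = #|B| ->
  (exists x, arch (marks B) (level A B) x (x + M%:Z)) <-> ~~ gapb A B.
Proof.
move=> eAB; have stepE k : level A B k - (marks B k)%:Z =
    cumul (marks A) (k + 1) - cumul (marks B) (k + 1) by rewrite /level (cumulS
      (marks B)); lia.
split=> [[x [_ h]] | /asboolP ng].
  apply/asboolP => /(_ x)[k]; rewrite -stepE -/(level A B x).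
  have [l kl] := @int_mod_interval x M%:Z k isT.
  have := h (k + l * M%:Z) ltac:(lia); rewrite marksD level_periodM eAB subrr mulr0 addr0.
  by lia.
have [x h] : exists x, forall k, ~ (cumul (marks A) (k + 1) - cumul (marks B) (k + 1)
    < cumul (marks A) (x + 1) - cumul (marks B) x).
  by apply: contrapT => no; apply: ng => x; apply: contrapT => no'; apply: no;
    exists x => k lt;
     apply: no'; exists k.
exists x; split=> [|k _]; first by rewrite level_period eAB; lia.
by rewrite stepE; have := h k; rewrite -/(level A B x); lia.
Qed.

Lemma cumul_marksM A (p : nat) : cumul (marks A) (p%:Z * M%:Z) = p%:Z * #|A|%:Z.
Proof.
elim: p => [|p IH]; first by rewrite !mul0r cumul0.
have -> : p.+1%:Z * M%:Z = p%:Z * M%:Z + M%:Z by lia.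
rewrite (@cumul_period _ M%:Z) ?IH ?cumul_residue; first by lia.
exact: marks_period.
Qed.

End PeriodicMarks.

Section RotationInvariant.
Variables (N N' d : nat).
Local Notation n := N'.+1.
Local Notation M := N.+1.
Hypotheses (d_gt2 : (2 < d)%N) (n_dM : n = (d * M)%N).
Implicit Types (P : {set {set 'I_n}}) (A B : {set 'I_M}) (x y z k : int).

Let m_gt0 : 0 < M%:Z. Proof. by []. Qed.
Let n_ge : 3 * M%:Z <= n%:Z. Proof. by rewrite n_dM PoszM ler_pM2r. Qed.
Let n_dMz : n%:Z = d%:Z * M%:Z. Proof. by rewrite n_dM. Qed.

Local Notation rotM := (rot_perm n ^+ M)%g.

Definition turn_partition P : {set {set 'I_n}} := [set rotM @: (B : {set 'I_n}) | B in P].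

Lemma residue_rot x : residue N' (x + M%:Z) = rotM (residue N' x).
Proof.
apply: val_inj; rewrite /= rot_permX; have [k ex] := residueP N' x.
rewrite {1}ex; move: (residue N' x) => i.
have -> : i%:Z + k * n%:Z + M%:Z = (i + M)%N%:Z + k * n%:Z by lia.
rewrite residueD /residue modz_nat absz_nat inordK // ltn_mod //.
Qed.

Lemma turn_partitionP P : partition P setT ->
  turn_partition P = P <-> forall i j, same P (rotM i) (rotM j) = same P i j.
Proof.
move=> pP; split=> [fixP i j | h]; first by rewrite -{1}fixP same_imset.
apply: eq_partition => //; first exact: partition_imset.
by move=> i j; rewrite -(permKV rotM i) -(permKV rotM j) same_imset // h.
Qed.

(** The partition as a relation on integers modulo n. *)
Definition cyclic_ext P x y : Prop := same P (residue N' x) (residue N' y).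

Definition invariant_partition P :=
  [/\ partition P setT, noncrossing P & turn_partition P = P].

Section OnePartition.
Variable P : {set {set 'I_n}}.
Hypothesis invP : invariant_partition P.

Let partP : partition P setT. Proof. by case: invP. Qed.

(** Translate a into [0, n); the four points then lie in [0, 2 n), and according to how
many of them pass n, the crossing on the circle is one of four crossings on the
line. *)
Lemma cyclic_ext_nc a b c f : a < b -> b < c -> c < f -> f < a + n%:Z ->
  cyclic_ext P a c -> cyclic_ext P b f -> cyclic_ext P a b.
Proof.
have nc : noncrossing P by case: invP.
have lin (i j k l : 'I_n) := (noncrossing_same partP).1 nc i j k l.
move=> ab bc cf fa.
have [k ea] := residueP N' a.
have lift x : a <= x < a + n%:Z -> exists2 p : nat, x = p%:Z + k * n%:Z &
  (residue N' a <= p < residue N' a + n)%N.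
  move=> hx; exists `|(x - k * n%:Z)%R|%N.
    by have : a >= k * n%:Z by [rewrite {1}ea; lia]; lia.
  by move: hx ea; move: (residue N' a : nat) (k * n%:Z) => r kn; lia.
have [pb eb hb] := lift b ltac:(lia); have [pc ec hc] := lift c ltac:(lia).
have [pf ef hf] := lift f ltac:(lia).
have res p : (p < n)%N -> residue N' (p%:Z + k * n%:Z) = inord p :> 'I_n.
  by move=> lt_p; rewrite residueD -[p in LHS](inordK lt_p) residue_ord.
have res' p : (n <= p)%N -> (p - n < n)%N -> residue N' (p%:Z + k * n%:Z) = inord
  (p - n) :> 'I_n.
  move=> le_p lt_p; have -> : p%:Z + k * n%:Z = (p - n)%N%:Z + (k + 1) * n%:Z by lia.
  by rewrite residueD -[(p - n)%N in LHS](inordK lt_p) residue_ord.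
rewrite /cyclic_ext; set i := residue N' a in ea hb hc hf *; have lt_i := ltn_ord i.
have val (p : nat) : (p < n)%N -> (inord p : 'I_n) = p :> nat by move=> lt_p;
  rewrite inordK.
have lt_bc : (pb < pc)%N by lia.
have lt_cf : (pc < pf)%N by lia.
have lt_ib : (i < pb)%N by lia.
have [b_n|n_b] := ltnP pb n; last first.
  have vb := val (pb - n)%N ltac:(lia); have vc := val (pc - n)%N ltac:(lia).
  have vf := val (pf - n)%N ltac:(lia).
  rewrite eb ec ef !res'; try lia.
  move=> ac bf; have cd : same P (inord (pb - n)) (inord (pc - n)).
    rewrite same_sym // in ac.
    by apply: lin bf ac; lia.
  by apply: (same_trans partP ac); rewrite same_sym.
have [c_n|n_c] := ltnP pc n; last first.
  have vb := val pb b_n; have vc := val (pc - n)%N ltac:(lia).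
  have vf := val (pf - n)%N ltac:(lia).
  rewrite eb ec ef (res pb) // !res'; try lia.
  move=> ac bf; have cd : same P (inord (pc - n)) (inord (pf - n)).
    rewrite same_sym // in ac; rewrite same_sym // in bf.
    by apply: lin ac bf; lia.
  apply: (same_trans partP ac); apply: (same_trans partP cd).
  by rewrite same_sym.
have [f_n|n_f] := ltnP pf n; last first.
  have vb := val pb b_n; have vc := val pc c_n; have vf := val (pf - n)%N ltac:(lia).
  rewrite eb ec ef (res pb) // (res pc) // res'; try lia.
  move=> ac bf; have fa' : same P (inord (pf - n)) i.
    rewrite same_sym // in bf.
    by apply: lin bf ac; lia.
  by rewrite same_sym //; apply: (same_trans partP bf).
have vb := val pb b_n; have vc := val pc c_n; have vf := val pf f_n.
rewrite eb ec ef !res // => ac bf; apply: lin ac bf; lia.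
Qed.

Lemma cyclic_ext_cyclic : cyclic_equiv n%:Z M%:Z (cyclic_ext P).
Proof.
split=> [a|a b|b a c|a|a b|]; rewrite /cyclic_ext.
- exact: same_refl.
- by rewrite same_sym.
- exact: same_trans.
- by rewrite -[in X in same P _ X](mul1r n%:Z) residueD; apply: same_refl.
- by case: invP => _ _ /(turn_partitionP partP) h; rewrite !residue_rot h.
exact: cyclic_ext_nc.
Qed.

Definition local_ext := unroll M%:Z (cyclic_ext P).

Lemma local_ext_nce : noncrossing_equiv local_ext.
Proof. exact: unroll_nce m_gt0 n_ge _ cyclic_ext_cyclic. Qed.

Lemma local_ext_period : periodic_rel M%:Z local_ext.
Proof. exact: unroll_shift cyclic_ext_cyclic. Qed.

Lemma cyclic_extE x y : cyclic_ext P x y <-> roll_up n%:Z local_ext x y.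
Proof.
split; first exact: unroll_cover m_gt0 n_ge _ cyclic_ext_cyclic _ _.
move=> [k [h _]]; move: h; rewrite /cyclic_ext residueD //.
Qed.

Local Notation A := (first_set N local_ext).
Local Notation B := (last_set N local_ext).

Lemma local_ext_arch x y : local_ext x y <-> arch (marks B) (level A B) x y.
Proof.
apply: (arch_equiv local_ext_nce); last exact: level_heights.
  by move=> i; apply: first_setP local_ext_period.
by move=> i; apply: last_setP local_ext_period.
Qed.

Lemma card_marks : #|A| = #|B|.
Proof. exact: card_first_last local_ext_nce local_ext_period. Qed.

Lemma exists_central : (exists x, cyclic_ext P x (x + M%:Z)) <-> ~~ gapb A B.
Proof.
rewrite -(central_gap card_marks); split=> -[x h]; exists x.
  by apply/local_ext_arch; apply/unroll_central.
by apply/unroll_central; apply/local_ext_arch.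
Qed.

(** Each block that is not central is represented by its first element, once in every
turn; the central block, if any, has no first element and is represented by any of
its points. *)
Lemma card_invariant_partition : #|P| = (d * #|A| + ~~ gapb A B)%N.
Proof.
have sP := cyclic_ext_cyclic; have eP := local_ext_nce; have eM := local_ext_period.
pose F := [set i : 'I_n | marks A i%:Z].
have cardF : #|F| = (d * #|A|)%N.
  apply/eqP; rewrite -eqz_nat PoszM -cumul_marksM -n_dMz /= -sum1_card big_mkcond.
  by rewrite sum_Posz; apply/eqP/eq_bigr => i _; rewrite inE; case: marks.
have marks_n x k : marks A (x + k * n%:Z) = marks A x by rewrite n_dMz mulrA marksD.
have F_first i : i \in F -> is_first local_ext i%:Z.
  by rewrite inE => /first_setP; apply.
have F_inj : {in F &, forall i j, same P i j -> i = j}.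
  move=> i j Fi Fj Pij.
  have : cyclic_ext P i%:Z j%:Z by rewrite /cyclic_ext !residue_ord.
  move/cyclic_extE => [k ij]; have fi := F_first i Fi.
  have fj : is_first local_ext (j%:Z + k * n%:Z).
    by apply/first_setP => //; rewrite marks_n; move: Fj; rewrite inE.
  have eij : i%:Z = j%:Z + k * n%:Z.
    have [lt|lt|//] := ltgtP i%:Z (j%:Z + k * n%:Z); first by case: (fj _ lt).
    by case: (fi _ lt); apply: (nce_sym eP).
  by rewrite -(residue_ord i) eij residueD residue_ord.
have F_cover (i : 'I_n) : ~ cyclic_ext P i%:Z (i%:Z + M%:Z) -> exists2 j,
  j \in F & same P j i.
  move=> nc; have near (y : int) : local_ext y i%:Z -> `|y - i%:Z| < M%:Z.
    move=> yi; have [//|far] := ltP `|y - i%:Z| M%:Z; case: nc.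
    have [_] := central_of_long m_gt0 n_ge eP eM n_dMz yi far.
    by case.
  have [||y [yi _ y_min]] := @int_min (fun y => local_ext y i%:Z) i%:Z (i%:Z - M%:Z).
  - exact: nce_refl.
  - by move=> y /near; lia.
  exists (residue N' y); last first.
    by case: yi => yi _; move: yi; rewrite /cyclic_ext residue_ord.
  have [k ey] := residueP N' y; rewrite inE -(marks_n _ k) -ey; apply/first_setP => //.
  by move=> z lt_zy zy; have := y_min z (nce_trans eP zy yi); lia.
have [central|gap] := boolP (gapb A B); last first.
  have [c cc] := (exists_central).2 gap.
  pose c0 := residue N' c; have nF : c0 \notin F.
    apply/negP => Fc; have := F_first _ Fc => /(unroll_first m_gt0 n_ge sP) h.
    have [k ec] := residueP N' c; rewrite -/c0 in ec.
    apply: (h (c0%:Z - M%:Z)); first by lia.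
    apply: (ce_shift sP _ _).1; rewrite subrK; apply: (central_shift sP cc).
    by rewrite /cyclic_ext -/c0 residue_ord; apply: same_refl.
  have -> : (d * #|A| + true = #|c0 |: F|)%N by rewrite cardsU1 nF cardF addnC.
  apply: (card_blocks partP) => [i|i j].
    have [ci|nci] := pselect (cyclic_ext P i%:Z (i%:Z + M%:Z)); last first.
      by have [j Fj ji] := F_cover i nci; exists j; rewrite // inE Fj orbT.
    exists c0; first by rewrite !inE eqxx.
    by have := central_unique m_gt0 n_ge sP cc ci; rewrite /cyclic_ext residue_ord.
  have c0F (j' : 'I_n) : j' \in F -> ~ same P c0 j'.
    move=> Fj' cj; have /(unroll_first m_gt0 n_ge sP) h := F_first _ Fj'.
    apply: (h (j'%:Z - M%:Z)); first by lia.
    apply: (ce_shift sP _ _).1; rewrite subrK; apply: (central_shift sP cc).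
    by rewrite /cyclic_ext -/c0 residue_ord.
  rewrite !in_setU1 => /predU1P[->|Fi] /predU1P[->|Fj] // ij.
  - by case: (c0F j).
  - by case: (c0F i); rewrite // same_sym.
  exact: F_inj.
rewrite addn0 -cardF; apply: (card_blocks partP) => // i; apply: F_cover => ci.
have /exists_central : exists x, cyclic_ext P x (x + M%:Z) by exists i%:Z.
by rewrite central.
Qed.

End OnePartition.

Definition mark_sets P := (first_set N (local_ext P), last_set N (local_ext P)).

Lemma mark_sets_inj : {in [pred P | `[< invariant_partition P >]] &, injective mark_sets}.
Proof.
have sub P Q : invariant_partition P -> invariant_partition Q ->
    mark_sets P = mark_sets Q -> forall i j, same P i j -> same Q i j.
  move=> iP iQ [eA eB] i j Pij.
  have : cyclic_ext P i%:Z j%:Z by rewrite /cyclic_ext !residue_ord.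
  move/(cyclic_extE iP) => [k ij].
  have : cyclic_ext Q i%:Z j%:Z.
    apply/(cyclic_extE iQ); exists k; apply/(local_ext_arch iQ).
    by rewrite -eA -eB; apply/(local_ext_arch iP).
  by rewrite /cyclic_ext !residue_ord.
move=> P Q /asboolP iP /asboolP iQ eq_marks; have [pP _ _] := iP; have [pQ _ _] := iQ.
by apply: eq_partition => // i j; apply/idP/idP; apply: sub.
Qed.

(** Roll up the relation given by arches; unrolling it again gives back the relation
([roll_up_unroll]), hence the same firsts and lasts. *)
Lemma mark_sets_surj A B : #|A| = #|B| ->
  exists2 P, invariant_partition P & mark_sets P = (A, B).
Proof.
move=> eAB; set e := arch (marks B) (level A B).
have eP : noncrossing_equiv e := arch_noncrossing_equiv (marks B) (level A B).
have eM : periodic_rel M%:Z e := arch_marks_period eAB.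
have sP := roll_up_cyclic m_gt0 n_ge eP eM n_dMz; set s := roll_up n%:Z e in sP.
pose r (i j : 'I_n) := `[< s i%:Z j%:Z >].
have rP : equivalence_rel r.
  move=> i j k; split; first by apply/asboolP; apply: (ce_refl sP).
  move=> /asboolP ij; apply/asboolP/asboolP => h; last exact: ce_trans sP _ _ _ ij h.
  exact: ce_trans sP _ _ _ (ce_sym sP ij) h.
have [P partP Pr] := partition_of_rel rP.
have turn a k : s a (a + k * n%:Z).
  exists (- k); rewrite mulNr addrK; exact: nce_refl eP a.
have Ps x y : cyclic_ext P x y <-> s x y.
  rewrite /cyclic_ext Pr /r; have [k ex] := residueP N' x; have [l ey] := residueP N' y.
  have xx : s (residue N' x)%:Z x by rewrite {2}ex; apply: turn.
  have yy : s (residue N' y)%:Z y by rewrite {2}ey; apply: turn.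
  split=> [/asboolP h|h]; first exact: ce_trans sP _ _ _ (ce_trans sP (ce_sym sP xx) h)
    yy.
  apply/asboolP; exact: ce_trans sP _ _ _ (ce_trans sP xx h) (ce_sym sP yy).
have Pij (i j : 'I_n) : same P i j <-> s i%:Z j%:Z by
  rewrite -Ps /cyclic_ext !residue_ord.
have ncP : noncrossing P.
  apply/noncrossing_same => // a b c f ab bc cf /Pij ac /Pij bf; apply/Pij.
  by apply: (ce_nc sP) ac bf; have := ltn_ord f; lia.
have invP : invariant_partition P.
  split=> //; apply/turn_partitionP => // i j.
  rewrite -[in LHS](residue_ord i) -[in LHS](residue_ord j) -!residue_rot.
  apply/idP/idP; first by move/Ps/(ce_shift sP)/Pij.
  by move/Pij/(ce_shift sP)/Ps.
exists P => //; rewrite /mark_sets.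
have lE x y : local_ext P x y <-> e x y.
  rewrite -(roll_up_unroll m_gt0 n_ge eP eM n_dMz) /local_ext /unroll -/s.
  by rewrite !Ps.
have DP := level_heights A B.
congr pair; apply/setP => i; rewrite inE.
  have markE : marks A i%:Z = (i \in A) by rewrite /marks residue_ord.
  apply/asboolP/idP => [h|Ai z zi /lE]; last first.
    by apply: (arch_first DP) => //; rewrite markE.
  rewrite -markE; apply: contraT => nA.
  have [||x [xi xarch]] := arch_not_first DP (x0 := i%:Z - M%:Z) nA; first by lia.
    by have := level_period A B (i%:Z - M%:Z); rewrite subrK eAB; lia.
  by case: (h x xi); apply/lE.
have markE : marks B i%:Z = (i \in B) by rewrite /marks residue_ord.
apply/asboolP/idP => [h|Bi z zi /lE]; last first.
  by apply: arch_last => //; rewrite markE.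
rewrite -markE; apply: contraT => nB.
have [||x [xi xarch]] := arch_not_last DP (x0 := i%:Z + M%:Z) nB; first by lia.
  by have := level_period A B i%:Z; rewrite eAB; lia.
by case: (h x xi); apply/lE.
Qed.

Theorem card_ncp_rot_fixed b :
  #|[set P in ncp n b | turn_partition P == P]| =
  #|[set AB : {set 'I_M} * {set 'I_M} |
     (#|AB.1| == #|AB.2|) && (d * #|AB.1| + ~~ gapb AB.1 AB.2 == b)%N]|.
Proof.
rewrite -(card_in_imset (f := mark_sets)) => [|P Q].
  apply: eq_card => -[A B]; rewrite inE;
    apply/imsetP/andP => [[P]|[/= /eqP eAB /eqP cAB]].
    rewrite inE => /andP[/ncpP[pP nP cP] /eqP tP].
    have iP : invariant_partition P by [].
    move=> eAB; have := card_marks iP; have := card_invariant_partition iP.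
    by case: eAB => -> ->; rewrite cP /= => -> ->.
  have [P iP eP] := mark_sets_surj eAB; exists P => //.
  have [pP nP tP] := iP; rewrite inE tP eqxx andbT; apply/ncpP; split=> //.
  by have := card_invariant_partition iP; case: eP => -> ->; rewrite cAB.
rewrite inE => /andP[/ncpP[pP nP _] /eqP tP];
  rewrite inE => /andP[/ncpP[pQ nQ _] /eqP tQ].
by apply: mark_sets_inj; apply/asboolP.
Qed.

Let succ_mul_neq a c : ((d * a).+1 == d * c)%N = false.
Proof.
apply/negbTE/eqP => e; have := dvdn_mulr c (dvdnn d).
by rewrite -e -addn1 dvdn_addr ?dvdn_mulr // dvdn1; lia.
Qed.

(** The number of blocks is a multiple of d exactly when there is no central block. *)
Theorem card_ncp_rot_gap j :
  #|[set P in ncp n (d * j) | turn_partition P == P]| = #|gap_pairs N j|.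
Proof.
rewrite card_ncp_rot_fixed; apply: eq_card => -[A B]; rewrite !inE /=.
case: (gapb A B); rewrite /= ?addn0 ?addn1 ?andbF ?andbT.
  rewrite eqn_pmul2l; last by lia.
  by case: (#|A| =P j) => [->|]; rewrite ?andbT ?andbF // eq_sym.
by rewrite succ_mul_neq andbF.
Qed.

Theorem card_ncp_rot_block j :
  (#|[set P in ncp n (d * j).+1 | turn_partition P == P]| + #|gap_pairs N j| =
   'C(M, j) ^ 2)%N.
Proof.
rewrite card_ncp_rot_fixed.
rewrite -card_equicard_pairs -(cardsID (gap_pairs N j) (equicard_pairs N j)) addnC;
  congr addn; apply: eq_card => -[A B]; rewrite !inE /=.
  by case: (#|A| == j); case: (#|B| == j).
case: (gapb A B); rewrite /= ?addn0 ?addn1 ?andbF ?andbT /=.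
  rewrite [RHS](_ : _ = false); last by case: (#|A| == j); case: (#|B| == j).
  by rewrite [X in _ && X]eq_sym succ_mul_neq andbF.
rewrite eqSS eqn_pmul2l; last by lia.
by case: (#|A| =P j) => [->|]; rewrite ?andbT ?andbF // eq_sym.
Qed.

Theorem card_ncp_rot_other b : (1 < b %% d)%N ->
  #|[set P in ncp n b | turn_partition P == P]| = 0%N.
Proof.
move=> b_d; rewrite card_ncp_rot_fixed; apply: eq_card0 => -[A B]; rewrite !inE /=.
apply/negbTE; rewrite negb_and; apply/orP; right; apply: contraTneq b_d => <-.
by rewrite mulnC modnMDl; case: gapb; rewrite /= ?mod0n // modn_small //; lia.
Qed.

End RotationInvariant.

(** * Values of the characters *)
Section PolygonAngles.
Variable R : realType.
Implicit Types (x : R) (m n a : nat).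

(** With t = -1 and s = 2 cos x, the recursion is the addition formula of the sine. *)
Lemma lucas_sin x m : lucas (2 * cos x) (-1) m * sin x = sin (x *+ m).
Proof.
suff [] : lucas (2 * cos x) (-1) m * sin x = sin (x *+ m) /\
  lucas (2 * cos x) (-1) m.+1 * sin x = sin (x *+ m.+1) by [].
elim: m => [|m [IH1 IH2]]; first by rewrite mulr0n mulr1n sin0 mul0r mul1r.
split=> //; rewrite lucasSS mulrDl -!mulrA IH1 IH2.
have -> : x *+ m = x *+ m.+1 - x by rewrite mulrSr addrK.
by rewrite [in RHS]mulrSr; move: (x *+ m.+1) => y; rewrite [in RHS]sinD sinB; ring.
Qed.

Lemma polygon_angle_n n : (0 < n)%N -> polygon_angle R n *+ n = pi *+ 2.
Proof. by move=> n_gt0; rewrite -mulr_natr divfK // pnatr_eq0 -lt0n. Qed.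

(** The angle is 2 pi m / n; as n is odd it is never pi modulo 2 pi. *)
Lemma sin_polygon_neq0 n m :
  odd n -> ~~ (n %| m)%N -> sin (polygon_angle R n *+ m) != 0.
Proof.
move=> n_odd; have n_gt0 : (0 < n)%N by case: n n_odd.
rewrite {2}(divn_eq m n) /dvdn; have := ltn_pmod m n_gt0.
move: (m %% n)%N (m %/ n)%N => y q lt_yn y_neq0.
rewrite mulrnDr mulnC mulrnA polygon_angle_n // addrC periodicn; last exact: sinD2pi.
have n_neq0 : n%:R != 0 :> R by rewrite pnatr_eq0 -lt0n.
have angleE : polygon_angle R n *+ y = pi * ((2 * y)%:R / n%:R).
  by rewrite /polygon_angle -mulr_natr natrM -mulr_natr; field.
have n_gt0' : 0 < n%:R :> R by rewrite ltr0n.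
have pi0 := pi_gt0 R.
rewrite angleE; have [lt_2y | le_n] := ltnP (2 * y) n.
  apply/lt0r_neq0/sin_gt0_pi; apply/andP; split.
    by rewrite mulr_gt0 // divr_gt0 // ltr0n; lia.
  by rewrite gtr_pMr // ltr_pdivrMr // mul1r ltr_nat.
have -> : pi * ((2 * y)%:R / n%:R) = pi * ((2 * y - n)%:R / n%:R) + pi :> R.
  by rewrite natrB //; field.
rewrite sinDpi oppr_eq0; apply/lt0r_neq0/sin_gt0_pi; apply/andP; split.
  by rewrite mulr_gt0 // divr_gt0 // ltr0n; lia.
by rewrite gtr_pMr // ltr_pdivrMr // mul1r ltr_nat; lia.
Qed.

Lemma sin_polygon_turn n m a : (0 < n)%N -> (n %| m)%N ->
  sin (polygon_angle R n *+ (m + a)) = sin (polygon_angle R n *+ a).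
Proof.
move=> n_gt0 /dvdnP[q ->].
by rewrite mulrnDr mulnC mulrnA polygon_angle_n // addrC periodicn //; apply: sinD2pi.
Qed.

End PolygonAngles.

Section Evaluation.
Variables (F : fieldType) (gT : finGroupType) (G : {group gT}).
Implicit Types (u v : Rep F G) (phi psi : gT -> F).

Lemma affords_lucas u v phi psi m : affords u phi -> affords v psi ->
  affords (lucas u v m) (fun g => lucas (phi g) (psi g) m).
Proof.
move=> uP vP; suff [] : affords (lucas u v m) (fun g => lucas (phi g) (psi g) m) /\
  affords (lucas u v m.+1) (fun g => lucas (phi g) (psi g) m.+1) by [].
elim: m => [|m [IH1 IH2]]; first by split; [apply: affords0 | apply: affords1].
by split=> //; apply: affordsD; apply: affordsM.
Qed.

Lemma affords_lucasnomial u v phi psi i j : affords u phi -> affords v psi ->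
  affords (lucasnomial u v i j) (fun g => lucasnomial (phi g) (psi g) i j).
Proof.
move=> uP vP; elim: i j => [|i IHi] j; first exact: affords1.
elim: j => [|j IHj]; first exact: affords1.
apply: affordsD; apply: affordsM => //; first exact: affords_lucas.
by apply: affordsM => //; apply: affords_lucas.
Qed.

Lemma affords_lucas_narayana u v phi psi k l : affords u phi -> affords v psi ->
  affords (lucas_narayana u v k l) (fun g => lucas_narayana (phi g) (psi g) k l).
Proof.
move=> uP vP; case: k l => [|k] [|l]; try exact: affords1.
have lP := fun i j => affords_lucasnomial i j uP vP.
by apply: affordsD; [apply: affordsM (lP _ _) (lP _ _) |
  apply: affordsM vP (affordsM (lP _ _) (lP _ _))].
Qed.

End Evaluation.

Lemma lucas_narayana_eval (A : comNzRingType) (x y : A) k l :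
  (map_poly (map_poly intr) (lucas_narayana 'X 'Y k l)).[x, y] =
  lucas_narayana x y k l.
Proof.
pose ev1 : {rmorphism {poly {poly int}} -> {poly {poly A}}} := map_poly (map_poly intr).
pose ev2 : {rmorphism {poly {poly A}} -> {poly A}} := horner_eval x%:P.
pose ev3 : {rmorphism {poly A} -> A} := horner_eval y.
rewrite -[LHS]/(ev3 (ev2 (ev1 _))) !rmorph_lucas_narayana /=.
rewrite map_polyX map_polyC /= map_polyX.
by rewrite !horner_evalE !hornerE.
Qed.

Lemma mxtrace_permutation (F : fieldType) (aT : finGroupType) (G D : {group aT})
    (T : finType) (to : action D T) (X : {set T}) (actsX : [acts G, on X | to]) g :
  \tr (permutation_rep F actsX g) = #|[set x in X | to x g == x]|%:R.
Proof.
rewrite /mxtrace -sum1_card natr_sum [RHS]big_mkcond.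
rewrite (eq_bigr (fun i : 'I_#|X| => (to (enum_val i) g == enum_val i)%:R)) => [|i _];
  last first.
  by rewrite mxE.
rewrite -(@big_enum_val _ _ _ _ (mem X) (fun x => (to x g == x)%:R : F))
  /= [LHS]big_mkcond.
by apply: eq_bigr => x _; rewrite inE; case: (x \in X); case: eqP.
Qed.

Section DihedralCharacters.
Variables (R : realType) (n : nat) (n_gt2 : (2 < n)%N).
Local Notation C := R[i].
Local Open Scope complex_scope.
Local Notation rot := (rot_perm n).
Local Notation refl := (refl_perm n).

Lemma z1_rot a : z1 R n_gt2 (rot ^+ a)%g = rotation_mx (polygon_angle R n *+ a).
Proof. by have := z1_mxE R n_gt2 a 0; rewrite expg0 mulg1 expr0 mulr1 rotation_mxX. Qed.

Lemma z1_rot_refl a :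
  z1 R n_gt2 (rot ^+ a * refl)%g = rotation_mx (polygon_angle R n *+ a) * reflection_mx R.
Proof. by have := z1_mxE R n_gt2 a 1; rewrite expg1 expr1 rotation_mxX. Qed.

Lemma trace_z1_rot a :
  \tr (z1 R n_gt2 (rot ^+ a)%g) = (2 * cos (polygon_angle R n *+ a))%:C.
Proof.
rewrite z1_rot /mxtrace !big_ord_recl big_ord0 !mxE /=.
by rewrite rmorphM rmorph_nat; ring.
Qed.

Lemma trace_det_rot a : \tr (det_rep R n_gt2 (rot ^+ a)%g) = 1.
Proof.
rewrite mxtrace_scalar /= -[z1_mx R _]/(z1 R n_gt2 _) z1_rot det_mx22 !mxE /=.
by rewrite rmorphN mulNr opprK -!rmorphM -rmorphD /= -!expr2 cos2Dsin2.
Qed.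

Lemma trace_z1_rot_refl a : \tr (z1 R n_gt2 (rot ^+ a * refl)%g) = 0.
Proof.
rewrite z1_rot_refl /mxtrace !big_ord_recl big_ord0 !mxE /= !big_ord_recl !big_ord0
  !mxE /=.
by rewrite expr0 expr1; ring.
Qed.

Lemma trace_det_rot_refl a : \tr (det_rep R n_gt2 (rot ^+ a * refl)%g) = -1.
Proof.
rewrite mxtrace_scalar /= -[z1_mx R _]/(z1 R n_gt2 _) z1_rot_refl det_mulmx.
have -> : \det (rotation_mx (polygon_angle R n *+ a)) = 1 :> C.
  by have := trace_det_rot a; rewrite mxtrace_scalar /= -[z1_mx R _]/(z1 R n_gt2 _)
    z1_rot.
by rewrite det_mx22 !mxE /= expr0 expr1; ring.
Qed.

End DihedralCharacters.

(** * Fixed points are values of the Narayana polynomial *)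
Section FixedPointCounts.
Variable K : fieldType.
Implicit Types (k l h N d : nat).

Lemma card_ncp_narayana k l : [pchar K] =i pred0 ->
  #|ncp (k + l).+1 l.+1|%:R = lucas_narayana (2 : K) (-1) k l.
Proof.
move=> K0; rewrite card_ncp lucas_narayana_identity //.
have e1 : 'C(k + l, l) = 'C(k + l, k) by rewrite -bin_sub ?leq_addl // addnK.
have e2 : ('C(k + l, l.+1) * bin_pred (k + l) l = 'C(k + l, k.+1) * bin_pred (k + l) k)%N.
  have pred_bin a b : 'C(a + b, a.+1) = bin_pred (a + b) b.
    case: b => [|b]; first by rewrite addn0 bin_small.
    by rewrite /= -bin_sub; [congr 'C(_, _); lia | lia].
  by rewrite (pred_bin k l) [in LHS](addnC k l) (pred_bin l k) addnC mulnC.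
have := @ballot_numberE (k + l) l l (leqnSn l).
by rewrite e2 e1 -mulnn => <-; rewrite natrD addrK.
Qed.

Lemma card_ncp_reflection_narayana k l : ~~ odd (k + l) ->
  #|[set P in ncp (k + l).+1 l.+1 |
      [set rev_perm (k + l) @: (B : {set 'I_(k + l).+1}) | B in P] == P]|%:R =
  lucas_narayana (0 : K) 1 k l.
Proof.
move=> even_kl; rewrite lucas_narayana_reflection //; congr _%:R.
set h := (k + l)./2; have def_kl : (k + l = h + h)%N by rewrite /h; lia.
have count N : N = (h + h)%N -> #|[set P in ncp N.+1 l.+1 |
    [set rev_perm N @: (B : {set 'I_N.+1}) | B in P] == P]| = ('C(h, l./2) * 'C(h,
      uphalf l))%N.
  by move=> ->; apply: card_ncp_rev_fixed.
rewrite (count _ def_kl).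
have [k_odd | k_even] := boolP (odd k).
  have -> : l./2 = (h - uphalf k)%N by rewrite /h; lia.
  have -> : uphalf l = (h - k./2)%N by rewrite /h; lia.
  by rewrite !bin_sub 1?mulnC //; rewrite /h; lia.
have -> : uphalf k = k./2 by lia.
have -> : uphalf l = l./2 by lia.
have -> : l./2 = (h - k./2)%N by rewrite /h; lia.
by rewrite !bin_sub //; rewrite /h; lia.
Qed.

Lemma card_ncp_rotation_narayana s d N k l :
  (2 < d)%N -> odd d -> lucas s (-1) d = 0 -> lucas s (-1) d.+1 = 1 ->
  (forall i, (0 < i < d)%N -> lucas s (-1) i != 0) ->
  ((k + l).+1 = d * N.+1)%N ->
  #|[set P in ncp (k + l).+1 l.+1 | turn_partition N P == P]|%:R =
  lucas_narayana (s : K) (-1) k l.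
Proof.
move=> d_gt2 d_odd f0 f1 fn0 n_dM.
have lt_u : (k %% d < d)%N by rewrite ltn_mod; lia.
have def_k := divn_eq k d; move: (k %/ d)%N (k %% d)%N def_k lt_u => I u def_k lt_u.
have le_IN : (I <= N)%N by rewrite -ltnS -(ltn_pmul2l (m := d)) //; lia.
have [J def_N] : exists J, N = (I + J)%N by exists (N - I)%N; rewrite subnKC.
have [v [def_l uv]] : exists v, l = (d * J + v)%N /\ (u + v)%N = d.-1.
  by exists (d.-1 - u)%N; rewrite def_N in n_dM; split; lia.
rewrite mulnC in def_k.
(* The number of blocks l + 1 is congruent to d - u modulo d. *)
have [u0 | u_neq0] := eqVneq u 0%N.
  have -> : l.+1 = (d * J.+1)%N by lia.
  rewrite (card_ncp_rot_gap d_gt2 n_dM) def_k def_l u0 addn0.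
  have -> : v = d.-1 by lia.
  rewrite (lucas_narayana_rotation_gap d_gt2 d_odd f0 f1 fn0); congr _%:R.
  apply/eqP; rewrite -(eqn_pmul2l (ltn0Sn N)) card_gap_pairs def_N; apply/eqP.
  have := mul_bin_diag (I + J).+1 J; rewrite /= => e.
  have -> : 'C(I + J, I) = 'C(I + J, J) by rewrite -bin_sub ?leq_addr // addKn.
  have -> : 'C((I + J).+1, I) = 'C((I + J).+1, J.+1).
    by rewrite -[in RHS]bin_sub; [congr 'C(_, _); lia | lia].
  by rewrite mulnA e; ring.
have [ud | u_neqd] := eqVneq u d.-1.
  have -> : l.+1 = (d * J).+1 by lia.
  have := card_ncp_rot_block d_gt2 n_dM J.
  have -> : l = (d * J)%N by lia.
  rewrite def_k ud (lucas_narayana_rotation_block d_gt2 d_odd f0 f1 fn0) => e.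
  congr _%:R; apply/eqP; rewrite -(eqn_pmul2l (ltn0Sn N)); apply/eqP.
  have := card_gap_pairs N J; have := mul_bin_down (I + J).+1 J; rewrite /= -def_N.
  have -> : 'C(N, I) = 'C(N, J) by rewrite -bin_sub; [congr 'C(_, _); lia | lia].
  have -> : 'C(N.+1, I.+1) = 'C(N.+1, J) by rewrite -bin_sub; [congr 'C(_, _); lia | lia].
  have -> : (N.+1 - J = I.+1)%N by lia.
  move: e; move: #|_| #|_| 'C(_, _) 'C(_, _) => x g c c' e down gapJ.
  (* x counts the pairs with a gap and g those without. *)
  apply: (@addIn (J * c' ^ 2)%N); rewrite -{1}gapJ -mulnDr e mulnA down def_N; ring.
rewrite (card_ncp_rot_other d_gt2 n_dM); last first.
  have -> : l.+1 = (J * d + v.+1)%N by lia.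
  by rewrite modnMDl modn_small; lia.
rewrite def_k def_l.
have [u' eu] : {u' | u = u'.+1} by exists u.-1; lia.
have [v' ev] : {v' | v = v'.+1} by exists v.-1; lia.
rewrite eu ev (lucas_narayana_rotation_zero d_gt2 d_odd f0 f1 fn0) //; lia.
Qed.

End FixedPointCounts.

Section FixedPoints.
Variables (R : realType) (k l : nat).
Local Notation n := (k + l).+1.
Local Notation C := R[i].
Hypotheses (n_gt2 : (2 < n)%N) (n_odd : odd n).
Local Notation rot := (rot_perm n).
Local Notation refl := (refl_perm n).
Local Notation U := (permutation_rep C (ncp_acts n l.+1)).

Definition fixed_ncp (g : 'S_n) :=
  [set P in ncp n l.+1 | [set g @: (B : {set 'I_n}) | B in P] == P].

Lemma trace_permutation_ncp g : \tr (U g) = #|fixed_ncp g|%:R.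
Proof. exact: mxtrace_permutation. Qed.

(** Conjugation by a power c of the rotation adds 2 c to the exponent, and 2 is
invertible modulo n: all reflections are conjugate to the order reversal. *)
Lemma rot_refl_conj a : exists c,
  (rot ^+ a * refl = rot ^+ c * (rev_perm (k + l) * rot ^- c))%g.
Proof.
have rs c : (rot ^+ c * refl = refl * rot ^- c)%g.
  rewrite conjgC; congr (_ * _)%g; rewrite conjXg.
  have -> : (rot ^ refl = rot^-1)%g by rewrite conjgE rot_refl_perm mulKg.
  by rewrite expgVn.
have revE : (rev_perm (k + l) = rot * refl)%g.
  by rewrite rot_refl_perm -rev_permM mulgK.
have [c ec] : exists c, a = (1 + 2 * c)%N %[mod n].
  have [a_odd | a_even] := boolP (odd a).
    by exists (a./2); congr (_ %% _)%N; lia.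
  exists ((a + (k + l))./2); have -> : (1 + 2 * (a + (k + l))./2 = a + n)%N by lia.
  by rewrite modnDr.
exists c; rewrite revE -mulgA -rs !mulgA -expgSr -expgD.
have -> : (c.+1 + c = 1 + 2 * c)%N by lia.
congr (_ * _)%g.
by rewrite -(expg_mod a (rot_perm_expn n)) ec expg_mod // rot_perm_expn.
Qed.

Lemma trace_reflection a :
  \tr (U (rot ^+ a * refl)%g) = lucas_narayana (0 : C) 1 k l.
Proof.
have [c ->] := rot_refl_conj a.
have rP := groupX c (rot_perm_in n); have vP := rev_perm_in (k + l).
rewrite repr_mxM ?groupM ?groupV // mxtrace_mulC -repr_mxM ?groupM ?groupV //.
rewrite mulgKV trace_permutation_ncp card_ncp_reflection_narayana //.
Qed.

Lemma fixed_ncp_sub (g h : 'S_n) e : h = (g ^+ e)%g -> fixed_ncp g \subset fixed_ncp h.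
Proof.
move=> ->; apply/subsetP => P; rewrite !inE => /andP[-> /eqP fixP] /=.
rewrite -[X in X == _]/(('P^*^*)%act P (g ^+ e)%g) actX.
by apply/eqP; apply: iter_fix.
Qed.

(** The two rotations are powers of each other, so they fix the same partitions. *)
Lemma fixed_ncp_gcd a : (0 < a)%N -> fixed_ncp (rot ^+ a)%g = fixed_ncp
  (rot ^+ gcdn a n)%g.
Proof.
move=> a_gt0; apply/eqP; rewrite eqEsubset; apply/andP; split.
  case: (egcdnP n a_gt0) => ka kn e _; apply: (@fixed_ncp_sub _ _ ka).
  rewrite -expgM mulnC e expgD mulnC expgM rot_perm_expn expg1n mul1g //.
apply: (@fixed_ncp_sub _ _ (a %/ gcdn a n)).
by rewrite -expgM mulnC divnK // dvdn_gcdl.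
Qed.

(** A nontrivial rotation by a steps has order d = n / gcd(a, n), which is odd and at
least 3, and fixes the same partitions as the rotation by gcd(a, n) steps. *)
Lemma trace_rotation a : \tr (U (rot ^+ a)%g) =
  lucas_narayana ((2 * cos (polygon_angle R n *+ a))%:C)%C (-1) k l.
Proof.
have -> : -1 = ((-1 : R)%:C)%C :> C by rewrite rmorphN1.
rewrite trace_permutation_ncp -rmorph_lucas_narayana.
suff <- : #|fixed_ncp (rot ^+ a)%g|%:R = lucas_narayana (2 * cos
  (polygon_angle R n *+ a)) (-1) k l.
  by rewrite rmorph_nat.
have R0 : [pchar R] =i pred0 by apply: pchar_num.
have [/dvdnP[q ->] | n_a] := boolP (n %| a)%N.
  rewrite mulnC mulrnA polygon_angle_n //.
  have -> : cos ((pi *+ 2) *+ q) = 1 :> R.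
    by rewrite -[_ *+ q]add0r (periodicn (@cosD2pi R)) cos0.
  rewrite mulr1 -card_ncp_narayana //; congr _%:R; apply: eq_card => P.
  rewrite inE expgM rot_perm_expn expg1n; apply: andb_idr => _; apply/eqP.
  exact: (act1 ('P^*^*)%act P).
have a_gt0 : (0 < a)%N by case: a n_a.
have M_gt0 : (0 < gcdn a n)%N by rewrite gcdn_gt0 a_gt0.
have [N eN] : exists N, gcdn a n = N.+1 by exists (gcdn a n).-1; rewrite prednK.
have [d n_dM] : exists d, n = (d * N.+1)%N.
  by have /dvdnP[d] := dvdn_gcdr a n; rewrite eN; exists d.
have [b a_bM] : exists b, a = (b * N.+1)%N.
  by have /dvdnP[b] := dvdn_gcdl a n; rewrite eN; exists b.
have cop : coprime d b.
  have : (gcdn (b * N.+1) (d * N.+1) = N.+1)%N by rewrite -a_bM -n_dM.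
  rewrite -muln_gcdl -[X in _ = X]mul1n => /eqP; rewrite eqn_pmul2r //.
  by rewrite /coprime gcdnC.
have n_dvd i : (n %| a * i)%N = (d %| i)%N.
  by rewrite n_dM a_bM mulnAC dvdn_pmul2r // Gauss_dvdr.
have d_odd : odd d by move: n_odd; rewrite n_dM oddM => /andP[].
have d_gt2 : (2 < d)%N.
  case: d d_odd n_dM n_dvd {cop} => [|[|[|d]]] // _ _ n_dvd.
  by have := n_dvd 1%N; rewrite muln1 dvd1n (negPf n_a).
set x := polygon_angle R n *+ a.
have xE i : x *+ i = polygon_angle R n *+ (a * i) by rewrite mulrnA.
have sinx : sin x != 0 by apply: sin_polygon_neq0.
have f0 : lucas (2 * cos x) (-1) d = 0.
  apply: (mulIf sinx); rewrite mul0r lucas_sin xE -[X in sin (_ *+ X)]addn0.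
  by rewrite sin_polygon_turn ?n_dvd // mulr0n sin0.
have f1 : lucas (2 * cos x) (-1) d.+1 = 1.
  apply: (mulIf sinx); rewrite mul1r lucas_sin xE mulnS (addnC a).
  by rewrite sin_polygon_turn ?n_dvd.
have fn0 i : (0 < i < d)%N -> lucas (2 * cos x) (-1) i != 0.
  move=> /andP[i_gt0 lt_id]; have : sin (x *+ i) != 0.
    by rewrite xE; apply: sin_polygon_neq0 => //; rewrite n_dvd gtnNdvd.
  by rewrite -lucas_sin; apply: contraNneq => ->; rewrite mul0r.
rewrite fixed_ncp_gcd // eN.
exact: (card_ncp_rotation_narayana d_gt2 d_odd f0 f1 fn0 n_dM).
Qed.

Theorem trace_ncp g : g \in I2 n ->
  \tr (U g) = lucas_narayana (\tr (z1 R n_gt2 g)) (- \tr (det_rep R n_gt2 g)) k l.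
Proof.
move=> /I2_normal_form[a [b ->]].
rewrite -(expg_mod b (refl_perm_sqr n)) modn2; case: (odd b).
  rewrite expg1 trace_z1_rot_refl trace_det_rot_refl opprK.
  exact: trace_reflection.
by rewrite expg0 mulg1 trace_z1_rot trace_det_rot trace_rotation.
Qed.

End FixedPoints.

Theorem proposition5p2 (R : realType) (n k : nat) (n_ge3 : (3 <= n)%N)
    (n_odd : odd n) (k_le : (k <= n - 1)%N) :
  exists P : {poly {poly int}},
    P%:F = (fibpoly n)%:F^-1 * fibonomial n k * fibonomial n k.+1 /\
    dihedral_sieving R n_ge3 (ncp_acts n (n - k)%N) P.
Proof.
have lt_kn : (k < n)%N by lia.
exists (lucas_narayana 'X 'Y k (n - k.+1)); split; first exact: narayana_fraction.
have [l def_n] : exists l, n = (k + l).+1 by exists (n - k.+1)%N; lia.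
subst n; rewrite /dihedral_sieving lucas_narayana_eval.
have -> : ((k + l).+1 - k.+1 = l)%N by lia.
have -> : ((k + l).+1 - k = l.+1)%N by lia.
apply: affords_inj (affords_rep _) _; first exact: pchar_num.
have [U [V [UV trUV]]] := affords_lucas_narayana k l
  (affords_rep (z1 R n_ge3)) (affordsN (affords_rep (det_rep R n_ge3))).
by exists U, V; split=> // g Gg; rewrite -trUV // trace_ncp.
Qed.
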